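(* Let $(K,\mathcal{O},k)$ be an $l$-modular system. Let $A,B$ be split quasi-hereditary algebras over $\mathcal{O}$ with respect to posets $\Lambda,\Upsilon$ respectively, and suppose that $KA$ and $KB$ are semisimple. Let $T$ be an $A$-$B$-bimodule which is a $K$-$k$-tilting module at the same time as a left $A$-module and as a right $B$-module. Suppose that the functors $$KT\otimes_{KB}-\colon KB\text{-mod}\to KA\text{-mod},\qquad -\otimes_{KA}KT\colon \text{mod-}KA\to\text{mod-}KB$$ are equivalences of categories, such that the resulting bijections of irreducible modules define order-reversing maps between $\Lambda$ and $\Upsilon$. Then $kT$ defines a Ringel duality between $kA$ and $kB^{op}$. Furthermore, $B\cong\mathrm{End}_A(T)$ and $A\cong\mathrm{End}_B(T)$.
   Context: $l$-modular system: $\mathcal{O}$ is a discrete valuation ring with field of fractions $K$ of characteristic $0$ and residue field $k$ of characteristic $l$; $KX=K\otimes_{\mathcal{O}}X$, $kX=k\otimes_{\mathcal{O}}X$. Split quasi-hereditary algebra over $\mathcal{O}$ (Cline–Parshall–Scott): an $\mathcal{O}$-algebra $A$, free of finite rank over $\mathcal{O}$, having a finite chain of two-sided ideals $0=J_0\subset J_1\subset\dots\subset J_t=A$ such that each $J=J_i/J_{i-1}$ is a split heredity ideal of $\bar A=A/J_{i-1}$: $\bar A/J$ is $\mathcal{O}$-projective, $J$ is projective as a left $\bar A$-module, $J^2=J$, and $\mathrm{End}_{\bar A}(J)$ is split (a product of algebras $\mathrm{End}_{\mathcal O}(V)$ with $V$ free over $\mathcal{O}$), with the simples labelled by the poset compatibly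 with the chain. Then $KA$ and $kA$ are split quasi-hereditary algebras over $K$ and $k$, with standard modules $K\Delta(\lambda)$, $k\Delta(\lambda)$ obtained from $\mathcal{O}$-free standard modules $\Delta(\lambda)$, $\lambda\in\Lambda$. When $KA$ is semisimple its irreducible modules are the $K\Delta(\lambda)$, so are labelled by $\Lambda$. The category of right modules is quasi-hereditary with the same poset. A tilting module for a quasi-hereditary algebra $S$ over a field is a finite-dimensional module having both a filtration by standard modules and a filtration by costandard modules. Indecomposable tilting modules $T(\lambda)$ are labelled by the poset ($[T(\lambda):L(\lambda)]=1$, all other composition factors $L(\mu)$ having $\mu<\lambda$). A full tilting module is a tilting module in which every $T(\lambda)$ occurs as a direct summand. A Ringel dual of $S$ is $\mathrm{End}_S(T)^{op}$ with $T$ a full tilting module. For an $S$-$B$-bimodule $T$, with endomorphisms of left modules written on the right, $T$ defines a Ringel duality between $S$ and $S'=B^{op}$ if $T$ is a full tilting left $S$-module and the right action identifies $B$ with $\mathrm{End}_S(T)$. $K$-$k$-tilting module: for a split quasi-hereditary $\mathcal{O}$-algebra $A$, a finitely generated $\mathcal{O}$-free $A$-module $T$ such that $KT$ is a tilting module for $KA$ and $kT$ is a tilting module for $kA$ (and similarly for right modules). *)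

(* Defs.v *)
From HB Require Import structures.
From mathcomp Require Import all_boot all_order all_algebra.
Set Implicit Arguments. Unset Strict Implicit. Unset Printing Implicit Defensive.
Import Order.TTheory GRing.Theory VectorInternalTheory.
Local Open Scope ring_scope.

Local Notation "R ^c" := (GRing.converse R) : type_scope.

(* [O] is the valuation ring of a surjective discrete valuation [v] on its    *)
(* fraction field [K] (the value of [v] at [0] is irrelevant), and [ik] is the *)
(* reduction modulo the maximal ideal of [O], which consists of the non-units. *)
Definition modular_system (l : nat) (O : idomainType) (K k : fieldType)
    (iK : {rmorphism O -> K}) (ik : {rmorphism O -> k}) : Prop :=
  [/\ injective iK
      /\ (forall x : K, exists a b, b != 0 /\ x = iK a / iK b),
      exists v : K -> int,
        [/\ forall x y, x != 0 -> y != 0 -> v (x * y) = v x + v y,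
            forall x y, x != 0 -> y != 0 -> x + y != 0 ->
              Order.min (v x) (v y) <= v (x + y),
            forall n : int, exists2 x, x != 0 & v x = n
          & forall x, x != 0 -> (0 <= v x <-> exists a, iK a = x)],
      (forall y, exists a, ik a = y)
      /\ (forall a, ik a = 0 <-> a \isn't a GRing.unit),
      [pchar K] =i pred0
    & l \in [pchar k]].

(* As always for the rings of the library, these algebras satisfy [1 != 0].   *)
#[short(type="freeAlgType")]
HB.structure Definition FreeAlg (R : nzRingType) :=
  { A of GRing.Algebra R A & Vector R A }.

Section Opposite.
Variables (R : comNzRingType) (A : freeAlgType R).

HB.instance Definition _ := Vector.on A^c.

Fact conv_scalerAl (c : R) (x y : A^c) :
  c *: (x * y : A^c) = (c *: x : A^c) * y.
Proof. exact: (@scalerAr R A c y x). Qed.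
HB.instance Definition _ := GRing.Lmodule_isLalgebra.Build R A^c conv_scalerAl.

Fact conv_scalerAr (c : R) (x y : A^c) :
  c *: (x * y : A^c) = x * (c *: y : A^c).
Proof. exact: (@scalerAl R A c y x). Qed.
HB.instance Definition _ := GRing.Lalgebra_isAlgebra.Build R A^c conv_scalerAr.

End Opposite.


(* Over a field these are the finite-dimensional [S]-modules. A right         *)
(* [S]-module is a left module over the opposite algebra [S^c].               *)
Record fmod (R : comNzRingType) (S : freeAlgType R) := FMod {
  fcar :> vectType R;
  act : S -> fcar -> fcar;
  act_linl : forall x, linear (act^~ x);
  act_linr : forall a, linear (act a);
  act1 : forall x, act 1 x = x;
  actM : forall a b x, act (a * b) x = act a (act b x) }.

Record mhom (R : comNzRingType) (S : freeAlgType R) (M N : fmod S) := MHom {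
  hfun :> {linear M -> N};
  mhom_act : forall a x, hfun (act a x) = act a (hfun x) }.

Section Modules.
Variables (R : comNzRingType) (S : freeAlgType R).
Implicit Types M N P Q X Y : fmod S.

Definition mhom_id M : mhom M M := @MHom R S M M idfun (fun _ _ => erefl).

Definition mhom_comp M N P (g : mhom N P) (f : mhom M N) : mhom M P.
Proof.
exists (g \o f : {linear M -> P}) => a x /=.
by rewrite !mhom_act.
Defined.

Definition surj M N (f : mhom M N) : Prop := forall y, exists x, f x = y.

Definition iso M N : Prop := exists f : mhom M N, bijective f.

Definition zero_mod M : Prop := forall x : M, x = 0.

Definition short_exact N M Q (i : mhom N M) (p : mhom M Q) : Prop :=
  [/\ injective i, surj p & forall y, p y = 0 <-> exists x, i x = y].

Definition direct_sum n (D : 'I_n -> fmod S) M : Prop :=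
  exists (i : forall j, mhom (D j) M) (p : forall j, mhom M (D j)),
    [/\ forall j x, p j (i j x) = x,
        forall j j' x, j != j' -> p j' (i j x) = 0
      & forall x, x = \sum_j i j (p j x)].

Definition summand N M : Prop :=
  exists (i : mhom N M) (p : mhom M N), forall x, p (i x) = x.

Definition regular : fmod S.
Proof.
exists (S : vectType R) (fun a x => a * x) => [x c a b|a c x y|x|a b x].
- by rewrite mulrDl scalerAl.
- by rewrite mulrDr scalerAr.
- exact: mul1r.
- by rewrite mulrA.
Defined.

(* Finitely generated projective: a direct summand of some [S^n]. *)
Definition projective P : Prop :=
  exists n F, direct_sum (fun _ : 'I_n => regular) F /\ summand P F.

(* [filtration X M s]: [M] has a finite filtration whose successive quotients, *)
(* read from the top, are in the classes [X] of the labels listed in [s].      *)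
Inductive filtration (L : Type) (X : L -> fmod S -> Prop) :
    fmod S -> seq L -> Prop :=
| FiltNil M : zero_mod M -> filtration X M [::]
| FiltCons M N Q l s (i : mhom N M) (p : mhom M Q) :
    short_exact i p -> X l Q -> filtration X N s -> filtration X M (l :: s).

(* [End_S(M)] is isomorphic, as an [R]-algebra, to a finite product of         *)
(* algebras [End_R(V j)]; [phi] is the isomorphism onto [End_S(M)].            *)
Definition split_end M : Prop :=
  exists (J : finType) (V : J -> vectType R)
         (phi : (forall j, 'End(V j)) -> 'End(M)),
    [/\ forall c u v, phi (fun j => c *: u j + v j) = c *: phi u + phi v,
        phi (fun j => \1%VF) = \1%VF
        /\ forall u v, phi (fun j => (u j \o v j)%VF) = (phi u \o phi v)%VF,
        forall u v, phi u = phi v -> forall j, u j = v j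
      & forall f : 'End(M), (exists u, phi u = f) <->
                            (forall a x, f (act a x) = act a (f x))].

End Modules.

Section Restriction.
Variables (R : comNzRingType) (A B : freeAlgType R) (p : {lrmorphism A -> B}).

Definition restrict (M : fmod B) : fmod A.
Proof.
exists (M : vectType R) (fun a x => act (p a) x) => [x c a b|a c x y|x|a b x].
- by rewrite linearP act_linl.
- exact: act_linr.
- by rewrite rmorph1 act1.
- by rewrite rmorphM actM.
Defined.

End Restriction.

Section FieldModules.
Variables (F : fieldType) (S : freeAlgType F).
Implicit Types M X : fmod S.

Definition stable M (U : {vspace M}) : Prop :=
  forall a x, x \in U -> act a x \in U.

Definition simple M : Prop :=
  ~ zero_mod M
  /\ forall U : {vspace M}, stable U -> U = 0%VS \/ U = fullv.

Definition indecomposable M : Prop :=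
  ~ zero_mod M
  /\ forall U W : {vspace M}, stable U -> stable W ->
       (U + W)%VS = fullv -> (U :&: W)%VS = 0%VS -> U = 0%VS \/ W = 0%VS.

Definition semisimple_alg : Prop :=
  exists n (D : 'I_n -> fmod S),
    (forall j, simple (D j)) /\ direct_sum D (regular S).

End FieldModules.

Section Dual.
Variables (R : comNzRingType) (S : freeAlgType R) (M : fmod S).

Definition dual_act (a : S^c) (f : 'Hom(M, R^o)) : 'Hom(M, R^o) :=
  linfun (fun x => f (act (a : S) x) : R^o).

Fact dual_actE a f x : dual_act a f x = f (act (a : S) x).
Proof.
have lin : linear (fun x => f (act (a : S) x) : R^o).
  by move=> c y z; rewrite act_linr linearP.
pose g : {linear M -> R^o} :=
  HB.pack (fun x => f (act (a : S) x) : R^o) (GRing.isLinear.Build _ _ _ _ _ lin).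
by rewrite /dual_act -[LHS]/(linfun g x) lfunE.
Qed.

(* [Hom_R(M, R)], a right [S]-module via [(f a)(x) = f (a x)]. *)
Definition dual : fmod S^c.
Proof.
exists ('Hom(M, R^o) : vectType R) dual_act => [f c a b|a c f g|f|a b f];
  apply/lfunP => x; rewrite ?(add_lfunE, scale_lfunE, dual_actE) //.
- by rewrite act_linl linearP.
- by rewrite act1.
- by rewrite -actM.
Defined.

End Dual.

Record bimod (R : comNzRingType) (A B : freeAlgType R) := BiMod {
  bcar :> vectType R;
  lact : A -> bcar -> bcar;
  ract : bcar -> B -> bcar;
  lact_linl : forall x, linear (lact^~ x);
  lact_linr : forall a, linear (lact a);
  lact1 : forall x, lact 1 x = x;
  lactM : forall a b x, lact (a * b) x = lact a (lact b x);
  ract_linl : forall b, linear (ract^~ b);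
  ract_linr : forall x, linear (ract x);
  ract1 : forall x, ract x 1 = x;
  ractM : forall a b x, ract x (a * b) = ract (ract x a) b;
  lractA : forall a x b, lact a (ract x b) = ract (lact a x) b }.

Section Bimodules.
Variables (R : comNzRingType) (A B : freeAlgType R) (T : bimod A B).

Definition lmod : fmod A :=
  FMod (@lact_linl R A B T) (@lact_linr R A B T) (@lact1 R A B T)
       (@lactM R A B T).

Definition rmod : fmod B^c :=
  @FMod R B^c T (fun b x => ract x b) (@ract_linr R A B T) (@ract_linl R A B T)
       (@ract1 R A B T) (fun a b => @ractM R A B T b a).

Definition flip : bimod B^c A^c :=
  @BiMod R B^c A^c T (fun b x => ract x b) (fun x a => @lact R A B T a x)
    (@ract_linr R A B T) (@ract_linl R A B T) (@ract1 R A B T)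
    (fun a b => @ractM R A B T b a)
    (@lact_linr R A B T) (@lact_linl R A B T) (@lact1 R A B T)
    (fun a b => @lactM R A B T b a) (fun b x a => esym (@lractA R A B T a x b)).

(* The right action is an isomorphism from [B] onto [End_A(T)] (endomorphisms  *)
(* of left modules being written on the right).                               *)
Definition right_action_iso : Prop :=
  forall f : mhom lmod lmod, exists! b : B, forall x, f x = ract x b.

(* The left action is an isomorphism from [A] onto [End_B(T)]. *)
Definition left_action_iso : Prop :=
  forall f : mhom rmod rmod, exists! a : A, forall x, f x = lact a x.

End Bimodules.

(* For [V] free over [R] with its chosen basis, [F (x)_R V] is realised as the *)
(* space of [F]-coordinate vectors in that basis, and [bcin v] is [1 (x) v].   *)
Definition bc (R F : comNzRingType) (phi : {rmorphism R -> F})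
  (V : vectType R) : Type := 'rV[F]_(dim V).

HB.instance Definition _ (R F : comNzRingType) (phi : {rmorphism R -> F})
  (V : vectType R) := Vector.on (bc phi V).

Lemma lin0 (R : nzRingType) (V W : lmodType R) (f : V -> W) : linear f -> f 0 = 0.
Proof. by move=> /(_ (-1) 0 0); rewrite !scaleN1r !oppr0 addr0 addNr. Qed.

Lemma lin_sum (R : nzRingType) (V W : lmodType R) (f : V -> W) n
    (c : 'I_n -> R) (v : 'I_n -> V) :
  linear f -> f (\sum_i c i *: v i) = \sum_i c i *: f (v i).
Proof.
move=> lf; elim: n c v => [|n IH] c v; first by rewrite !big_ord0 (lin0 lf).
by rewrite !big_ord_recl lf IH.
Qed.

Definition bbasis (R : nzRingType) (V : vectType R) (i : 'I_(dim V)) : V := r2v (delta_mx 0 i).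

Lemma bbasis_sum (R : nzRingType) (V : vectType R) (x : V) : x = \sum_i v2r x 0 i *: bbasis i.
Proof.
rewrite -[LHS]v2rK [v2r x in LHS]row_sum_delta linear_sum.
by apply: eq_bigr => i _; rewrite linearZ.
Qed.

Lemma basis_ext (R : nzRingType) (V : vectType R) (W : lmodType R)
    (f g : V -> W) :
  linear f -> linear g -> (forall i, f (bbasis i) = g (bbasis i)) -> f =1 g.
Proof.
move=> lf lg fg x; rewrite [x]bbasis_sum !lin_sum //.
by apply: eq_bigr => i _; rewrite fg.
Qed.

Section BaseChange.
Variables (R F : comNzRingType) (phi : {rmorphism R -> F}).
Local Notation bc := (bc phi).
Implicit Types U V W : vectType R.

Definition bcin V (x : V) : bc V := map_mx phi (v2r x).

Lemma bcinP V c (x y : V) : bcin (c *: x + y) = phi c *: bcin x + bcin y.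
Proof. by rewrite /bcin linearP map_mxD map_mxZ. Qed.

Lemma bcin0 V : bcin (0 : V) = 0.
Proof. by rewrite /bcin linear0 map_mx0. Qed.

Lemma bcin_basis V i : bcin (@bbasis _ V i) = delta_mx 0 i.
Proof. by rewrite /bcin r2vK map_delta_mx. Qed.

Lemma bc_sum V (u : bc V) : u = \sum_i u 0 i *: bcin (@bbasis _ V i).
Proof.
rewrite [LHS]row_sum_delta.
by apply: eq_bigr => i _; rewrite bcin_basis.
Qed.

Lemma bc_ind V (P : bc V -> Prop) :
  P 0 -> (forall x, P (bcin x)) ->
  (forall c u v, P u -> P v -> P (c *: u + v)) -> forall u, P u.
Proof.
move=> P0 Pin Plin u; rewrite (bc_sum u).
by apply: big_rec => // i v _ Pv; apply: Plin.
Qed.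

(* The [F]-bilinear extension of a bilinear map. *)
Definition bcbil U V W (b : U -> V -> W) (u : bc U) (v : bc V) : bc W :=
  \sum_i \sum_j (u 0 i * v 0 j) *: bcin (b (bbasis i) (bbasis j)).

Section Bilinear.
Variables (U V W : vectType R) (b : U -> V -> W).

Lemma bcbil_linl v : linear (bcbil b ^~ v).
Proof.
move=> c u u'; rewrite /bcbil scaler_sumr -big_split; apply: eq_bigr => i _ /=.
rewrite scaler_sumr -big_split; apply: eq_bigr => j _ /=.
by rewrite !mxE mulrDl scalerDl scalerA mulrA.
Qed.

Lemma bcbil_linr u : linear (bcbil b u).
Proof.
move=> c v v'; rewrite /bcbil scaler_sumr -big_split; apply: eq_bigr => i _ /=.
rewrite scaler_sumr -big_split; apply: eq_bigr => j _ /=.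
by rewrite !mxE mulrDr scalerDl scalerA mulrCA.
Qed.

Hypotheses (bl : forall y, linear (b^~ y)) (br : forall x, linear (b x)).

Lemma bcbil_in x y : bcbil b (bcin x) (bcin y) = bcin (b x y).
Proof.
have bcin_sum n (c : 'I_n -> R) (w : 'I_n -> W) :
    bcin (\sum_i c i *: w i) = \sum_i phi (c i) *: bcin (w i).
  elim: n c w => [|n IH] c w; first by rewrite !big_ord0 bcin0.
  by rewrite !big_ord_recl bcinP IH.
rewrite [x in RHS]bbasis_sum [y in RHS]bbasis_sum (lin_sum _ _ (bl _)) bcin_sum.
apply: eq_bigr => i _; rewrite (lin_sum _ _ (br _)) bcin_sum scaler_sumr.
by apply: eq_bigr => j _; rewrite !mxE scalerA.
Qed.

End Bilinear.

Lemma bc_ext V (W : lmodType F) (f g : bc V -> W) :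
  linear f -> linear g -> (forall x, f (bcin x) = g (bcin x)) -> f =1 g.
Proof.
move=> lf lg fg; apply: bc_ind => // [|c u v fu fv].
  by rewrite (lin0 lf) (lin0 lg).
by rewrite lf lg fu fv.
Qed.

End BaseChange.

Section BaseChangeAlgebra.
Variables (R F : comNzRingType) (phi : {rmorphism R -> F}) (A : freeAlgType R).
Local Notation FA := (bc phi A).

Let mulA (x y : A) : A := x * y.
Let mul_linl y : linear (mulA ^~ y).
Proof. by move=> c x x'; rewrite /mulA mulrDl scalerAl. Qed.
Let mul_linr x : linear (mulA x).
Proof. by move=> c y y'; rewrite /mulA mulrDr scalerAr. Qed.

Definition bcmul (u v : FA) : FA := bcbil (fun x y : A => x * y) u v.
Definition bcone : FA := bcin phi (1 : A).

Lemma bcmul_in (x y : A) : bcmul (bcin phi x) (bcin phi y) = bcin phi (x * y).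
Proof. exact: (bcbil_in phi mul_linl mul_linr). Qed.

Let bcmul_linl v : linear (bcmul ^~ v). Proof. exact: bcbil_linl. Qed.
Let bcmul_linr u : linear (bcmul u). Proof. exact: bcbil_linr. Qed.

Fact bcmul1 : left_id bcone bcmul.
Proof.
apply: bc_ext => [|c u v|x] //.
by rewrite bcmul_in mul1r.
Qed.
Fact bcmulr1 : right_id bcone bcmul.
Proof.
apply: bc_ext => [|c u v|x] //.
by rewrite bcmul_in mulr1.
Qed.
Fact bcmulDl : left_distributive bcmul +%R.
Proof. by move=> u u' v; have := bcmul_linl v 1 u u'; rewrite !scale1r. Qed.
Fact bcmulDr : right_distributive bcmul +%R.
Proof. by move=> u v v'; have := bcmul_linr u 1 v v'; rewrite !scale1r. Qed.
Fact bcmul_scalerAl (c : F) (u v : FA) : c *: bcmul u v = bcmul (c *: u) v.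
Proof.
have := bcmul_linl v c u 0; rewrite addr0 => ->.
by rewrite (lin0 (bcmul_linl v)) addr0.
Qed.
Fact bcmul_scalerAr (c : F) (u v : FA) : c *: bcmul u v = bcmul u (c *: v).
Proof.
have := bcmul_linr u c v 0; rewrite addr0 => ->.
by rewrite (lin0 (bcmul_linr u)) addr0.
Qed.

Fact bcmulA : associative bcmul.
Proof.
move=> u v w; move: u.
apply: bc_ext => [c u u'|c u u'|x]; rewrite ?bcmul_linl //.
move: v; apply: bc_ext => [c v v'|c v v'|y].
- by rewrite bcmul_linl bcmul_linr.
- by rewrite bcmul_linr bcmul_linl.
move: w; apply: bc_ext => [c w w'|c w w'|z]; rewrite ?bcmul_linr //.
by rewrite !bcmul_in mulrA.
Qed.

Fact bcone_neq0 : bcone != 0.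
Proof.
apply/eqP => one0.
have bc0 (u : FA) : u = 0 by rewrite -[u]bcmul1 one0 (lin0 (bcmul_linl u)).
have [dA0 | dA_gt0] := posnP (dim A).
  have /eqP[] := oner_neq0 A; rewrite [1]bbasis_sum big1 // => -[m lt_m] _.
  by exfalso; move: lt_m; rewrite dA0.
have /matrixP/(_ 0 (Ordinal dA_gt0))/eqP := bc0 (delta_mx 0 (Ordinal dA_gt0)).
by rewrite !mxE !eqxx oner_eq0.
Qed.

HB.instance Definition _ := GRing.Zmodule_isNzRing.Build FA
  bcmulA bcmul1 bcmulr1 bcmulDl bcmulDr bcone_neq0.
HB.instance Definition _ := GRing.Lmodule_isLalgebra.Build F FA bcmul_scalerAl.
HB.instance Definition _ := GRing.Lalgebra_isAlgebra.Build F FA bcmul_scalerAr.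

End BaseChangeAlgebra.

Section BaseChangeModules.
Variables (R F : comNzRingType) (phi : {rmorphism R -> F}) (A B : freeAlgType R).

Fact bcact1 (M : fmod A) (u : bc phi M) :
  bcbil (@act R A M) (1 : bc phi A) u = u.
Proof.
move: u; apply: bc_ext => [||x] //; first exact: bcbil_linr.
by rewrite (bcbil_in phi (@act_linl R A M) (@act_linr R A M)) act1.
Qed.

Fact bcactM (M : fmod A) (a b : bc phi A) (u : bc phi M) :
  bcbil (@act R A M) (a * b) u = bcbil (@act R A M) a (bcbil (@act R A M) b u).
Proof.
have actin := bcbil_in phi (@act_linl R A M) (@act_linr R A M).
have multl (c : bc phi A) : linear ( *%R^~ c).
  by move=> d y z; rewrite mulrDl scalerAl.
have multr (c : bc phi A) : linear ( *%R c).
  by move=> d y z; rewrite mulrDr scalerAr.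
move: a; apply: bc_ext => [c a a'||x]; try exact: bcbil_linl.
  by rewrite multl bcbil_linl.
move: b; apply: bc_ext => [c b b'|c b b'|y].
- by rewrite multr bcbil_linl.
- by rewrite bcbil_linl bcbil_linr.
move: u; apply: bc_ext => [c u u'|c u u'|z].
- by rewrite bcbil_linr.
- by rewrite !bcbil_linr.
by rewrite [_ * _]bcmul_in !actin actM.
Qed.

(* [F (x)_R M], a module over [F (x)_R A] via [(1 (x) a)(1 (x) x) = 1 (x) a x]. *)
Definition bc_mod (M : fmod A) : fmod (bc phi A) :=
  @FMod F (bc phi A) (bc phi M) (bcbil (@act R A M))
    (bcbil_linl _) (bcbil_linr _) (@bcact1 M) (@bcactM M).

Variable T : bimod A B.
Let lT := lmod T.

Fact bcract1 (u : bc phi T) : bcbil (@ract R A B T) u (1 : bc phi B) = u.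
Proof.
move: u; apply: bc_ext => [||x] //; first exact: bcbil_linl.
by rewrite (bcbil_in phi (@ract_linl R A B T) (@ract_linr R A B T)) ract1.
Qed.

Fact bcractM (a b : bc phi B) (u : bc phi T) :
  bcbil (@ract R A B T) u (a * b) =
  bcbil (@ract R A B T) (bcbil (@ract R A B T) u a) b.
Proof.
have actin := bcbil_in phi (@ract_linl R A B T) (@ract_linr R A B T).
have multl (c : bc phi B) : linear ( *%R^~ c).
  by move=> d y z; rewrite mulrDl scalerAl.
have multr (c : bc phi B) : linear ( *%R c).
  by move=> d y z; rewrite mulrDr scalerAr.
move: a; apply: bc_ext => [c a a'|c a a'|x].
- by rewrite multl bcbil_linr.
- by rewrite bcbil_linr bcbil_linl.
move: b; apply: bc_ext => [c b b'||y]; try exact: bcbil_linr.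
  by rewrite multr bcbil_linr.
move: u; apply: bc_ext => [c u u'|c u u'|z].
- by rewrite bcbil_linl.
- by rewrite !bcbil_linl.
by rewrite [_ * _]bcmul_in !actin ractM.
Qed.

Fact bclractA (a : bc phi A) (u : bc phi T) (b : bc phi B) :
  bcbil (@lact R A B T) a (bcbil (@ract R A B T) u b) =
  bcbil (@ract R A B T) (bcbil (@lact R A B T) a u) b.
Proof.
have lactin := bcbil_in phi (@lact_linl R A B T) (@lact_linr R A B T).
have ractin := bcbil_in phi (@ract_linl R A B T) (@ract_linr R A B T).
move: a; apply: bc_ext => [||x].
- exact: bcbil_linl.
- by move=> c a a'; rewrite !bcbil_linl.
move: u; apply: bc_ext => [c u u'|c u u'|z].
- by rewrite bcbil_linl bcbil_linr.
- by rewrite bcbil_linr bcbil_linl.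
move: b; apply: bc_ext => [c b b'|c b b'|y].
- by rewrite !bcbil_linr.
- by rewrite bcbil_linr.
by rewrite !(lactin, ractin) lractA.
Qed.

Definition bc_bimod : bimod (bc phi A) (bc phi B) :=
  @BiMod F (bc phi A) (bc phi B) (bc phi T)
    (bcbil (@lact R A B T)) (bcbil (@ract R A B T))
    (bcbil_linl _) (bcbil_linr _) (@bcact1 lT) (@bcactM lT)
    (bcbil_linl _) (bcbil_linr _) bcract1 bcractM bclractA.

End BaseChangeModules.

Section Functors.
Variables (R : comNzRingType).

Record functor (S S' : freeAlgType R) := Functor {
  fobj :> fmod S -> fmod S';
  fmap : forall M N, mhom M N -> mhom (fobj M) (fobj N);
  fmap_ext : forall M N (f g : mhom M N), f =1 g -> fmap f =1 fmap g;
  fmap_id : forall M, fmap (mhom_id M) =1 id;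
  fmap_comp : forall M N P (g : mhom N P) (f : mhom M N),
    fmap (mhom_comp g f) =1 fmap g \o fmap f }.

Definition functor_id (S : freeAlgType R) : functor S S.
Proof. by exists id (fun _ _ f => f). Defined.

Definition functor_comp (S1 S2 S3 : freeAlgType R)
  (G : functor S2 S3) (E : functor S1 S2) : functor S1 S3.
Proof.
exists (fun M => G (E M)) (fun M N f => fmap G (fmap E f)).
- by move=> M N f g fg; do 2!apply: fmap_ext.
- move=> M x; rewrite (fmap_ext (g := mhom_id (E M))) ?fmap_id //.
  exact: fmap_id.
- move=> M N P g f x.
  by rewrite (fmap_ext (g := mhom_comp (fmap E g) (fmap E f))) ?fmap_comp //;
    apply: fmap_comp.
Defined.

Definition naturally_iso (S S' : freeAlgType R) (E G : functor S S') : Prop :=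
  exists eta : forall M, mhom (E M) (G M),
    (forall M, bijective (eta M))
    /\ forall M N (f : mhom M N) x, eta N (fmap E f x) = fmap G f (eta M x).

Definition is_equivalence (S S' : freeAlgType R) (E : functor S S') : Prop :=
  exists G : functor S' S,
    naturally_iso (functor_comp G E) (functor_id S)
    /\ naturally_iso (functor_comp E G) (functor_id S').

End Functors.

Section Quotient.
Variables (F : fieldType) (W : vectType F) (U : {vspace W}).

(* The quotient space [W / U], realised on a complement of [U]. *)
Definition vquot : vectType F := subvs_of (U^C)%VS.
Definition vquot_pi (w : W) : vquot := vsproj (U^C) (daddv_pi (U^C) U w).
Definition vquot_repr (q : vquot) : W := vsval q.

Lemma vquot_pi_linear : linear vquot_pi.
Proof. by move=> c x y; rewrite /vquot_pi !linearP. Qed.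

Lemma vquot_repr_linear : linear vquot_repr.
Proof. by move=> c x y; rewrite /vquot_repr linearP. Qed.

Lemma vquot_piK w : vquot_repr (vquot_pi w) = daddv_pi (U^C) U w.
Proof. by rewrite /vquot_repr /vquot_pi vsprojK ?memv_pi. Qed.

Lemma vquot_reprK : cancel vquot_repr vquot_pi.
Proof.
move=> q; apply: (can_inj (@vsvalK _ _ _)).
by rewrite -[LHS]/(vquot_repr _) vquot_piK daddv_pi_id ?subvsP // capvC capv_compl.
Qed.

Lemma vquot_pi_eq0 w : vquot_pi w = 0 <-> w \in U.
Proof.
have dUC : (U^C :&: U = 0)%VS by rewrite capvC capv_compl.
have UCw : w \in (U^C + U)%VS by rewrite addvC addv_complf memvf.
have repr0 : vquot_repr 0 = 0 := lin0 vquot_repr_linear.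
split=> [w0|Uw].
  rewrite -(daddv_pi_add dUC UCw) -vquot_piK w0 repr0 add0r.
  exact: memv_pi.
apply: (can_inj vquot_reprK); rewrite vquot_piK repr0.
apply: (addIr (daddv_pi U (U^C) w)); rewrite (daddv_pi_add dUC UCw) add0r.
by rewrite daddv_pi_id // capv_compl.
Qed.

End Quotient.

Section Tensor.
Variables (F : fieldType) (S B : freeAlgType F) (T : bimod S B).

Section Module.
Variable M : fmod B.

(* [T (x)_F M], with [t (x) m] the product of the coordinate vectors of [t]    *)
(* and [m].                                                                   *)
Definition tmx : vectType F := 'M[F]_(dim T, dim M).
Definition tpure (t : T) (m : M) : tmx := (v2r t)^T *m v2r m.

(* The relations [t b (x) m = t (x) b m]; letting [t], [b], [m] run over bases *)
(* gives all of them.                                                         *)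
Definition tbal (t : T) (b : B) (m : M) : tmx :=
  tpure (ract t b) m - tpure t (act b m).

Definition tker : {vspace tmx} :=
  (\sum_(x : 'I_(dim T) * 'I_(dim B) * 'I_(dim M))
     <[tbal (bbasis x.1.1) (bbasis x.1.2) (bbasis x.2)]>)%VS.

Definition tquot : vectType F := vquot tker.
Definition tpi (w : tmx) : tquot := vquot_pi tker w.

Lemma tpure_linl m : linear (tpure^~ m).
Proof.
by move=> c t t'; rewrite /tpure linearP /= linearP /= mulmxDl scalemxAl.
Qed.
Lemma tpure_linr t : linear (tpure t).
Proof. by move=> c m m'; rewrite /tpure linearP mulmxDr scalemxAr. Qed.

Lemma tpi_linear : linear tpi. Proof. exact: vquot_pi_linear. Qed.

Lemma tpi_surj q : exists w, tpi w = q.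
Proof. by exists (vquot_repr q); apply: vquot_reprK. Qed.

Lemma tbal_ext (V : lmodType F) (f : tmx -> V) : linear f ->
  (forall i j k, f (tbal (bbasis i) (bbasis j) (bbasis k)) = 0) ->
  forall t b m, f (tbal t b m) = 0.
Proof.
move=> lf f0 t b m;
move: t; apply: (basis_ext (g := fun=> 0)) => [c t t'|c _ _|i].
- rewrite -lf; congr f; rewrite /tbal ract_linl !tpure_linl scalerBr.
  by rewrite opprD addrACA.
- by rewrite scaler0 addr0.
move: b; apply: (basis_ext (g := fun=> 0)) => [c b b'|c _ _|j].
- rewrite -lf; congr f; rewrite /tbal ract_linr act_linl tpure_linl tpure_linr.
  by rewrite scalerBr opprD addrACA.
- by rewrite scaler0 addr0.
move: m; apply: (basis_ext (g := fun=> 0)) => [c m m'|c _ _|k] //.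
- rewrite -lf; congr f; rewrite /tbal act_linr !tpure_linr scalerBr.
  by rewrite opprD addrACA.
- by rewrite scaler0 addr0.
Qed.

Lemma tbal_tker t b m : tbal t b m \in tker.
Proof.
apply/vquot_pi_eq0; apply: tbal_ext; first exact: tpi_linear.
move=> i j k; apply/vquot_pi_eq0; apply: (subvP (sumv_sup (i, j, k) _ _)) => //.
exact: memv_line.
Qed.

Lemma tker_kill (V : vectType F) (f : tmx -> V) : linear f ->
  (forall t b m, f (tbal t b m) = 0) -> forall w, w \in tker -> f w = 0.
Proof.
move=> lf f0 w; pose g : {linear tmx -> V} :=
  HB.pack f (GRing.isLinear.Build _ _ _ _ f lf).
suff /subvP sub : (tker <= lker (linfun g))%VS.
  by move=> /sub; rewrite memv_ker lfunE => /eqP.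
apply/subv_sumP => x _; rewrite -memvE memv_ker lfunE /=.
by apply/eqP/f0.
Qed.

Lemma tpi_repr (V : vectType F) (f : tmx -> V) : linear f ->
  (forall t b m, f (tbal t b m) = 0) ->
  forall w, f (vquot_repr (tpi w)) = f w.
Proof.
move=> lf f0 w; apply/eqP; rewrite -subr_eq0; apply/eqP.
have <- : f (vquot_repr (tpi w) - w) = f (vquot_repr (tpi w)) - f w.
  by have := lf (-1) w (vquot_repr (tpi w)); rewrite !scaleN1r ![- _ + _]addrC.
apply: (tker_kill lf f0); apply/vquot_pi_eq0.
have := tpi_linear (-1) w (vquot_repr (tpi w)).
rewrite !scaleN1r ![- _ + _]addrC /tpi => ->.
by rewrite vquot_reprK subrr.
Qed.

Lemma tmx_ext (V : lmodType F) (f g : tmx -> V) : linear f -> linear g ->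
  (forall t m, f (tpure t m) = g (tpure t m)) -> f =1 g.
Proof.
move=> lf lg fg w; suff -> : w = \sum_i \sum_j w i j *: tpure (bbasis i) (bbasis j).
  have E (h : tmx -> V) : linear h ->
      h (\sum_i \sum_j w i j *: tpure (bbasis i) (bbasis j))
      = \sum_i \sum_j w i j *: h (tpure (bbasis i) (bbasis j)).
    move=> lh; have hD x y : h (x + y) = h x + h y.
      by have := lh 1 x y; rewrite !scale1r.
    rewrite (big_morph h hD (lin0 lh)).
    by apply: eq_bigr => i _; rewrite (lin_sum _ _ lh).
  by rewrite !E //; do 2!apply: eq_bigr => ? _; rewrite fg.
rewrite {1}[w]matrix_sum_delta; do 2!apply: eq_bigr => ? _; congr (_ *: _).
by rewrite /tpure /bbasis !r2vK trmx_delta mul_delta_mx.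
Qed.

(* The pure tensor [t (x) m] in [T (x)_B M]. *)
Definition tens (t : T) (m : M) : tquot := tpi (tpure t m).

Lemma tens_bal t b m : tens (ract t b) m = tens t (act b m).
Proof.
apply/eqP; rewrite -subr_eq0; apply/eqP.
have := tbal_tker t b m => /vquot_pi_eq0; rewrite /tbal.
have := tpi_linear (-1) (tpure t (act b m)) (tpure (ract t b) m).
by rewrite !scaleN1r ![- _ + _]addrC /tpi => ->.
Qed.

Lemma tens_ext (V : lmodType F) (f g : tquot -> V) : linear f -> linear g ->
  (forall t m, f (tens t m) = g (tens t m)) -> f =1 g.
Proof.
move=> lf lg fg q; have [w <-] := tpi_surj q; move: w.
by apply: tmx_ext => // c u v; rewrite tpi_linear ?lf ?lg.
Qed.

Lemma tens_linl m : linear (tens^~ m).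
Proof. by move=> c t t'; rewrite /tens tpure_linl tpi_linear. Qed.
Lemma tens_linr t : linear (tens t).
Proof. by move=> c m m'; rewrite /tens tpure_linr tpi_linear. Qed.

(* Universal property: balanced bilinear maps factor through [tens]. *)
Definition tlift (V : vectType F) (b : T -> M -> V) (q : tquot) : V :=
  \sum_i \sum_j (vquot_repr q : 'M_(_, _)) i j *: b (bbasis i) (bbasis j).

Section Lift.
Variables (V : vectType F) (b : T -> M -> V).
Hypotheses (bl : forall m, linear (b^~ m)) (br : forall t, linear (b t)).
Hypothesis bbal : forall t a m, b (ract t a) m = b t (act a m).

Lemma tlift_linear : linear (tlift b).
Proof.
move=> c p q; have E := vquot_repr_linear c p q.
rewrite /tlift E scaler_sumr -big_split; apply: eq_bigr => i _ /=.
rewrite scaler_sumr -big_split; apply: eq_bigr => j _ /=.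
by rewrite !mxE scalerDl scalerA.
Qed.

Lemma tlift_tens t m : tlift b (tens t m) = b t m.
Proof.
pose f (w : tmx) : V :=
  \sum_i \sum_j (w : 'M_(_, _)) i j *: b (bbasis i) (bbasis j).
have lf : linear f.
  move=> c p q; rewrite /f scaler_sumr -big_split; apply: eq_bigr => i _ /=.
  rewrite scaler_sumr -big_split; apply: eq_bigr => j _ /=.
  by rewrite !mxE scalerDl scalerA.
have fpure t' m' : f (tpure t' m') = b t' m'.
  rewrite [t' in RHS]bbasis_sum [m' in RHS]bbasis_sum (lin_sum _ _ (bl _)).
  apply: eq_bigr => i _; rewrite (lin_sum _ _ (br _)) scaler_sumr.
  apply: eq_bigr => j _; rewrite scalerA; congr (_ *: _).
  by rewrite /tpure mxE big_ord1 mxE.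
rewrite -[LHS]/(f (vquot_repr (tpi (tpure t m)))) tpi_repr ?fpure //.
move=> t' a m'; have := lf (-1) (tpure t' (act a m')) (tpure (ract t' a) m').
rewrite !scaleN1r ![- _ + _]addrC /tbal => ->.
by rewrite !fpure bbal subrr.
Qed.

End Lift.

Lemma tact_lin s m : linear (fun t => tens (lact s t) m).
Proof. by move=> c t t'; rewrite lact_linr tens_linl. Qed.
Lemma tact_bal s t b m : tens (lact s (ract t b)) m = tens (lact s t) (act b m).
Proof. by rewrite lractA tens_bal. Qed.

Definition tact (s : S) : tquot -> tquot := tlift (fun t m => tens (lact s t) m).

Lemma tact_tens s t m : tact s (tens t m) = tens (lact s t) m.
Proof.
apply: (tlift_tens (b := fun t m => tens (lact s t) m)).
- by move=> m'; apply: tact_lin.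
- by move=> t'; apply: tens_linr.
- by move=> *; apply: tact_bal.
Qed.

Lemma tact_linr s : linear (tact s).
Proof. exact: tlift_linear. Qed.

(* [T (x)_B M], an [S]-module via [s (t (x) m) = s t (x) m]. *)
Definition tensor_mod : fmod S.
Proof.
exists tquot tact => [q|s|q|s s' q].
- move=> c s s'; move: q; apply: tens_ext => [||t m].
  + exact: tact_linr.
  + move=> d p q; rewrite !tact_linr !scalerDr !scalerA mulrC.
    by rewrite !addrA; congr (_ + _); rewrite addrAC.
  by rewrite !tact_tens lact_linl tens_linl.
- exact: tact_linr.
- move: q; apply: tens_ext => [||t m] //; first exact: tact_linr.
  by rewrite tact_tens lact1.
- move: q; apply: tens_ext => [||t m]; first exact: tact_linr.
    by move=> d p q; rewrite !tact_linr.
  by rewrite !tact_tens lactM.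
Defined.

End Module.

Section Morphism.
Variables (M N : fmod B) (f : mhom M N).

Definition tmap : tquot M -> tquot N := tlift (fun t m => tens t (f m)).

Lemma tmap_tens t m : tmap (tens t m) = tens t (f m).
Proof.
apply: (tlift_tens (b := fun t m => tens t (f m))) => [m'|t'|t' a m'].
- exact: tens_linl.
- by move=> c x y; rewrite linearP tens_linr.
- by rewrite mhom_act tens_bal.
Qed.

Lemma tmap_linear : linear tmap. Proof. exact: tlift_linear. Qed.

Definition tensor_map : mhom (tensor_mod M) (tensor_mod N).
Proof.
exists (HB.pack_for {linear tensor_mod M -> tensor_mod N} tmap
         (GRing.isLinear.Build _ _ _ _ tmap tmap_linear)) => s q /=.
move: q; apply: tens_ext => [||t m].
- by move=> c p q; rewrite tact_linr tmap_linear.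
- by move=> c p q; rewrite tmap_linear tact_linr.
by rewrite !(tact_tens, tmap_tens).
Defined.

End Morphism.

Definition tensor : functor B S.
Proof.
exists tensor_mod tensor_map => [M N f g fg|M|M N P g f];
  apply: tens_ext => [||t m] //=; rewrite ?tmap_tens ?fg //;
  try exact: tmap_linear.
by move=> c p q /=; rewrite !tmap_linear.
Defined.

End Tensor.

Section HeredityIdeals.
Variables (R : comNzRingType) (A : freeAlgType R).
Implicit Types I J : A -> Prop.

Definition two_sided I : Prop :=
  [/\ I 0, forall x y, I x -> I y -> I (x + y),
      forall a x, I x -> I (a * x) & forall a x, I x -> I (x * a)].

Definition ideal_mul I J : A -> Prop := fun x =>
  exists n (a b : 'I_n -> A),
    (forall j, I (a j) /\ J (b j)) /\ x = \sum_j a j * b j.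

(* [X] is the left ideal [J], regarded as a left [A]-module. *)
Definition ideal_module J (X : fmod A) : Prop :=
  exists i : mhom X (regular A),
    injective i /\ forall a, J a <-> exists x, i x = a.

(* [J] is a split heredity ideal and [X] is [J] as a left [A]-module. Finitely *)
(* generated projective modules over a local ring are free, so that the        *)
(* requirement that [A / J] be [R]-projective reads: [J] is the kernel of a    *)
(* surjection from [A] onto a free [R]-module.                                 *)
Definition split_heredity_ideal J (X : fmod A) : Prop :=
  [/\ two_sided J,
      exists (Q : vectType R) (q : {linear A -> Q}),
        (forall y, exists x, q x = y) /\ (forall x, q x = 0 <-> J x),
      ideal_module J X /\ projective X,
      forall x, J x <-> ideal_mul J J x
    & split_end X].

End HeredityIdeals.

(* [A] is split quasi-hereditary with respect to the poset [L], with chain of  *)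
(* ideals [qh_ideal 0], ..., [qh_ideal qh_len] and standard modules [qh_std].  *)
(* The layer [qh_layer l] of [l] is the index [i] such that [qh_std l] is an   *)
(* indecomposable summand of the projective [A / qh_ideal i]-module            *)
(* [qh_ideal i.+1 / qh_ideal i].                                               *)
Record split_qh (R : comNzRingType) (A : freeAlgType R) (d : Order.disp_t)
    (L : finPOrderType d) := SplitQH {
  qh_len : nat;
  qh_ideal : nat -> A -> Prop;
  qh_ideal0 : forall x, qh_ideal 0 x <-> x = 0;
  qh_idealT : forall x, qh_ideal qh_len x;
  qh_ideal_two_sided : forall i, (i <= qh_len)%N -> two_sided (qh_ideal i);
  qh_ideal_lt : forall i, (i < qh_len)%N ->
    (forall x, qh_ideal i x -> qh_ideal i.+1 x)
    /\ (exists x, qh_ideal i.+1 x /\ ~ qh_ideal i x);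
  qh_std : L -> fmod A;
  qh_layer : L -> 'I_qh_len;
  (* [p] presents the quotient algebra [A / qh_ideal i], in which the image of *)
  (* [qh_ideal i.+1] is a split heredity ideal isomorphic, as a left module,   *)
  (* to a direct sum of copies of the standard modules of layer [i].           *)
  qh_heredity : forall i : 'I_qh_len,
    exists (Abar : freeAlgType R) (p : {lrmorphism A -> Abar}) (X : fmod Abar),
      [/\ forall y, exists x, p x = y,
          forall x, p x = 0 <-> qh_ideal i x,
          split_heredity_ideal
            (fun y => exists2 x, qh_ideal i.+1 x & p x = y) X
        & exists n (lab : 'I_n -> L),
            direct_sum (fun j => qh_std (lab j)) (restrict p X)
            /\ forall l, qh_layer l = i <-> exists j, lab j = l];
  qh_std_neq0 : forall l, ~ zero_mod (qh_std l);
  qh_std_end : forall l (f : mhom (qh_std l) (qh_std l)),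
    exists c : R, forall x, f x = c *: x;
  (* Compatibility of the labelling with the order: larger labels occur first  *)
  (* in the chain, and the weight conditions of a highest weight category hold *)
  (* (each standard module is the quotient of a projective module by a kernel  *)
  (* filtered by standard modules of strictly larger labels, and has nonzero   *)
  (* maps only to standard modules of larger or equal label).                  *)
  qh_layer_lt : forall l m, (l < m)%O -> (qh_layer m < qh_layer l)%N;
  qh_std_hom : forall l m (f : mhom (qh_std l) (qh_std m)),
    (exists x, f x != 0) -> (l <= m)%O;
  qh_std_proj : forall l, exists (P N : fmod A) (i : mhom N P)
      (q : mhom P (qh_std l)) (s : seq L),
    [/\ projective P, short_exact i q,
        filtration (fun m X => iso X (qh_std m)) N s & all (fun m => l < m)%O s]
}.

Section Weights.
Variables (F : fieldType) (d : Order.disp_t) (L : finPOrderType d).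

(* The simple, standard and costandard modules of a quasi-hereditary algebra, *)
(* each given by the isomorphism class attached to a label.                   *)
Record weights (S : freeAlgType F) := Weights {
  wsimple : L -> fmod S -> Prop;
  wstd : L -> fmod S -> Prop;
  wcostd : L -> fmod S -> Prop }.

(* The same poset labels the right modules, [D = Hom_F(-, F)] exchanging left *)
(* and right simples, and standard and costandard modules.                    *)
Definition opp_weights S (w : weights S) : weights S^c :=
  Weights (fun l N => exists2 M, wsimple w l M & iso N (dual M))
          (fun l N => exists2 M, wcostd w l M & iso N (dual M))
          (fun l N => exists2 M, wstd w l M & iso N (dual M)).

Variables (S : freeAlgType F) (sim : L -> fmod S -> Prop).

(* All composition factors of [M] have labels [<= l]. *)
Definition truncated (l : L) (M : fmod S) : Prop :=
  exists2 s, filtration sim M s & all (fun m => m <= l)%O s.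

(* [N] is an injective hull of the simple module [L(l)] in the category of     *)
(* modules all of whose composition factors have labels [<= l].               *)
Definition injective_hull_truncated (l : L) (N : fmod S) : Prop :=
  [/\ truncated l N,
      exists (E : fmod S) (i : mhom E N),
        [/\ sim l E, injective i
          & forall (X : fmod S) (g : mhom N X),
              injective (fun x => g (i x)) -> injective g]
    & forall (X Y : fmod S) (j : mhom X Y) (f : mhom X N),
        truncated l X -> truncated l Y -> injective j ->
        exists h : mhom Y N, forall x, h (j x) = f x].

Variable w : weights S.

Definition tilting (M : fmod S) : Prop :=
  (exists s, filtration (wstd w) M s) /\ (exists s, filtration (wcostd w) M s).

Definition indec_tilting (l : L) (X : fmod S) : Prop :=
  [/\ tilting X, indecomposable X
    & exists s, [/\ filtration (wsimple w) X s, count_mem l s = 1%N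
                  & all (fun m => (m == l) || (m < l)%O) s]].

Definition full_tilting (M : fmod S) : Prop :=
  tilting M /\ forall l, exists2 X, indec_tilting l X & summand X M.

(* [T] defines a Ringel duality between [S] and [B^c]. *)
Definition ringel_duality (B : freeAlgType F) (T : bimod S B) : Prop :=
  full_tilting (lmod T) /\ right_action_iso T.

End Weights.

Section ReducedWeights.
Variables (R : comNzRingType) (F : fieldType) (phi : {rmorphism R -> F}).
Variables (A : freeAlgType R) (d : Order.disp_t) (L : finPOrderType d).
Variable q : split_qh A L.

Definition bc_std (l : L) : fmod (bc phi A) := bc_mod phi (qh_std q l).

Definition qh_simple (l : L) (M : fmod (bc phi A)) : Prop :=
  simple M /\ exists f : mhom (bc_std l) M, surj f.

Definition qh_weights : weights L (bc phi A) :=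
  Weights qh_simple (fun l M => iso M (bc_std l))
          (injective_hull_truncated qh_simple).

End ReducedWeights.

Section KkTilting.
Variables (O : comNzRingType) (K k : fieldType).
Variables (iK : {rmorphism O -> K}) (ik : {rmorphism O -> k}).
Variables (A B : freeAlgType O) (d : Order.disp_t) (L : finPOrderType d).

Definition left_Kk_tilting (q : split_qh A L) (T : bimod A B) : Prop :=
  tilting (qh_weights iK q) (lmod (bc_bimod iK T))
  /\ tilting (qh_weights ik q) (lmod (bc_bimod ik T)).

Definition right_Kk_tilting (q : split_qh B L) (T : bimod A B) : Prop :=
  tilting (opp_weights (qh_weights iK q)) (rmod (bc_bimod iK T))
  /\ tilting (opp_weights (qh_weights ik q)) (rmod (bc_bimod ik T)).

End KkTilting.

(* [E] maps the modules [X u] to the modules [Y l], up to isomorphism, along an *)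
(* order-reversing bijection of the labels.                                    *)
Definition order_reversing (R : comNzRingType) (S S' : freeAlgType R)
    (E : functor S S') (d d' : Order.disp_t)
    (U : finPOrderType d) (L : finPOrderType d')
    (X : U -> fmod S) (Y : L -> fmod S') : Prop :=
  exists sigma : U -> L,
    [/\ bijective sigma, forall u, iso (E (X u)) (Y (sigma u))
      & forall u v, (u <= v)%O -> (sigma v <= sigma u)%O].

(* Main.v *)
(* For a label [u] of [B], with [la] the corresponding label of [A], take a    *)
(* projective [B]-module [P] mapping onto the standard module of [u] with      *)
(* kernel filtered by standard modules of larger labels. Over [K] the module   *)
(* [KT (x) KP] contains the standard module of [la] exactly once and otherwise *)
(* only smaller ones. As [P] is cut out of [B^n] by an idempotent matrix,      *)
(* homomorphisms from standard modules to [T (x) P] are tuples of              *)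
(* homomorphisms to [T]; these can be lifted from [k] to [O], because Ext^1    *)
(* from modules with a standard to modules with a costandard filtration        *)
(* vanishes over [k]. Hence [kT (x) kP], and so [kT], has a summand which is   *)
(* the indecomposable tilting module of [la]: [kT] is full tilting. Every      *)
(* standard module then embeds in [kT], which therefore cogenerates the        *)
(* regular module and is faithful over [kA]. The same argument for the dual    *)
(* bimodule shows that [kT] is faithful over [kB]. Since the tensor functors   *)
(* are full over [K], an endomorphism of [T] is up to a denominator the action *)
(* of an element of [B] (or [A]), and faithfulness over [k] removes the        *)
(* denominator. Finally [End_A(T)] maps onto [End_kA(kT)] by Ext^1-vanishing.  *)
From HB Require Import structures.
From Stdlib Require Import ClassicalEpsilon.
Require Import Defs.
From mathcomp Require Import all_boot all_order all_algebra.
Set Implicit Arguments. Unset Strict Implicit. Unset Printing Implicit Defensive.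
Import Order.TTheory GRing.Theory Num.Theory VectorInternalTheory.
Local Open Scope ring_scope.

(** * Modules over an algebra *)

(** The proof has three stages: the indecomposable tilting modules are found inside kT, kT is shown
    to be faithful on both sides, and endomorphisms are identified integrally.

    Summands. Let sigma be the bijection of labels induced by KT (x) -, and let P be a projective
    B-module mapping onto Delta(u) with kernel filtered by larger standard modules. KT (x) KP
    contains the standard module of sigma u once and otherwise only smaller ones, so Hom_A(Delta(m),
    T (x) P) vanishes unless m <= sigma u and has rank one for m = sigma u ([left_tuple_le],
    [left_tuple_prop], [left_tuple_exists]). Over k, Ext^1 from standardly filtered to costandardly
    filtered modules is zero ([std_costd_ext]), so homomorphisms lift from k to O ([hom_lift]) and
    the same bounds hold over k. They characterise the tilting module of label sigma u among
    indecomposable tilting modules ([indec_tiltingP]). Instead of decomposing T (x) P, the proof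
    writes P as the image of an idempotent matrix e over B: for some j, right multiplication by e_jj
    scales a nonzero map from k Delta(sigma u) to kT by a nonzero constant, and Fitting's lemma
    gives the summand of kT itself ([indec_tilting_exists], [tilting_summand]). That summands of
    tilting modules are tilting is [std_filt_summand] and [costd_filt_summand].

    Faithfulness. The construction also embeds each standard module in kT. By Ext^1-vanishing, maps
    into kT extend along standard filtrations, so kT cogenerates the regular module
    ([tilting_faithful]). For the action of B the same is done with the dual bimodule [star T]: maps
    from Delta(v) to it are functionals on KT (x) K Delta(v), that is, on K Delta(sigma v). The
    bound on labels now requires that sigma reflects the order, which follows by counting from the
    order-reversing bijection of the second functor ([antitone_reflect]).

    Endomorphisms. Over K fullness of the tensor functors makes every endomorphism of T an element
    of KB (or KA). With denominators cleared it becomes c f = b, and faithfulness over k allows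
    division by c ([bilinear_divide]). Finally every endomorphism of kT lifts to T, which gives the
    statement over k. *)

Definition mklin (R : nzRingType) (V W : lmodType R) (f : V -> W)
    (lf : linear f) : {linear V -> W} :=
  HB.pack f (GRing.isLinear.Build _ _ _ _ f lf).

Section ModuleTheory.
Variables (R : comNzRingType) (S : freeAlgType R).
Implicit Types M N P Q X Y : fmod S.

Definition mkhom M N (f : M -> N) (lf : linear f)
  (ef : forall a x, f (act a x) = act a (f x)) : mhom M N :=
  @MHom R S M N (mklin lf) ef.

Definition nonzero M N (f : mhom M N) : Prop := exists x, f x != 0.

Lemma zero_or_nonzero M N (f : mhom M N) : (forall x, f x = 0) \/ nonzero f.
Proof.
case: (classic (nonzero f)) => [|nf]; [by right | left => x].
by apply/eqP; case: eqP => // /eqP fx; case: nf; exists x.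
Qed.

Section Act.
Variable M : fmod S.
Implicit Types (a b : S) (x y : M).
Lemma act0r a : act a 0 = 0 :> M. Proof. exact: lin0 (@act_linr R S M a). Qed.
Lemma act0l x : act 0 x = 0. Proof. exact: lin0 (@act_linl R S M x). Qed.
Lemma actDr a x y : act a (x + y) = act a x + act a y.
Proof. by have := @act_linr R S M a 1 x y; rewrite !scale1r. Qed.
Lemma actDl a b x : act (a + b) x = act a x + act b x.
Proof. by have := @act_linl R S M x 1 a b; rewrite !scale1r. Qed.
Lemma actZr c a x : act a (c *: x) = c *: act a x.
Proof. by have := @act_linr R S M a c x 0; rewrite !addr0 act0r addr0. Qed.
Lemma actBr a x y : act a (x - y) = act a x - act a y.
Proof. by rewrite actDr -scaleN1r actZr scaleN1r. Qed.
Lemma act_sumr a n (x : 'I_n -> M) : act a (\sum_j x j) = \sum_j act a (x j).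
Proof. by apply: (big_morph _ (actDr a)); apply: act0r. Qed.
Lemma act_suml n (a : 'I_n -> S) x : act (\sum_j a j) x = \sum_j act (a j) x.
Proof. by apply: (big_morph (fun a => act a x) (fun a b => actDl a b x)); apply: act0l. Qed.
End Act.

(** Maps are defined by their graphs. Linearity together with the condition at 0 makes the relation
    single-valued, so maps out of quotients and sums need no separate choice of representatives. *)
Lemma mhom_of_rel M N (r : M -> N -> Prop) :
    (forall x, exists y, r x y) -> (forall y, r 0 y -> y = 0) ->
    (forall c x x' y y', r x y -> r x' y' -> r (c *: x + x') (c *: y + y')) ->
    (forall a x y, r x y -> r (act a x) (act a y)) ->
  exists f : mhom M N, forall x, r x (f x).
Proof.
move=> tot r0 rlin ract.
have uni x y y' : r x y -> r x y' -> y = y'.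
  move=> rxy rxy'; have := rlin (-1) _ _ _ _ rxy rxy'.
  rewrite !scaleN1r addNr => /r0/eqP.
  by rewrite addrC subr_eq0 eq_sym => /eqP.
pose f x := proj1_sig (constructive_indefinite_description _ (tot x)).
have fr x : r x (f x) by rewrite /f; case: constructive_indefinite_description.
have lf : linear f by move=> c x y; apply: (uni _ _ _ (fr _)); apply: rlin.
have ef a x : f (act a x) = act a (f x) by apply: (uni _ _ _ (fr _)); apply: ract.
by exists (mkhom lf ef).
Qed.

Lemma mhomZ M N (f : mhom M N) c x : f (c *: x) = c *: f x.
Proof. exact: linearZ. Qed.

Lemma mhom_inj M N (f : mhom M N) : (forall x, f x = 0 -> x = 0) -> injective f.
Proof.
move=> f0 x y fxy; apply/eqP; rewrite -subr_eq0; apply/eqP/f0.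
by rewrite linearB fxy subrr.
Qed.

Lemma inj_eq0 M N (f : mhom M N) x : injective f -> f x = 0 -> x = 0.
Proof. by move=> injf fx; apply: injf; rewrite fx linear0. Qed.

Lemma factor_inj M N X (i : mhom N M) (f : mhom X M) : injective i ->
  (forall x, exists y, i y = f x) -> exists g : mhom X N, forall x, i (g x) = f x.
Proof.
move=> injf fi; apply: (mhom_of_rel (r := fun x y => i y = f x)) => //.
- by move=> y; rewrite linear0 => /(inj_eq0 injf).
- by move=> c x x' y y' xy xy'; rewrite !linearP xy xy'.
- by move=> a x y xy; rewrite !mhom_act xy.
Qed.

Lemma factor_surj M N X (p : mhom M N) (f : mhom M X) : surj p ->
  (forall x, p x = 0 -> f x = 0) -> exists g : mhom N X, forall x, g (p x) = f x.
Proof.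
move=> sp fp.
have [] := mhom_of_rel (r := fun y z => exists2 x, p x = y & f x = z).
- by move=> y; have [x <-] := sp y; exists (f x), x.
- by move=> z [x px <-]; apply: fp.
- move=> c y y' z z' [x <- <-] [x' <- <-].
  by exists (c *: x + x'); rewrite !linearP.
- by move=> a y z [x <- <-]; exists (act a x); rewrite mhom_act.
move=> g gr; exists g => x; have [x' pp <-] := gr (p x).
apply/eqP; rewrite -subr_eq0 -linearB; apply/eqP/fp.
by rewrite linearB pp subrr.
Qed.

Lemma bij_inverse M N (f : mhom M N) : injective f -> surj f ->
  exists g : mhom N M, cancel f g /\ cancel g f.
Proof.
move=> injf sf; have [g gf] := factor_inj (f := mhom_id N) injf sf.
by exists g; split=> // x; apply: injf; rewrite gf.
Qed.

Lemma iso_inj_surj M N : iso M N -> exists f : mhom M N, injective f /\ surj f.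
Proof.
by case=> f [g fK gK]; exists f; split=> [|y]; [apply: can_inj fK | exists (g y)].
Qed.

Lemma inj_surj_iso M N (f : mhom M N) : injective f -> surj f -> iso M N.
Proof.
by move=> injf sf; have [g [fK gK]] := bij_inverse injf sf; exists f, g.
Qed.

Lemma iso_sym M N : iso M N -> iso N M.
Proof.
move=> isoM; have [f [injf sf]] := iso_inj_surj isoM; have [g [fK gK]] := bij_inverse injf sf.
by exists g, f.
Qed.

Lemma iso_refl M : iso M M.
Proof. by exists (mhom_id M), id. Qed.

Fact scale_lin M N (c : R) (f : mhom M N) : linear (fun x => c *: f x).
Proof. by move=> d x y; rewrite linearP scalerDr !scalerA mulrC. Qed.
Fact scale_act M N (c : R) (f : mhom M N) a x : c *: f (act a x) = act a (c *: f x).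
Proof. by rewrite mhom_act actZr. Qed.
Definition mhom_scale M N c (f : mhom M N) := mkhom (scale_lin c f) (scale_act c f).

Fact add_lin M N (f g : mhom M N) : linear (fun x => f x + g x).
Proof. by move=> d x y; rewrite !linearP scalerDr addrACA. Qed.
Fact add_act M N (f g : mhom M N) a x : f (act a x) + g (act a x) = act a (f x + g x).
Proof. by rewrite !mhom_act actDr. Qed.
Definition mhom_add M N (f g : mhom M N) := mkhom (add_lin f g) (add_act f g).

Definition mhom_sub M N (f g : mhom M N) := mhom_add f (mhom_scale (-1) g).
Lemma mhom_subE M N (f g : mhom M N) x : mhom_sub f g x = f x - g x.
Proof. by rewrite /= scaleN1r. Qed.

Fact zero_lin M N : linear (fun _ : M => 0 : N).
Proof. by move=> d x y; rewrite scaler0 addr0. Qed.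
Fact zero_act M N a (x : M) : 0 = act a (0 : N).
Proof. by rewrite act0r. Qed.
Definition mhom_zero M N : mhom M N := mkhom (@zero_lin M N) (@zero_act M N).

Lemma filt_iso (L : Type) (C : L -> fmod S -> Prop) M M' s :
  iso M M' -> filtration C M s -> filtration C M' s.
Proof.
move=> isoM FM; have [f [injf sf]] := iso_inj_surj (iso_sym isoM).
move: {isoM} f injf sf; elim: FM => {M s} [M M0|M N Q l s i p [injf sp ker] CQ FN _] f injf' sf.
  by apply: FiltNil => x; apply: injf'; rewrite linear0; apply: M0.
have [g [fK gK]] := bij_inverse injf' sf.
apply: (FiltCons (i := mhom_comp g i) (p := mhom_comp p f)) CQ FN; split.
- by move=> x y /= /(can_inj gK)/injf.
- by move=> y; have [x <-] := sp y; have [x' <-] := sf x; exists x'.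
- move=> y /=; split=> [/ker[x ix]|[x <-]]; first by exists x; rewrite ix.
  by apply/ker; exists x; rewrite gK.
Qed.

(** Either the map is nonzero on the submodule, or it factors through the top layer. *)
Lemma filt_hom (L : eqType) (C : L -> fmod S -> Prop) M Y s (f : mhom M Y) :
  filtration C M s -> nonzero f ->
  exists l Q (g : mhom Q Y), [/\ l \in s, C l Q & nonzero g].
Proof.
move=> FM; elim: FM Y f => {M s} [M M0|M N Q l s i p [injf sp ker] CQ FN IH] Y f [x fx].
  by rewrite (M0 x) linear0 eqxx in fx.
have [fi0|nfi] := zero_or_nonzero (mhom_comp f i); last first.
  by have [m [Q' [g [ms CQ' ng]]]] := IH _ _ nfi; exists m, Q', g; rewrite inE ms orbT.
have [|g gp] := factor_surj (f := f) sp.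
  by move=> y /ker[z <-]; apply: (fi0 z).
by exists l, Q, g; split; rewrite ?mem_head //; exists (p x); rewrite gp.
Qed.

End ModuleTheory.

(** * Modules over a field *)

Section FieldTheory.
Variables (F : fieldType) (S : freeAlgType F).
Implicit Types M N P Q X Y E : fmod S.

(** A subspace contained in the predicate is enlarged by one vector at a time; the dimension bounds
    the number of steps. *)
Lemma vspace_of_pred (V : vectType F) (U : V -> Prop) :
  U 0 -> (forall c x y, U x -> U y -> U (c *: x + y)) ->
  exists W : {vspace V}, forall x, x \in W <-> U x.
Proof.
move=> U0 UP.
suff sub n (W : {vspace V}) : (\dim {:V} - \dim W <= n)%N ->
    (forall x, x \in W -> U x) ->
    exists W : {vspace V}, forall x, x \in W <-> U x.
  apply: (sub _ 0%VS (leqnn _)) => x; rewrite memv0 => /eqP->; exact: U0.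
elim: n W => [|n IH] W leW WU; last first.
  have [[x [Ux Wx]]|nx] := classic (exists x, U x /\ x \notin W); last first.
    exists W => x; split=> [/WU//|Ux].
    by case: (boolP (x \in W)) => // Wx; case: nx; exists x.
  apply: (IH (W + <[x]>)%VS).
    rewrite -ltnS (leq_trans _ leW) // ltn_sub2l //.
      rewrite ltn_neqAle dimvS ?subvf // andbT; apply: contra Wx => /eqP dW.
      have /eqP-> : W == {:V}%VS by rewrite eqEdim subvf dW /=.
      exact: memvf.
    rewrite ltn_neqAle dimvS ?addvSl // andbT; apply: contra Wx => /eqP dW.
    have /eqP-> : W == (W + <[x]>)%VS by rewrite eqEdim addvSl dW /=.
    by apply: (subvP (addvSr _ _)); apply: memv_line.
  move=> y /memv_addP[w /WU Uw [_ /vlineP[c ->] ->]].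
  by rewrite addrC; apply: UP.
exists W => x; split=> [/WU//|_].
suff /eqP-> : W == {:V}%VS by apply: memvf.
by rewrite eqEdim subvf /= -subn_eq0 -leqn0.
Qed.

Definition stable_pred M (U : M -> Prop) : Prop :=
  [/\ U 0, forall c x y, U x -> U y -> U (c *: x + y)
    & forall a x, U x -> U (act a x)].

Section SubQuo.
Variables (M : fmod S) (U : {vspace M}) (sU : stable U).

Definition submod : fmod S.
Proof.
exists (subvs_of U) (fun a x => vsproj U (act a (vsval x))) => [x c a b|a c x y|x|a b x].
- by rewrite act_linl linearP.
- by rewrite linearP /= act_linr linearP.
- by rewrite act1 vsvalK.
- by rewrite actM vsprojK //; apply/sU/subvsP.
Defined.

Definition submod_in : mhom submod M.
Proof.
exists (mklin (fun c (x y : subvs_of U) => linearP vsval c x y)) => a x /=.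
by rewrite vsprojK //; apply/sU/subvsP.
Defined.

Lemma submod_inj : injective submod_in.
Proof. by move=> x y; apply: val_inj. Qed.

Lemma submod_im y : y \in U <-> exists x, submod_in x = y.
Proof.
split=> [Uy|[x <-]]; last exact: subvsP.
by exists (vsproj U y) => /=; rewrite vsprojK.
Qed.

Let quo_act a (q : vquot U) : vquot U := vquot_pi U (act a (vquot_repr q)).

Let quo_actE a x : quo_act a (vquot_pi U x) = vquot_pi U (act a x).
Proof.
apply/eqP; rewrite -subr_eq0 -scaleN1r addrC -vquot_pi_linear scaleN1r; apply/eqP.
apply/vquot_pi_eq0; rewrite addrC -actBr; apply: sU; apply/vquot_pi_eq0.
rewrite addrC -scaleN1r vquot_pi_linear scaleN1r vquot_reprK addNr //.
Qed.

Definition quomod : fmod S.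
Proof.
exists (vquot U) quo_act => [q c a b|a c p q|q|a b q].
- by rewrite /quo_act act_linl vquot_pi_linear.
- by rewrite /quo_act vquot_repr_linear act_linr vquot_pi_linear.
- by rewrite /quo_act act1 vquot_reprK.
- by rewrite {3}/quo_act quo_actE -actM.
Defined.

Definition quomod_pi : mhom M quomod.
Proof. by exists (mklin (@vquot_pi_linear _ _ U)) => a x; rewrite /= quo_actE. Defined.

Lemma quomod_surj : surj quomod_pi.
Proof. by move=> q; exists (vquot_repr q); apply: vquot_reprK. Qed.

Lemma quomod_ker y : quomod_pi y = 0 <-> y \in U.
Proof. exact: vquot_pi_eq0. Qed.

End SubQuo.
Arguments quomod_surj {M U} sU.
Arguments quomod_ker {M U} sU y.
Arguments submod_inj {M U} sU.
Arguments submod_im {M U} sU y.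

Lemma submod_exists M (U : M -> Prop) : stable_pred U ->
  exists K (i : mhom K M), injective i /\ forall y, U y <-> exists x, i x = y.
Proof.
move=> [U0 UP Ua]; have [W WU] := vspace_of_pred U0 UP.
have sW : stable W by move=> a x /WU Ux; apply/WU/Ua.
exists (submod sW), (submod_in sW); split; first exact: submod_inj.
by move=> y; rewrite -WU (submod_im sW).
Qed.

Lemma quomod_exists M (U : M -> Prop) : stable_pred U ->
  exists Q (p : mhom M Q), surj p /\ forall y, p y = 0 <-> U y.
Proof.
move=> [U0 UP Ua]; have [W WU] := vspace_of_pred U0 UP.
have sW : stable W by move=> a x /WU Ux; apply/WU/Ua.
exists (quomod sW), (quomod_pi sW); split; first exact: quomod_surj.
by move=> y; rewrite (quomod_ker sW) WU.
Qed.

Lemma stable_ker M N (f : mhom M N) : stable_pred (fun x => f x = 0).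
Proof.
split=> [|c x y fx fy|a x fx]; first exact: linear0.
  by rewrite linearP fx fy scaler0 addr0.
by rewrite mhom_act fx act0r.
Qed.

Lemma stable_im M N (f : mhom M N) : stable_pred (fun y => exists x, f x = y).
Proof.
split=> [|c _ _ [x <-] [y <-]|a _ [x <-]]; first by exists 0; apply: linear0.
  by exists (c *: x + y); rewrite linearP.
by exists (act a x); rewrite mhom_act.
Qed.

Lemma stable_preim M N (f : mhom M N) (U : N -> Prop) :
  stable_pred U -> stable_pred (fun x => U (f x)).
Proof.
move=> [U0 UP Ua]; split=> [|c x y Ux Uy|a x Ux]; first by rewrite linear0.
  by rewrite linearP; apply: UP.
by rewrite mhom_act; apply: Ua.
Qed.

Lemma stable_vspace M (U : {vspace M}) : stable U -> stable_pred (fun x => x \in U).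
Proof.
move=> sU; split=> [|c x y Ux Uy|a x Ux]; first exact: mem0v.
  by rewrite memvD ?memvZ.
exact: sU.
Qed.

Lemma ker_exists M N (f : mhom M N) : surj f ->
  exists K (i : mhom K M), short_exact i f.
Proof.
move=> sf; have [K [i [injf iK]]] := submod_exists (stable_ker f).
by exists K, i.
Qed.

Lemma coker_exists M N (f : mhom M N) : injective f ->
  exists Q (p : mhom N Q), short_exact f p.
Proof.
move=> injf; have [Q [p [sp pQ]]] := quomod_exists (stable_im f).
by exists Q, p.
Qed.

Lemma dim_inj M N (f : mhom M N) : injective f -> (\dim {:M} <= \dim {:N})%N.
Proof.
move=> injf; have k0 : lker (linfun f) == 0%VS.
  apply/lker0P => x y; rewrite !lfunE; exact: injf.
by rewrite -(limg_dim_eq (f := linfun f)) ?dimvS ?subvf // (eqP k0) capv0.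
Qed.

Lemma dim_inj_lt M N (f : mhom M N) : injective f -> ~ surj f ->
  (\dim {:M} < \dim {:N})%N.
Proof.
move=> injf nsf; rewrite ltn_neqAle (dim_inj injf) andbT.
apply/eqP => dMN; apply: nsf => y.
have k0 : lker (linfun f) == 0%VS.
  apply/lker0P => x x'; rewrite !lfunE; exact: injf.
have : limg (linfun f) == fullv.
  by rewrite eqEdim subvf /= limg_dim_eq ?(eqP k0) ?capv0 // -dMN.
move/eqP => im; have : y \in limg (linfun f) by rewrite im memvf.
by case/memv_imgP => x _ ->; exists x; rewrite lfunE.
Qed.

Lemma dim_surj_lt M N (f : mhom M N) : surj f -> ~ injective f ->
  (\dim {:N} < \dim {:M})%N.
Proof.
move=> sf nif; have im : limg (linfun f) = fullv.
  apply/eqP; rewrite eqEsubv subvf /=; apply/subvP => y _.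
  by have [x <-] := sf y; rewrite -[f x]lfunE memv_img ?memvf.
have := limg_ker_dim (linfun f) fullv; rewrite im => <-.
rewrite -[X in (X < _)%N]add0n ltn_add2r capfv lt0n dimv_eq0.
by apply/negP => /lker0P injf; apply: nif => x y fxy; apply: injf; rewrite !lfunE.
Qed.

Lemma simple_surj M E (f : mhom M E) : simple E -> nonzero f -> surj f.
Proof.
move=> [_ sE] [x fx] y.
have [U0 UP Ua] := stable_im f.
have [W WU] := vspace_of_pred U0 UP.
have sW : stable W by move=> a z /WU Ux; apply/WU/Ua.
have [W0|WT] := sE W sW; last by apply/WU; rewrite WT memvf.
by have: f x \in W by [apply/WU; exists x]; rewrite W0 memv0 (negPf fx).
Qed.

Lemma simple_inj E N (f : mhom E N) : simple E -> nonzero f -> injective f.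
Proof.
move=> [_ sE] [x fx]; apply: mhom_inj => y fy.
have [U0 UP Ua] := stable_ker f.
have [W WU] := vspace_of_pred U0 UP.
have sW : stable W by move=> a z /WU Ux; apply/WU/Ua.
have [W0|WT] := sE W sW; last first.
  by have /WU fx0 : x \in W by [rewrite WT memvf]; rewrite fx0 eqxx in fx.
by have: y \in W by [apply/WU]; rewrite W0 memv0 => /eqP.
Qed.

Lemma zero_mod_or M : zero_mod M \/ exists x : M, x != 0.
Proof.
case: (classic (exists x : M, x != 0)) => [|nx]; [by right|left => x].
by apply/eqP; case: eqP => // /eqP x0; case: nx; exists x.
Qed.

Lemma nonzero_mod M (x : M) : x != 0 -> ~ zero_mod M.
Proof. by move=> x0 M0; rewrite (M0 x) eqxx in x0. Qed.

Lemma simple_quotient M : ~ zero_mod M ->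
  exists E (p : mhom M E), simple E /\ surj p.
Proof.
have [n] := ubnP (\dim {:M}); elim: n M => // n IH M leM nzM.
have [sM|nsM] := classic (simple M).
  by exists M, (mhom_id M); split=> // y; exists y.
have [U [sU [Un0 UnT]]] : exists U : {vspace M}, stable U /\ U <> 0%VS /\ U <> fullv.
  case: (classic (exists U : {vspace M}, stable U /\ U <> 0%VS /\ U <> fullv)) => // nU.
  case: nsM; split=> // U sU; case: (classic (U = 0%VS)); first by left.
  by right; case: (classic (U = fullv)) => // UT; case: nU; exists U.
have [||E [p [sE sp]]] := IH (quomod sU).
- rewrite -ltnS; apply: leq_trans leM; rewrite ltnS.
  refine (dim_surj_lt (f := quomod_pi sU) (quomod_surj sU) _) => injp; apply: Un0.
  apply/eqP; rewrite -subv0; apply/subvP => x /(quomod_ker sU).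
  by rewrite -[RHS](linear0 (quomod_pi sU)) => /injp->; rewrite mem0v.
- move=> Q0; apply: UnT; apply/eqP; rewrite eqEsubv subvf /=.
  by apply/subvP => x _; apply/(quomod_ker sU)/Q0.
exists E, (mhom_comp p (quomod_pi sU)); split=> // y.
have [z <-] := sp y; have [x <-] := quomod_surj sU z; by exists x.
Qed.

Lemma short_exact_dim_lt M N Q (i : mhom N M) (p : mhom M Q) :
  short_exact i p -> ~ zero_mod Q -> (\dim {:N} < \dim {:M})%N.
Proof.
move=> [injf sp ker] nzQ; apply: (dim_inj_lt injf) => si; apply: nzQ => y.
have [x <-] := sp y; apply/ker; exact: si.
Qed.

(** Labels are read from the top, so those of the quotient come first. The filtration of [Q] is
    pulled back to [M] layer by layer. *)
Lemma filt_cat (L : Type) (C : L -> fmod S -> Prop) M N Q (i : mhom N M)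
    (p : mhom M Q) s1 s2 : short_exact i p ->
  filtration C Q s1 -> filtration C N s2 -> filtration C M (s1 ++ s2).
Proof.
move=> ex FQ FN.
elim: FQ M i p ex => {Q s1} [Q Q0|Q Q1 E l s1 j r [injj sr kerj] CE FQ1 IH] M i p [inji sp ker].
  apply: filt_iso FN; apply: inj_surj_iso inji _ => y; apply/ker/Q0.
have sc : surj (mhom_comp r p).
  by move=> z; have [y <-] := sr z; have [x <-] := sp y; exists x.
have [M1 [i1 ex1]] := ker_exists sc.
apply: (FiltCons ex1 CE); case: ex1 => inji1 _ ker1.
have [i' i'E] : exists i' : mhom N M1, forall x, i1 (i' x) = i x.
  apply: factor_inj inji1 _ => x; apply/ker1 => /=.
  by rewrite (iffRL (ker _)) ?linear0 //; exists x.
have [p' p'E] : exists p' : mhom M1 Q1, forall x, j (p' x) = p (i1 x).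
  apply: (factor_inj (f := mhom_comp p i1)) injj _ => x; apply/kerj.
  by apply: (iffRL (ker1 _)); exists x.
apply: (IH _ i' p'); split.
- by move=> x y e; apply: inji; rewrite -!i'E e.
- move=> y; have [x px] := sp (j y).
  have /ker1[x' x'E] : mhom_comp r p x = 0 by rewrite /= px; apply/kerj; exists y.
  by exists x'; apply: injj; rewrite p'E x'E.
- move=> y; split=> [p'y|[x <-]].
    have /ker[x xE] : p (i1 y) = 0 by rewrite -p'E p'y linear0.
    by exists x; apply: inji1; rewrite i'E.
  by apply: injj; rewrite p'E i'E linear0; apply/ker; exists x.
Qed.

Lemma filt_single (L : Type) (C : L -> fmod S -> Prop) l Q : C l Q -> filtration C Q [:: l].
Proof.
move=> CQ; have [|K [i ex]] := @ker_exists Q Q (mhom_id Q); first by move=> y; exists y.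
have [inji _ ker] := ex; apply: FiltCons ex CQ _; apply: FiltNil => x.
by apply: inji; rewrite linear0; apply/ker; exists x.
Qed.


(** This is the vanishing of Ext^1(Q, N): the pushout of every extension of [Q] along every map to
    [N] splits. Quantifying over [f] avoids forming the pushout. *)
Definition ext0 Q N : Prop := forall X Y (i : mhom X Y) (p : mhom Y Q),
  short_exact i p -> forall f : mhom X N, exists h : mhom Y N, forall x, h (i x) = f x.

(** The preimage [Y1] of [M1] in [Y] is an extension of [M1] by [X], and [Y] is an extension of [M2]
    by [Y1]; the map is extended in these two stages. *)
Lemma ext0_cat M M1 M2 N (i : mhom M1 M) (p : mhom M M2) : short_exact i p ->
  ext0 M1 N -> ext0 M2 N -> ext0 M N.
Proof.
move=> [inji sp ker] e1 e2 X Y j r [injj sr kerj] f.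
have sc : surj (mhom_comp p r).
  by move=> z; have [y <-] := sp z; have [x <-] := sr y; exists x.
have [Y1 [i1 ex1]] := ker_exists sc; have [inji1 _ ker1] := ex1.
have [j' j'E] : exists j' : mhom X Y1, forall x, i1 (j' x) = j x.
  apply: factor_inj inji1 _ => x; apply/ker1 => /=.
  by rewrite (iffRL (kerj _)) ?linear0 //; exists x.
have [r' r'E] : exists r' : mhom Y1 M1, forall x, i (r' x) = r (i1 x).
  apply: (factor_inj (f := mhom_comp r i1)) inji _ => x; apply/ker.
  by apply: (iffRL (ker1 _)); exists x.
have [|h1 h1E] := e1 _ _ j' r' _ f.
  split.
  - by move=> x y e; apply: injj; rewrite -!j'E e.
  - move=> y; have [x px] := sr (i y).
    have /ker1[x' x'E] : mhom_comp p r x = 0 by rewrite /= px; apply/ker; exists y.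
    by exists x'; apply: inji; rewrite r'E x'E.
  - move=> y; split=> [r'y|[x <-]].
      have /kerj[x xE] : r (i1 y) = 0 by rewrite -r'E r'y linear0.
      by exists x; apply: inji1; rewrite j'E.
    by apply: inji; rewrite r'E j'E linear0; apply/kerj; exists x.
have [h hE] := e2 _ _ _ _ ex1 h1.
by exists h => x; rewrite -j'E hE h1E.
Qed.

Lemma ext0_zero M N : zero_mod M -> ext0 M N.
Proof.
move=> M0 X Y i p [inji _ ker] f.
have si : surj i by move=> y; apply/ker/M0.
have [g [ig gi]] := bij_inverse inji si.
by exists (mhom_comp f g) => x /=; rewrite ig.
Qed.

Lemma ext0_filt (L : eqType) (C : L -> fmod S -> Prop) M N s : filtration C M s ->
  (forall l Q, l \in s -> C l Q -> ext0 Q N) -> ext0 M N.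
Proof.
elim=> {M s} [M M0 _|M N1 Q l s i p ex CQ _ IH eN]; first exact: ext0_zero.
apply: (ext0_cat ex).
  by apply: IH => m Q' ms; apply: eN; rewrite inE ms orbT.
by apply: (eN l) => //; rewrite mem_head.
Qed.

Lemma ext0_iso M M' N : iso M M' -> ext0 M N -> ext0 M' N.
Proof.
move=> isoM; have [g [injg sg]] := iso_inj_surj (iso_sym isoM) => e X Y i p [inji sp ker] f.
apply: (e _ _ i (mhom_comp g p)); split=> //.
  by move=> z; have [y <-] := sg z; have [x <-] := sp y; exists x.
by move=> y; rewrite -ker /=; split=> [/(inj_eq0 injg)|->] //; rewrite linear0.
Qed.

(* Extension criterion in terms of a projective presentation [K -> P -> Q]. *)
Definition lifts P : Prop := forall X Y (p : mhom X Y) (f : mhom P Y), surj p ->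
  exists g : mhom P X, forall x, p (g x) = f x.

Lemma ext0_presented K P Q N (i : mhom K P) (q : mhom P Q) :
  lifts P -> short_exact i q ->
  (forall f : mhom K N, exists h : mhom P N, forall x, h (i x) = f x) -> ext0 Q N.
Proof.
move=> lP [inji sq ker] ext X Y j p [injj sp kerj] f.
have [phi phiE] := lP _ _ p q sp.
have [psi psiE] : exists psi : mhom K X, forall x, j (psi x) = phi (i x).
  apply: (factor_inj (f := mhom_comp phi i)) injj _ => x; apply/kerj => /=.
  by rewrite phiE; apply/ker; exists x.
have [h hE] := ext (mhom_comp f psi).
(* [Y] is the sum of the images of [X] and [P], which forces the value f x + h z at j x + phi z. The
   two parts agree on the overlap because [h] extends the composite of [f] and [psi]. *)
have [||||g gE] := mhom_of_rel
    (r := fun y n => exists x z, y = j x + phi z /\ n = f x + h z).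
- move=> y; have [z qz] := sq (p y).
  have /kerj[x xE] : p (y - phi z) = 0 by rewrite linearB phiE qz subrr.
  by exists (f x + h z), x, z; rewrite xE subrK.
- move=> n [x [z [e ->]]].
  have /ker[w wE] : q z = 0.
    rewrite -phiE -[LHS]add0r -{1}(iffRL (kerj (j x))); last by exists x.
    by rewrite -linearD -e linear0.
  rewrite -wE hE /= -linearD (_ : x + _ = 0) ?linear0 //.
  by apply: (inj_eq0 injj); rewrite linearD psiE wE.
- move=> c _ _ _ _ [x [z [-> ->]]] [x' [z' [-> ->]]].
  exists (c *: x + x'), (c *: z + z'); rewrite !linearP !scalerDr.
  by split; rewrite addrACA.
- move=> a _ _ [x [z [-> ->]]]; exists (act a x), (act a z).
  by rewrite !mhom_act !actDr.
exists g => x; have [x' [z [e ->]]] := gE (j x).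
have /ker[w wE] : q z = 0.
  by rewrite -phiE -(addKr (j x') (phi z)) -e -linearN -linearD; apply/kerj; eexists.
rewrite -wE hE /= -linearD; congr (f _); apply: injj.
by rewrite linearD psiE wE -e.
Qed.

End FieldTheory.
Arguments quomod_surj {F S M U} sU.
Arguments quomod_ker {F S M U} sU y.
Arguments submod_inj {F S M U} sU.
Arguments submod_im {F S M U} sU y.

(** * Highest weight theory *)

Lemma max_label (d : Order.disp_t) (L : porderType d) (s : seq L) : s != [::] ->
  exists2 l, l \in s & forall m, m \in s -> (l <= m)%O -> m = l.
Proof.
elim: s => // a [_ _|b s /(_ isT) [l ls lmax] _].
  by exists a => [|m]; rewrite ?mem_head // inE => /eqP.
case: (boolP (l < a)%O) => la.
  exists a; rewrite ?mem_head // => m; rewrite inE => /orP[/eqP//|ms am].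
  have lm := le_trans (ltW la) am; have ml := lmax m ms lm.
  by rewrite ml (lt_geF la) in am.
exists l => [|m]; first by rewrite inE ls orbT.
rewrite inE => /orP[/eqP->|ms lm]; last exact: lmax.
by rewrite le_eqVlt (negPf la) orbF => /eqP.
Qed.

(* [hwP l] is projective with top layer [D l], but need not be indecomposable. *)
Record hw_data (F : fieldType) (S : freeAlgType F) (d : Order.disp_t)
    (L : finPOrderType d) (D : L -> fmod S) := HWData {
  hwP : L -> fmod S;
  hwN : L -> fmod S;
  hwi : forall l, mhom (hwN l) (hwP l);
  hwq : forall l, mhom (hwP l) (D l);
  hws : L -> seq L;
  hw_exact : forall l, short_exact (hwi l) (hwq l);
  hw_lifts : forall l, lifts (hwP l);
  hwN_filt : forall l, filtration (fun m X => iso X (D m)) (hwN l) (hws l);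
  hws_lt : forall l m, m \in hws l -> (l < m)%O;
  hw_hom_le : forall l m (f : mhom (hwP l) (D m)), nonzero f -> (l <= m)%O;
  hw_hom_scal : forall l (f : mhom (hwP l) (D l)), exists c, forall x, f x = c *: hwq l x;
  hw_std_neq0 : forall l, ~ zero_mod (D l);
  hw_regular : exists s, filtration (fun m X => iso X (D m)) (regular S) s }.

Section HighestWeight.
Variables (F : fieldType) (S : freeAlgType F) (d : Order.disp_t) (L : finPOrderType d).
Variables (D : L -> fmod S) (H : hw_data D).
Implicit Types M N Q X Y E : fmod S.
Local Notation P := (hwP H).
Local Notation q := (hwq H).

Definition hw_simple (l : L) (M : fmod S) : Prop :=
  simple M /\ exists f : mhom (D l) M, surj f.
Definition hw_weights : weights L S :=
  Weights hw_simple (fun l M => iso M (D l)) (injective_hull_truncated hw_simple).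
Local Notation std := (wstd hw_weights).
Local Notation nabla := (injective_hull_truncated hw_simple).

(** A substitute for multiplicities of composition factors. As [P m] may have simple quotients of
    labels above [m], a weight [m] only detects a composition factor of some label >= m, which
    suffices for upper bounds. Projectivity makes weights behave well under subquotients and
    extensions. *)
Definition weight_of M (m : L) : Prop := exists f : mhom (P m) M, nonzero f.

Lemma weight_sub N M (i : mhom N M) m : injective i -> weight_of N m -> weight_of M m.
Proof.
move=> injf [f [x fx]]; exists (mhom_comp i f), x => /=.
by apply: contra fx => /eqP/(inj_eq0 injf)->.
Qed.

Lemma weight_quo M Q (p : mhom M Q) m : surj p -> weight_of Q m -> weight_of M m.
Proof.
move=> sp [f [x fx]]; have [g gE] := hw_lifts f sp.
by exists g, x; apply: contra fx => /eqP gx; rewrite -gE gx linear0.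
Qed.

Lemma weight_ext N M Q (i : mhom N M) (p : mhom M Q) m : short_exact i p ->
  weight_of M m -> weight_of N m \/ weight_of Q m.
Proof.
move=> [inji sp ker] [f [x fx]].
have [pf0|npf] := zero_or_nonzero (mhom_comp p f); last by right; exists (mhom_comp p f).
have [g gE] := factor_inj (f := f) inji (fun x => iffLR (ker (f x)) (pf0 x)).
by left; exists g, x; apply: contra fx => /eqP gx; rewrite -gE gx linear0.
Qed.

Lemma weight_iso M N m : iso M N -> weight_of M m -> weight_of N m.
Proof. by move=> isoM; have [f [injf sf]] := iso_inj_surj isoM; apply: weight_sub injf. Qed.

Lemma weight_zero M m : zero_mod M -> ~ weight_of M m.
Proof. by move=> M0 [f [x]]; rewrite (M0 (f x)) eqxx. Qed.

Lemma q_surj l : surj (q l). Proof. by case: (hw_exact H l). Qed.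

Lemma weight_hom m Y (g : mhom (D m) Y) : nonzero g -> weight_of Y m.
Proof.
move=> [y gy]; have [x qx] := q_surj y.
by exists (mhom_comp g (q m)), x; rewrite /= qx.
Qed.

(** The kernel of [q l] is filtered by standard modules of labels above [l], and none of these maps
    nontrivially to [Y]. *)
Lemma hom_kernel_zero l Y (f : mhom (P l) Y) :
  (forall m, (l < m)%O -> ~ weight_of Y m) -> exists g : mhom (D l) Y, forall x, g (q l x) = f x.
Proof.
move=> nW; have [inji sq ker] := hw_exact H l.
apply: factor_surj => // x /ker[y <-].
have [fi0|nf] := zero_or_nonzero (mhom_comp f (hwi H l)); first exact: fi0.
have [m [Q [g [ms isoQ [z gz]]]]] := filt_hom (hwN_filt H l) nf.
case: (nW m (hws_lt ms)); have [h [injh sh]] := iso_inj_surj (iso_sym isoQ).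
by have [w hw] := sh z; apply: (@weight_hom _ _ (mhom_comp g h)); exists w; rewrite /= hw.
Qed.

Lemma hom_of_weight Y l : weight_of Y l ->
  exists m (g : mhom (D m) Y), (l <= m)%O /\ nonzero g.
Proof.
move=> [f [x fx]].
have [[m [g [lm ng]]]|nhom] := classic (exists m (g : mhom (D m) Y), (l < m)%O /\ nonzero g).
  by exists m, g; rewrite ltW.
have [inji sq ker] := hw_exact H l.
have [fi0|nf] := zero_or_nonzero (mhom_comp f (hwi H l)).
  have [|g gE] := factor_surj (f := f) sq; first by move=> y /ker[z <-]; apply: fi0.
  by exists l, g; split=> //; exists (q l x); rewrite gE.
have [m [Q [g [ms isoQ [z gz]]]]] := filt_hom (hwN_filt H l) nf.
have [h [injh sh]] := iso_inj_surj (iso_sym isoQ).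
have [w hw] := sh z; exists m, (mhom_comp g h); split; first exact: ltW (hws_lt ms).
by exists w; rewrite /= hw.
Qed.

Lemma weight_std l m : weight_of (D l) m -> (m <= l)%O.
Proof. by case=> f nf; apply: hw_hom_le nf. Qed.

Lemma std_nonzero l M (f : mhom (D l) M) : ~ zero_mod M -> surj f -> nonzero f.
Proof.
move=> nM sf; have [M0|[y y0]] := zero_mod_or M; first by [].
by have [x fx] := sf y; exists x; rewrite fx.
Qed.

Lemma weight_simple l E : hw_simple l E -> weight_of E l.
Proof. by move=> [[nE _] [f sf]]; apply: weight_hom (std_nonzero nE sf). Qed.

Lemma weight_simple_le l m E : hw_simple l E -> weight_of E m -> (m <= l)%O.
Proof. by move=> [_ [f sf]] /(weight_quo sf)/weight_std. Qed.

Lemma hw_simpleP E : simple E -> exists l, hw_simple l E.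
Proof.
move=> sE; case: (zero_mod_or E) => [E0|[x x0]]; first by case: sE.
pose f := mkhom (M := regular S) (@act_linl _ _ _ x) (fun a b => actM a b x).
have nf : nonzero f by exists (1 : S); rewrite /= act1.
have [s /filt_hom/(_ nf)[l [Q [g [_ isoQ [z gz]]]]]] := hw_regular H.
have [h [injh sh]] := iso_inj_surj (iso_sym isoQ).
exists l; split=> //; exists (mhom_comp g h); apply: simple_surj => //.
by have [w hw] := sh z; exists w; rewrite /= hw.
Qed.

Lemma filt_weight M s m : filtration hw_simple M s -> m \in s -> weight_of M m.
Proof.
elim=> {M s} // M N Q l s i p ex sQ _ IH; have [inji sp _] := ex.
rewrite inE => /orP[/eqP->|/IH]; last exact: weight_sub inji.
exact: weight_quo sp (weight_simple sQ).
Qed.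

Lemma composition_series M : exists s, filtration hw_simple M s.
Proof.
have [n] := ubnP (\dim {:M}); elim: n M => // n IH M leM.
have [M0|[x x0]] := zero_mod_or M; first by exists [::]; apply: FiltNil.
have [E [p [sE sp]]] := simple_quotient (nonzero_mod x0).
have [l sl] := hw_simpleP sE; have [K [i ex]] := ker_exists sp.
have [|s FK] := IH K; last by exists (l :: s); apply: FiltCons ex sl FK.
by rewrite -ltnS; apply: leq_trans leM; apply: short_exact_dim_lt ex _; case: sE.
Qed.

Lemma filt_weight_le M s m : filtration hw_simple M s -> weight_of M m ->
  exists2 l, l \in s & (m <= l)%O.
Proof.
elim=> {M s} [M M0 /(weight_zero M0)//|M N Q l s i p ex sQ _ IH].
move=> /(weight_ext ex)[/IH[k ks mk]|/(weight_simple_le sQ) ml].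
  by exists k; rewrite ?inE ?ks ?orbT.
by exists l; rewrite ?mem_head.
Qed.

(** Turns the condition on composition series into one on weights, which visibly passes to
    submodules and extensions. *)
Lemma truncatedP l M : truncated hw_simple l M <-> forall m, weight_of M m -> (m <= l)%O.
Proof.
split=> [[s FM sl] m|Wl].
  by move=> /(filt_weight_le FM)[k /(allP sl) kl mk]; apply: le_trans kl.
by have [s FM] := composition_series M; exists s => //; apply/allP => m /(filt_weight FM)/Wl.
Qed.

(** A nonzero map from [P l] to the radical of [D l] would be a nonzero multiple of [q l], hence
    onto [D l]. *)
Lemma rad_weight l E R (r : mhom (D l) E) (j : mhom R (D l)) :
  simple E -> short_exact j r -> ~ weight_of R l.
Proof.
move=> [nE _] [injj sr ker] [f [x fx]]; apply: nE => y.
have [c fE] := hw_hom_scal (mhom_comp j f).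
have c0 : c != 0.
  by apply: contra fx => /eqP c0; apply/eqP/(inj_eq0 injj); rewrite [LHS]fE c0 scale0r.
have [z <-] := sr y; have [w <-] := q_surj z; apply/ker.
exists (c^-1 *: f w); have /= jf := fE w.
by rewrite linearZ /= jf scalerA mulVf ?scale1r.
Qed.

(** * Costandard modules: socle, Ext^1-vanishing, multiplicity one *)

Lemma nabla_weight l N m : nabla l N -> weight_of N m -> (m <= l)%O.
Proof. by case=> /truncatedP Wl _ _; apply: Wl. Qed.

Lemma nabla_socle l N : nabla l N -> exists E (i : mhom E N),
  [/\ hw_simple l E, injective i
    & forall X (g : mhom N X), ~ injective g -> forall x, g (i x) = 0].
Proof.
case=> _ [E [i [sE inji ess]]] _; exists E, i; split=> // X g ng x.
apply/eqP; case: eqP => // /eqP gx; case: ng; apply: ess.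
by apply: (simple_inj (f := mhom_comp g i)); [case: sE | exists x].
Qed.

Lemma nabla_nonzero l N : nabla l N -> ~ zero_mod N.
Proof.
move=> /nabla_socle[E [i [[[nE _] _] inji _]]] N0; apply: nE => x; apply: inji.
by rewrite linear0; apply: N0.
Qed.

Lemma nabla_hom_socle N Y (g : mhom Y N) E (i : mhom E N) :
  (forall X (g : mhom N X), ~ injective g -> forall x, g (i x) = 0) ->
  nonzero g -> forall x, exists y, g y = i x.
Proof.
move=> ess [y gy] x; have [Q [p [sp ker]]] := quomod_exists (stable_im g).
apply/ker/ess => injp; have : p (g y) = 0 by apply/ker; exists y.
by move/(inj_eq0 injp)/eqP; rewrite (negPf gy).
Qed.

(** The socle of a costandard module is essential, so the image of [g] contains the simple module of
    label [l]. *)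
Lemma nabla_hom l N Y (g : mhom Y N) : nabla l N -> nonzero g -> weight_of Y l.
Proof.
move=> /nabla_socle[E [i [sE inji ess]]] ng.
have ex := nabla_hom_socle ess ng.
have [K [j [injj jK]]] := submod_exists (stable_im g).
have [g' g'E] := factor_inj (f := g) injj (fun x => iffLR (jK _) (ex_intro _ x erefl)).
have [e eE] := factor_inj (f := i) injj (fun x => iffLR (jK _) (ex x)).
apply: (@weight_quo _ _ g').
  by move=> y; have [x xE] := iffRL (jK (j y)) (ex_intro _ y erefl); exists x; apply: injj; rewrite g'E.
apply: (weight_sub (i := e)) (weight_simple sE).
by move=> x y exy; apply: inji; rewrite -!eE exy.
Qed.

(** Dividing [Y] by the image of the kernel of [f] leaves an extension of [Q] by the image of [f] in
    [N]. This extension is truncated at [l], so relative injectivity of [N] applies to it. *)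
Lemma nabla_ext_truncated l N Q : nabla l N ->
  (forall m, weight_of Q m -> (m <= l)%O) -> ext0 Q N.
Proof.
move=> nN WQ X Y i p [inji sp ker] f.
have [|Y' [p1 [sp1 ker1]]] := @quomod_exists _ _ Y (fun y => exists x, f x = 0 /\ i x = y).
  split=> [|c _ _ [x [fx <-]] [y [fy <-]]|a _ [x [fx <-]]].
  - by exists 0; rewrite !linear0.
  - by exists (c *: x + y); rewrite !linearP fx fy scaler0 addr0.
  - by exists (act a x); rewrite !mhom_act fx act0r.
have [K [j [injj jK]]] := submod_exists (stable_im f).
have [f' f'E] := factor_inj (f := f) injj (fun x => iffLR (jK _) (ex_intro _ x erefl)).
have sf' : surj f'.
  by move=> y; have [x xE] := iffRL (jK (j y)) (ex_intro _ y erefl); exists x; apply: injj; rewrite f'E.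
have [|a aE] := factor_surj (f := mhom_comp p1 i) sf'.
  by move=> x f'x; apply/ker1; exists x; rewrite -f'E f'x linear0.
have inja : injective a.
  apply: mhom_inj => y; have [x <-] := sf' y; rewrite aE => /ker1[x' [fx' /inji ex]].
  by apply: injj; rewrite f'E -ex fx' linear0.
have [|p' p'E] := factor_surj (f := p) sp1.
  by move=> y /ker1[x [_ <-]]; apply/ker; exists x.
have exK : short_exact a p'.
  split=> // [z|y]; first by have [y <-] := sp z; exists (p1 y).
  split=> [|[z <-]].
    have [y' <-] := sp1 y; rewrite p'E => /ker[x <-].
    by exists (f' x); rewrite aE.
  by have [x <-] := sf' z; rewrite aE p'E; apply/ker; exists x.
have WK m : weight_of K m -> (m <= l)%O by move/(weight_sub injj)/(nabla_weight nN).
case: nN => _ _ /(_ K Y' a j)[||//|h hE]; first exact/truncatedP.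
  by apply/truncatedP => m /(weight_ext exK)[/WK|/WQ].
by exists (mhom_comp h p1) => x /=; have /= <- := aE x; rewrite hE f'E.
Qed.

(** For j <= l the module [D j] is itself truncated. Otherwise the kernel of [P j] -> [D j] has no
    nonzero map to [N], since such a map would give [N] a weight above [j]. *)
Lemma nabla_ext_std l N j : nabla l N -> ext0 (D j) N.
Proof.
move=> nN; have [jl|njl] := boolP (j <= l)%O.
  by apply: nabla_ext_truncated nN _ => m /weight_std mj; apply: le_trans jl.
apply: (ext0_presented (@hw_lifts _ _ _ _ _ H j) (hw_exact H j)) => f.
have [f0|nf] := zero_or_nonzero f; first by exists (mhom_zero _ _) => x; rewrite f0.
have [m [Q [g [ms isoQ [z gz]]]]] := filt_hom (hwN_filt H j) nf.
have [h [injh sh]] := iso_inj_surj (iso_sym isoQ); have [w hw] := sh z.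
case/negP: njl; apply: le_trans (ltW (hws_lt ms)) (nabla_weight nN _).
by apply: (@weight_hom _ _ (mhom_comp g h)); exists w; rewrite /= hw.
Qed.

Lemma costd_filt_ext_std j Y s : filtration nabla Y s -> ext0 (D j) Y.
Proof.
elim=> {Y s} [Y Y0|Y N1 Q l s i p [inji sp ker] nQ _ IH].
  by move=> X Z a b _ f; exists (mhom_zero _ _) => x; rewrite [RHS]Y0.
apply: (ext0_presented (@hw_lifts _ _ _ _ _ H j) (hw_exact H j)) => f.
have [h2 h2E] := nabla_ext_std (j := j) nQ (hw_exact H j) (mhom_comp p f).
have [h hE] := hw_lifts h2 sp.
have [|f1 f1E] := factor_inj (f := mhom_sub f (mhom_comp h (hwi H j))) inji.
  by move=> x; apply/ker; rewrite mhom_subE linearB /= hE h2E subrr.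
have [h1 h1E] := IH _ _ _ _ (hw_exact H j) f1.
exists (mhom_add h (mhom_comp i h1)) => x /=.
by rewrite h1E f1E mhom_subE /= addrC subrK.
Qed.

Lemma std_costd_ext M Y s t : filtration std M s -> filtration nabla Y t -> ext0 M Y.
Proof.
move=> FM FY; apply: (ext0_filt FM) => l Q _ /iso_sym isoQ.
exact: ext0_iso isoQ (costd_filt_ext_std FY).
Qed.

(** A map to [N] from the kernel of [P j] -> [E] is corrected, using the vanishing for [D j], so as
    to factor through the radical of [D j]. A nonzero map from there puts a weight [l] in the
    radical, forcing l < j. *)
Lemma nabla_ext_simple l N j E : nabla l N -> hw_simple j E -> ~ (l < j)%O -> ext0 E N.
Proof.
move=> nN [sE [r sr]] nlj.
have [inji sq ker] := hw_exact H j.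
have srq : surj (mhom_comp r (q j)).
  by move=> z; have [y <-] := sr z; have [x <-] := sq y; exists x.
have [K [k exK]] := ker_exists srq; have [injk _ kerk] := exK.
apply: (ext0_presented (@hw_lifts _ _ _ _ _ H j) exK) => f.
have [|u uE] := factor_inj (f := hwi H j) injk.
  by move=> x; apply/kerk; rewrite /= (iffRL (ker _)) ?linear0 //; exists x.
have [h hE] := nabla_ext_std (j := j) nN (hw_exact H j) (mhom_comp f u).
have [R [t exR]] := ker_exists sr; have [injt _ kert] := exR.
have [|v vE] := factor_inj (f := mhom_comp (q j) k) injt.
  by move=> x; apply/kert; apply/(kerk (k x)); exists x.
have sv : surj v.
  move=> y; have [x xE] := sq (t y).
  have /kerk[z zE] : mhom_comp r (q j) x = 0 by rewrite /= xE; apply/kert; exists y.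
  by exists z; apply: injt; rewrite vE /= zE.
have [|g gE] := factor_surj (f := mhom_sub f (mhom_comp h k)) sv.
  move=> x vx; have /ker[y yE] : q j (k x) = 0 by have /= <- := vE x; rewrite vx linear0.
  have -> : x = u y by apply: injk; rewrite uE.
  by rewrite mhom_subE /= uE hE subrr.
have [g0|ng] := zero_or_nonzero g.
  exists h => x; have := gE x; rewrite g0 mhom_subE /= => /esym/eqP.
  by rewrite subr_eq0 => /eqP.
case: nlj; have WR := nabla_hom nN ng.
rewrite lt_neqAle (weight_std (weight_sub injt WR)) andbT.
by apply/eqP => lj; rewrite lj in WR; case: (rad_weight sE exR WR).
Qed.

Lemma nabla_ext_nabla l m M N : nabla m M -> nabla l N -> ~ (l < m)%O -> ext0 M N.
Proof.
move=> [[s FM sm] _ _] nN nlm; apply: (ext0_filt FM) => j Q js sQ.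
apply: nabla_ext_simple nN sQ _ => lj; apply: nlm.
exact: lt_le_trans lj (allP sm j js).
Qed.

(** The simple module of label [l] occurs in the costandard module only as its socle: a map from
    [P l] to [N] factors through [D l], kills its radical by [rad_weight], and hence lands in the
    socle, which [p] annihilates. *)
Lemma nabla_multiplicity_one l N X E (i : mhom E N) (p : mhom N X) :
  nabla l N -> hw_simple l E -> injective i ->
  (forall X (g : mhom N X), ~ injective g -> forall x, g (i x) = 0) ->
  surj p -> (forall x, p (i x) = 0) -> ~ weight_of X l.
Proof.
move=> nN sE inji ess sp pi0 [f [x fx]].
have [g gE] := hw_lifts f sp.
have [|g' g'E] := hom_kernel_zero g.
  by move=> m lm /(nabla_weight nN); rewrite lt_geF.
have [E0 [r [sE0 sr]]] := simple_quotient (@hw_std_neq0 _ _ _ _ _ H l).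
have [R [j exR]] := ker_exists sr; have [injj _ kerj] := exR.
have [g'j0|ng] := zero_or_nonzero (mhom_comp g' j); last first.
  exact: rad_weight sE0 exR (nabla_hom nN ng).
have [|g2 g2E] := factor_surj (f := g') sr.
  by move=> y /kerj[z <-]; apply: g'j0.
have [g20|ng2] := zero_or_nonzero g2.
  by case/eqP: fx; rewrite -gE -g'E -g2E g20 linear0.
have injg2 := simple_inj sE0 ng2.
have [e eE] := factor_inj (f := i) injg2 (nabla_hom_socle ess ng2).
have se : surj e.
  apply: simple_surj sE0 _; have [E0'|[z z0]] := zero_mod_or E; first by case: sE => -[].
  exists z; apply: contra z0 => /eqP ez; apply/eqP/(inj_eq0 inji).
  by rewrite -eE ez linear0.
by case/eqP: fx; rewrite -gE -g'E -g2E; have [z <-] := se (r (q l x)); rewrite eE.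
Qed.

(** If [g] killed the socle, its image would have no weight [l], although every nonzero submodule of
    [N'] has one. Surjectivity: relative injectivity gives a retraction of [g], which is injective
    for the same reason. *)
Lemma nabla_bij l N N' (g : mhom N N') : nabla l N -> nabla l N' -> nonzero g ->
  injective g /\ surj g.
Proof.
have inj M M' (f : mhom M M') : nabla l M -> nabla l M' -> nonzero f -> injective f.
  move=> nM nM' nf; apply: NNPP => ninj.
  have [E [i [sE inji ess]]] := nabla_socle nM.
  have [K [j [injj jK]]] := submod_exists (stable_im f).
  have [f' f'E] := factor_inj (f := f) injj (fun x => iffLR (jK _) (ex_intro _ x erefl)).
  have sf' : surj f'.
    by move=> y; have [x xE] := iffRL (jK (j y)) (ex_intro _ y erefl); exists x; apply: injj; rewrite f'E.
  apply: (nabla_multiplicity_one nM sE inji ess sf').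
    by move=> x; apply: injj; rewrite f'E linear0; apply: ess.
  apply: (nabla_hom (g := j)) nM' _; have [x fx] := nf.
  by exists (f' x); rewrite f'E.
move=> nN nN' ng; have injg := inj _ _ _ nN nN' ng; split=> // y.
have [tN _ inN] := nN; have [tN' _ _] := nN'.
have [h hg] := inN _ _ g (mhom_id N) tN tN' injg.
have injh : injective h.
  apply: inj nN' nN _; have [x gx] := ng; exists (g x); rewrite hg.
  by apply: contra gx => /eqP/=->; rewrite linear0.
by exists (h y); apply: injh; rewrite hg.
Qed.

(** If [g] vanishes on [N1] it factors through the top layer, whose label is then [l] by maximality,
    and [nabla_bij] applies. Otherwise the layer is removed and the kernel is rebuilt from the
    smaller one. *)
Lemma costd_filt_split l Y N0 s (g : mhom Y N0) : filtration nabla Y s -> nabla l N0 ->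
  (forall m, m \in s -> (l <= m)%O -> m = l) -> nonzero g ->
  exists K (i : mhom K Y) s',
    [/\ short_exact i g, filtration nabla K s' & perm_eq s (l :: s')].
Proof.
move=> FY nN0; elim: FY g => {Y s} [Y Y0 g _ [x]|Y N1 Q m s i p ex nQ FN IH g lmax ng].
  by rewrite (Y0 x) linear0 eqxx.
have [inji sp ker] := ex.
have [gi0|ngi] := zero_or_nonzero (mhom_comp g i).
  have [|g' g'E] := factor_surj (f := g) sp; first by move=> y /ker[x <-]; apply: gi0.
  have ng' : nonzero g' by have [x gx] := ng; exists (p x); rewrite g'E.
  have ml := lmax m (mem_head _ _) (nabla_weight nQ (nabla_hom nN0 ng')).
  subst m; have [injg' sg'] := nabla_bij nQ nN0 ng'.
  exists N1, i, s; split=> //; split=> // [z|y].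
    by have [y <-] := sg' z; have [x <-] := sp y; exists x; rewrite g'E.
  by rewrite -ker -g'E; split=> [/(inj_eq0 injg')//|->]; rewrite linear0.
have [|K1 [i1 [s' [[inji1 sg1 ker1] FK1 sE]]]] := IH _ _ ngi.
  by move=> k ks; apply: lmax; rewrite inE ks orbT.
have sg : surj g by move=> z; have [x <-] := sg1 z; exists (i x).
have [K [j exK]] := ker_exists sg; have [injj _ kerj] := exK.
have [|k kE] := factor_inj (f := mhom_comp i i1) injj.
  by move=> x; apply/kerj; apply/(ker1 (i1 x)); exists x.
exists K, j, (m :: s'); split=> //; last first.
  by rewrite -(perm_cat2l [:: m]) /= in sE; rewrite (perm_trans sE) // (perm_catCA [:: m] [:: l]).
apply: (FiltCons (i := k) (p := mhom_comp p j)) nQ FK1; split.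
- by move=> x y e; apply: inji1; apply: inji; move: (kE x) (kE y) => /= <- <-; rewrite e.
- move=> z; have [y <-] := sp z; have [n /= nE] := sg1 (g y).
  have /kerj[x xE] : g (y - i n) = 0 by rewrite linearB nE subrr.
  exists x; rewrite /= xE linearB (iffRL (ker (i n))) ?subr0 //; by exists n.
- move=> y /=; split=> [/ker[n nE]|[x <-]].
    have /ker1[x xE] : mhom_comp g i n = 0 by rewrite /= nE; apply/kerj; exists y.
    by exists x; apply: injj; rewrite kE /= xE.
  by rewrite kE; apply/ker; eexists.
Qed.

(** Maximality of [l] is what makes Ext^1 from the layers above vanish, so that a map found deeper
    in the filtration extends to [Y]. *)
Lemma costd_filt_top l Y s : filtration nabla Y s -> l \in s ->
  (forall m, m \in s -> (l <= m)%O -> m = l) ->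
  exists N0 (g : mhom Y N0), nabla l N0 /\ nonzero g.
Proof.
elim=> {Y s} // Y N1 Q m s i p ex nQ FN IH ls lmax.
have [ls1|nls1] := boolP (l \in s); last first.
  move: ls; rewrite inE (negPf nls1) orbF => /eqP lm; subst m.
  exists Q, p; split=> //; have [Q0|[z z0]] := zero_mod_or Q.
    by case: (nabla_nonzero nQ).
  by have [_ sp _] := ex; have [x px] := sp z; exists x; rewrite px.
have [|N0 [g [nN0 [x gx]]]] := IH ls1; first by move=> k ks; apply: lmax; rewrite inE ks orbT.
have [|h hE] := nabla_ext_nabla nQ nN0 _ ex g.
  by move=> lm; have := lmax m (mem_head _ _) (ltW lm); apply/eqP; rewrite gt_eqF.
by exists N0, h; split=> //; exists (i x); rewrite hE.
Qed.

(** Induction on the length, with [g] a nonzero map from [Y] to a costandard module of maximal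
    label. If [g] vanishes on [X], then [X] is a summand of the kernel of [g]. Otherwise [g] may be
    replaced by its composite with the projector onto [X], and the kernel of [g] on [X] is a summand
    of the kernel of that composite. *)
Lemma costd_filt_summand X Y s : filtration nabla Y s -> summand X Y ->
  exists s', filtration nabla X s'.
Proof.
have [n] := ubnP (size s); elim: n X Y s => // n IH X Y s les FY [i [p pi]].
have [s0|sn0] := eqVneq s [::].
  exists [::]; apply: FiltNil => x; rewrite -(pi x).
  suff Y0 : zero_mod Y by rewrite (Y0 (i x)) linear0.
  have [//|[y y0]] := zero_mod_or Y.
  have : nonzero (mhom_id Y) by exists y.
  by move=> /(filt_hom FY)[? [? [? []]]]; rewrite s0.
have [l ls lmax] := max_label sn0.
have [N0 [g [nN0 ng]]] := costd_filt_top FY ls lmax.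
have [gi0|ngi] := zero_or_nonzero (mhom_comp g i).
  have [K [j [s' [[injj sg ker] FK sE]]]] := costd_filt_split FY nN0 lmax ng.
  apply: (IH X K s') FK _; first by rewrite (perm_size sE) in les.
  have [i' i'E] := factor_inj (f := i) injj (fun x => iffLR (ker _) (gi0 x)).
  by exists i', (mhom_comp p j) => x /=; rewrite i'E pi.
have ngip : nonzero (mhom_comp (mhom_comp g i) p).
  by have [x gx] := ngi; exists (i x); rewrite /= pi.
have [K [j [s' [[injj sg ker] FK sE]]]] := costd_filt_split FY nN0 lmax ngip.
have sgi : surj (mhom_comp g i) by move=> z; have [x <-] := sg z; exists (p x).
have [X' [k exk]] := ker_exists sgi; have [injk _ kerk] := exk.
have [|||s'' FX'] := IH X' K s'; rewrite ?(perm_size sE) // in les *.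
- have [|i' i'E] := factor_inj (f := mhom_comp i k) injj.
    by move=> x; apply/ker; rewrite /= pi; apply/(kerk (k x)); exists x.
  have [|p' p'E] := factor_inj (f := mhom_comp p j) injk.
    by move=> y; apply/kerk; apply/(ker (j y)); exists y.
  by exists i', p' => x; apply: injk; rewrite p'E /= i'E /= pi.
by exists (l :: s''); apply: FiltCons exk nN0 FX'.
Qed.

(** * Summands of modules with a standard filtration *)

Lemma std_filt_weight Y s m : filtration std Y s -> weight_of Y m ->
  exists2 l, l \in s & (m <= l)%O.
Proof.
elim=> {Y s} [M M0 /(weight_zero M0)//|M N Q l s i p ex isoQ _ IH].
move=> /(weight_ext ex)[/IH[k ks mk]|/(weight_iso isoQ)/weight_std ml].
  by exists k; rewrite ?inE ?ks ?orbT.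
by exists l; rewrite ?mem_head.
Qed.

Lemma std_label_weight Y s m : filtration std Y s -> m \in s -> weight_of Y m.
Proof.
elim=> {Y s} // Y N Q l s i p [inji sp _] isoQ _ IH.
rewrite inE => /orP[/eqP->|/IH]; last exact: weight_sub inji.
apply: weight_quo sp _; apply: (weight_iso (iso_sym isoQ)).
apply: (@weight_hom _ _ (mhom_id _)).
have [D0|[x x0]] := zero_mod_or (D l); last by exists x.
by case: (hw_std_neq0 H D0).
Qed.

Lemma std_endo_bij l (f : mhom (D l) (D l)) : nonzero f -> injective f /\ surj f.
Proof.
move=> [y fy]; have [c cE] := hw_hom_scal (mhom_comp f (q l)).
have fE x : f x = c *: x by have [z <-] := q_surj x; apply: cE.
have c0 : c != 0 by apply: contra fy => /eqP c0; rewrite fE c0 scale0r.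
split=> [|x]; last by exists (c^-1 *: x); rewrite fE scalerA mulfV ?scale1r.
by move=> x x'; rewrite !fE => /(scalerI c0).
Qed.

Lemma std_filt_split l Y s (g : mhom (D l) Y) : filtration std Y s ->
  (forall m, m \in s -> (l <= m)%O -> m = l) -> nonzero g ->
  exists C (p : mhom Y C) s',
    [/\ short_exact g p, filtration std C s' & perm_eq s (l :: s')].
Proof.
move=> FY; elim: FY g => {Y s} [Y Y0 g _ [x]|Y N1 Q m s i p ex isoQ FN IH g lmax ng].
  by rewrite (Y0 (g x)) eqxx.
have [inji sp ker] := ex.
have [pg0|npg] := zero_or_nonzero (mhom_comp p g); last first.
  have [t [injt st]] := iso_inj_surj isoQ.
  have nt : nonzero (mhom_comp t (mhom_comp p g)).
    by have [x gx] := npg; exists x; apply: contra gx => /eqP/(inj_eq0 injt)->.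
  have ml := lmax m (mem_head _ _) (weight_std (weight_hom nt)).
  subst m; have [injtg stg] := std_endo_bij nt.
  have injg : injective g by move=> x y e; apply: injtg; rewrite /= e.
  have [C [r exr]] := coker_exists injg; have [_ sr kerr] := exr.
  exists C, r, s; split=> //; apply: filt_iso FN.
  apply: (inj_surj_iso (f := mhom_comp r i)).
    apply: mhom_inj => x /kerr[y yE]; apply: (inj_eq0 inji).
    rewrite -yE (_ : y = 0) ?linear0 //; apply: (inj_eq0 injtg).
    by rewrite /= yE (iffRL (ker (i x))) ?linear0 //; exists x.
  move=> z; have [y <-] := sr z; have [w wE] := stg (t (p y)).
  have /ker[x xE] : p (y - g w) = 0 by rewrite linearB; move/injt: wE => /= ->; rewrite subrr.
  by exists x; rewrite /= xE linearB (iffRL (kerr (g w))) ?subr0 //; exists w.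
have [g' g'E] := factor_inj (f := g) inji (fun x => iffLR (ker _) (pg0 x)).
have [||C1 [p1 [s' [[injg' sp1 ker1] FC1 sE]]]] := IH g'.
- by move=> k ks; apply: lmax; rewrite inE ks orbT.
- by have [x gx] := ng; exists x; apply: contra gx => /eqP g'x; rewrite -g'E g'x linear0.
have injg : injective g by move=> x y; rewrite -!g'E => /inji/injg'.
have [C [r exr]] := coker_exists injg; have [_ sr kerr] := exr.
exists C, r, (m :: s'); split=> //; last first.
  by rewrite -(perm_cat2l [:: m]) /= in sE; rewrite (perm_trans sE) // (perm_catCA [:: m] [:: l]).
have [|u uE] := factor_surj (f := mhom_comp r i) sp1.
  by move=> x /ker1[y <-]; apply/kerr; exists y; rewrite g'E.
have [|v vE] := factor_surj (f := p) sr.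
  by move=> y /kerr[x <-]; apply: pg0.
apply: (FiltCons (i := u) (p := v)) isoQ FC1; split.
- apply: mhom_inj => c; have [x <-] := sp1 c; rewrite uE => /kerr[y].
  by rewrite -g'E => /inji yE; apply/ker1; exists y.
- by move=> z; have [y <-] := sp z; exists (r y).
- move=> c; have [y <-] := sr c; rewrite vE; split=> [/ker[x <-]|[w wE]].
    by exists (p1 x); rewrite uE.
  have [x xE] := sp1 w; have : r (y - i x) = 0 by rewrite linearB -wE -xE uE subrr.
  case/kerr => z zE; apply/ker; exists (x + g' z).
  by rewrite linearD g'E zE addrC subrK.
Qed.

(** If the top layer is [D l], the projective [P l] lifts it into [Y]; since no label exceeds [l],
    the lift factors through [D l]. *)
Lemma std_filt_bottom l Y s : filtration std Y s -> l \in s ->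
  (forall m, m \in s -> (l <= m)%O -> m = l) -> exists g : mhom (D l) Y, nonzero g.
Proof.
elim=> {Y s} // Y N1 Q m s i p ex isoQ FN IH ls lmax.
have FY : filtration std Y (m :: s) := FiltCons ex isoQ FN.
have [inji sp ker] := ex; have [lm|nlm] := eqVneq l m; last first.
  have [||g [x gx]] := IH.
  - by move: ls; rewrite inE (negPf nlm).
  - by move=> k ks; apply: lmax; rewrite inE ks orbT.
  by exists (mhom_comp i g), x; apply: contra gx => /eqP/(inj_eq0 inji)->.
subst m; have [h [injh sh]] := iso_inj_surj (iso_sym isoQ).
have [f fE] := hw_lifts (mhom_comp h (q l)) sp.
have [|g gE] := hom_kernel_zero f.
  move=> m lm /(std_filt_weight FY)[k ks mk].
  by have kl := lmax k ks (le_trans (ltW lm) mk); rewrite kl (lt_geF lm) in mk.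
exists g; have [D0|[y y0]] := zero_mod_or (D l); first by case: (hw_std_neq0 H D0).
have [x xE] := q_surj y; exists (q l x); rewrite gE.
apply: contra y0 => /eqP fx; rewrite -xE; apply/eqP/(inj_eq0 injh).
by have /= <- := fE x; rewrite fx linear0.
Qed.

(** Dual to the costandard case: submodules [D l] of maximal label are split off at the bottom, and
    [std_endo_bij] plays the part of [nabla_bij]. *)
Lemma std_filt_summand X Y s : filtration std Y s -> summand X Y ->
  exists s', filtration std X s'.
Proof.
have [n] := ubnP (size s); elim: n X Y s => // n IH X Y s les FY [i [p pi]].
have [s0|sn0] := eqVneq s [::].
  exists [::]; apply: FiltNil => x; rewrite -(pi x).
  suff Y0 : zero_mod Y by rewrite (Y0 (i x)) linear0.
  have [//|[y y0]] := zero_mod_or Y.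
  have : nonzero (mhom_id Y) by exists y.
  by move=> /(filt_hom FY)[? [? [? []]]]; rewrite s0.
have [l ls lmax] := max_label sn0.
have [g ng] := std_filt_bottom FY ls lmax.
have [pg0|npg] := zero_or_nonzero (mhom_comp p g).
  have [C [r [s' [[injg sr ker] FC sE]]]] := std_filt_split FY lmax ng.
  apply: (IH X C s') FC _; first by rewrite (perm_size sE) in les.
  have [|p' p'E] := factor_surj (f := p) sr; first by move=> y /ker[x <-]; apply: pg0.
  by exists (mhom_comp r i), p' => x /=; rewrite p'E pi.
have nipg : nonzero (mhom_comp i (mhom_comp p g)).
  by have [x gx] := npg; exists x; apply: contra gx => /eqP ix; rewrite -(pi (mhom_comp p g x)) [i _]ix linear0.
have [C [r [s' [[injg sr ker] FC sE]]]] := std_filt_split FY lmax nipg.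
have injpg : injective (mhom_comp p g) by move=> x y e; apply: injg => /=; move: e => /= ->.
have [X' [k exk]] := coker_exists injpg; have [_ sk kerk] := exk.
have [|||s'' FX'] := IH X' C s'; rewrite ?(perm_size sE) // in les *.
- have [|i' i'E] := factor_surj (f := mhom_comp r i) sk.
    by move=> x /kerk[y <-]; apply/ker; exists y.
  have [|p' p'E] := factor_surj (f := mhom_comp k p) sr.
    by move=> y /ker[x <-]; apply/kerk; exists x; rewrite /= pi.
  by exists i', p' => z; have [x <-] := sk z; rewrite i'E /= p'E /= pi.
exists (s'' ++ [:: l]); apply: filt_cat exk FX' _; apply: filt_single; exact: iso_refl.
Qed.

End HighestWeight.

(** * Indecomposable tilting modules *)

Section Fitting.
Variables (F : fieldType) (S : freeAlgType F).
Implicit Types M N X Y : fmod S.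

Lemma surj_endo_inj M (f : mhom M M) : surj f -> injective f.
Proof. by move=> sf; apply: NNPP => /(dim_surj_lt sf); rewrite ltnn. Qed.

Fixpoint mhom_iter M (g : mhom M M) n : mhom M M :=
  if n is n'.+1 then mhom_comp g (mhom_iter g n') else mhom_id M.

Lemma mhom_iterD M (g : mhom M M) m n x :
  mhom_iter g (m + n) x = mhom_iter g m (mhom_iter g n x).
Proof. by elim: m => //= m ->. Qed.

Lemma im_iter_stable M (g : mhom M M) : exists2 n, (0 < n)%N &
  forall x, exists y, mhom_iter g n x = mhom_iter g n (mhom_iter g n y).
Proof.
pose I n := limg (linfun (mhom_iter g n)).
suff low d n : (0 < n)%N -> (\dim (I n) < d)%N -> exists2 n, (0 < n)%N &
    forall x, exists y, mhom_iter g n x = mhom_iter g n (mhom_iter g n y).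
  exact: (low (\dim (I 1%N)).+1 1%N).
elim: d n => // d IH n n0 len.
have [|/not_all_ex_not[x nx]] :=
  classic (forall x, exists y, mhom_iter g n x = mhom_iter g n (mhom_iter g n y)).
  by exists n.
apply: (IH (n + n)%N); first by rewrite addn_gt0 n0.
rewrite -ltnS; apply: leq_trans len; rewrite ltnS ltn_neqAle.
have sub : (I (n + n)%N <= I n)%VS.
  apply/subvP => _ /memv_imgP[y _ ->]; rewrite lfunE /= mhom_iterD.
  by rewrite -[mhom_iter g n _]lfunE memv_img ?memvf.
rewrite dimvS // andbT; apply/negP => /eqP dE; apply: nx.
have /eqP/esym IE : I (n + n)%N == I n by rewrite eqEdim sub dE /=.
have : mhom_iter g n x \in I n by rewrite -[mhom_iter g n _]lfunE memv_img ?memvf.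
by rewrite IE => /memv_imgP[y _ ->]; exists y; rewrite lfunE /= mhom_iterD.
Qed.

(** [X] is the image of a power g^n whose image no longer shrinks under g^n, so g^n is bijective on
    [X] and splits it off. As n > 0, [g] is injective there, and [f] lands in [X] since f = c^-n g^n
    f. *)
Lemma fitting M N (g : mhom M M) (f : mhom N M) c :
  c != 0 -> (forall x, g (f x) = c *: f x) ->
  exists X (i : mhom X M) (p : mhom M X) (h : mhom N X),
    [/\ forall x, p (i x) = x, injective (mhom_comp g i) & forall x, i (h x) = f x].
Proof.
move=> c0 gf; have [n n0 nE] := im_iter_stable g.
have [X [i [inji iX]]] := submod_exists (stable_im (mhom_iter g n)).
have [r rE] := factor_inj (f := mhom_iter g n) inji (fun x => iffLR (iX _) (ex_intro _ x erefl)).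
have sri : surj (mhom_comp r i).
  move=> x; have [y yE] := iffRL (iX (i x)) (ex_intro _ x erefl).
  have [z zE] := nE y; exists (r z); apply: inji.
  by rewrite /= !rE -zE.
have [k [kK Kk]] := bij_inverse (surj_endo_inj sri) sri.
have fn m x : mhom_iter g m (f x) = c ^+ m *: f x.
  by elim: m => /= [|m ->]; rewrite ?scale1r // linearZ /= gf scalerA exprSr.
have [|h hE] := factor_inj (f := f) inji.
  by move=> x; apply/iX; exists (c ^- n *: f x); rewrite linearZ /= fn scalerA mulVf ?scale1r ?expf_neq0.
exists X, i, (mhom_comp k r), h; split=> //.
apply: mhom_inj => x /= gx; apply: (inj_eq0 (surj_endo_inj sri)); apply: inji.
rewrite /= rE linear0; case: n n0 {nE iX rE fn} => // n _.
by rewrite -addn1 mhom_iterD /= gx linear0.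
Qed.

Lemma complement_proj M (U W : {vspace M}) (sU : stable U) (sW : stable W) :
  (U + W)%VS = fullv -> (U :&: W)%VS = 0%VS ->
  exists p : mhom M (submod sU),
    (forall x, p (submod_in sU x) = x) /\ (forall x, x - submod_in sU (p x) \in W).
Proof.
move=> UW UW0; have zero x : x \in U -> x \in W -> x = 0.
  by move=> Ux Wx; apply/eqP; rewrite -memv0 -UW0 memv_cap Ux.
have [||||p pE] := mhom_of_rel (r := fun x (u : submod sU) => x - submod_in sU u \in W).
- move=> x; have /memv_addP[u Uu [w Ww ->]] : x \in (U + W)%VS by rewrite UW memvf.
  by have [v <-] := iffLR (submod_im sU u) Uu; exists v; rewrite addrC addKr.
- move=> u; rewrite sub0r memvN => Wu; apply: (inj_eq0 (submod_inj sU)).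
  by apply: zero Wu; apply/(submod_im sU); exists u.
- move=> c x x' u u' Wu Wu'; rewrite linearP opprD addrACA -scalerBr.
  by rewrite memvD ?memvZ.
- by move=> a x u Wu; rewrite mhom_act -actBr sW.
exists p; split=> // x; apply: (submod_inj sU); apply/eqP.
rewrite eq_sym -subr_eq0 -linearB; apply/eqP; apply: zero.
  by apply/(submod_im sU); eexists.
by rewrite linearB.
Qed.

(** In a decomposition of [X] into two stable subspaces [f] cannot vanish after both projections, so
    one passes to a summand of smaller dimension. *)
Lemma indec_summand N X (f : mhom N X) : nonzero f ->
  exists Z (i : mhom Z X) (p : mhom X Z),
    [/\ forall x, p (i x) = x, indecomposable Z & nonzero (mhom_comp p f)].
Proof.
have [n] := ubnP (\dim {:X}); elim: n X f => // n IH X f leX nf.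
have [iX|niX] := classic (indecomposable X).
  by exists X, (mhom_id X), (mhom_id X).
have [U [W [sU [sW [UW [UW0 [Un0 Wn0]]]]]]] : exists U W : {vspace X},
    stable U /\ stable W /\ (U + W)%VS = fullv /\ (U :&: W)%VS = 0%VS /\ U <> 0%VS /\ W <> 0%VS.
  apply: NNPP => nUW; apply: niX; split.
    by have [x fx] := nf; apply: nonzero_mod fx.
  move=> U W sU sW UW UW0; apply: NNPP => /not_or_and[Un0 Wn0]; apply: nUW.
  by exists U, W.
have dim_lt (U' W' : {vspace X}) (sU' : stable U') :
    (U' :&: W')%VS = 0%VS -> W' <> 0%VS -> (\dim {:submod sU'} < n)%N.
  move=> UW' Wn; rewrite -ltnS; apply: leq_trans leX; rewrite ltnS.
  refine (dim_inj_lt (f := submod_in sU') (submod_inj sU') _) => ss; apply: Wn.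
  rewrite -UW'; apply/esym/capv_idPr/subvP => x _.
  by apply/(submod_im sU')/ss.
have WU : (W + U)%VS = fullv by rewrite addvC.
have WU0 : (W :&: U)%VS = 0%VS by rewrite capvC.
have [p [pK pW]] := complement_proj sU sW UW UW0.
have [p' [pK' pU]] := complement_proj sW sU WU WU0.
have step (V : fmod S) (j : mhom V X) (r : mhom X V) : (forall x, r (j x) = x) ->
    (\dim {:V} < n)%N -> nonzero (mhom_comp r f) ->
    exists Z (i : mhom Z X) (p : mhom X Z),
      [/\ forall x, p (i x) = x, indecomposable Z & nonzero (mhom_comp p f)].
  move=> rj dV /IH-/(_ dV)[Z [i [s [si iZ ns]]]].
  by exists Z, (mhom_comp j i), (mhom_comp s r); split=> // x /=; rewrite rj si.
have [pf0|] := zero_or_nonzero (mhom_comp p f); last exact: step (dim_lt _ _ _ UW0 Wn0).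
have [pf0'|] := zero_or_nonzero (mhom_comp p' f); last exact: step (dim_lt _ _ _ WU0 Un0).
have [x /eqP[]] := nf; apply/eqP; rewrite -memv0 -UW0 memv_cap.
have pf : p (f x) = 0 := pf0 x; have pf' : p' (f x) = 0 := pf0' x.
have := pW (f x); have := pU (f x).
by rewrite pf pf' (linear0 (submod_in sU)) (linear0 (submod_in sW)) !subr0 => -> ->.
Qed.

End Fitting.

(** * Recognising indecomposable tilting modules *)

Section Tilting.
Variables (F : fieldType) (S : freeAlgType F) (d : Order.disp_t) (L : finPOrderType d).
Variables (D : L -> fmod S) (H : hw_data D).
Implicit Types M N Q X Y E : fmod S.
Local Notation w := (hw_weights D).

(** Linear dependence of two maps; required of all pairs, it says that the space of homomorphisms
    has dimension at most one. *)
Definition proportional M N (f g : mhom M N) : Prop :=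
  exists c, (forall x, f x = c *: g x) \/ (forall x, g x = c *: f x).

(** Let [V] be the image of [f], [E] a simple quotient of [V], [U] the kernel of [V] -> [E] and [Q]
    the cokernel of [V] -> [X]. Every map from [P l] to [X] is a multiple of the composite of [q l]
    and [f], so neither [U] nor [Q] has weight [l]. Thus [E] is the only composition factor of label
    [l], and all others are smaller. *)
Lemma indec_tiltingP l X : tilting w X -> indecomposable X ->
  (forall m (f : mhom (D m) X), nonzero f -> (m <= l)%O) ->
  (forall f g : mhom (D l) X, proportional f g) ->
  (exists f : mhom (D l) X, nonzero f) -> indec_tilting w l X.
Proof.
move=> tX iX hom_le prop [f nf]; split=> //.
have wX m : weight_of H X m -> (m <= l)%O.
  by move=> /hom_of_weight[k [g [mk /hom_le]]]; apply: le_trans.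
have multiple (g : mhom (hwP H l) X) : exists c, forall x, g x = c *: f (hwq H l x).
  have [|g' g'E] := hom_kernel_zero g; first by move=> m lm /wX; rewrite lt_geF.
  have [c [fg|gf]] := prop g' f; first by exists c => x; rewrite -g'E fg.
  have c0 : c != 0.
    by have [x fx] := nf; apply: contra fx => /eqP c0; rewrite gf c0 scale0r.
  by exists c^-1 => x; rewrite gf scalerA mulVf // scale1r g'E.
have [V [j [injj jV]]] := submod_exists (stable_im f).
have [f' f'E] := factor_inj (f := f) injj (fun x => iffLR (jV _) (ex_intro _ x erefl)).
have sf' : surj f'.
  by move=> y; have [x xE] := iffRL (jV (j y)) (ex_intro _ y erefl); exists x; apply: injj; rewrite f'E.
have nV : ~ zero_mod V.
  have [x fx] := nf; apply: (nonzero_mod (x := f' x)).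
  by apply: contra fx => /eqP f'x; rewrite -f'E f'x linear0.
have [E [r [sE sr]]] := simple_quotient nV.
have sEl : hw_simple D l E.
  split=> //; exists (mhom_comp r f') => z.
  by have [y <-] := sr z; have [x <-] := sf' y; exists x.
have [U [k exU]] := ker_exists sr; have [injk _ kerk] := exU.
have [Q [p exQ]] := coker_exists injj; have [_ sp kerp] := exQ.
have nWU : ~ weight_of H U l.
  move=> [t [x tx]]; have [c cE] := multiple (mhom_comp j (mhom_comp k t)).
  have c0 : c != 0.
    apply: contra tx => /eqP c0; apply/eqP/(inj_eq0 injk)/(inj_eq0 injj).
    by have /= -> := cE x; rewrite c0 scale0r.
  have [nE _] := sE; apply: nE => z; have [v <-] := sr z; have [y yE] := sf' v.
  have [u uE] := q_surj H y; apply/kerk; exists (t (c^-1 *: u)); apply: injj.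
  have /= -> := cE (c^-1 *: u).
  have -> : hwq H l (c^-1 *: u) = c^-1 *: y by rewrite mhomZ uE.
  by rewrite mhomZ scalerA mulfV // scale1r -f'E yE.
have nWQ : ~ weight_of H Q l.
  move=> [t [x tx]]; have [g gE] := hw_lifts t sp; have [c cE] := multiple g.
  case/eqP: tx; rewrite -gE cE -f'E -linearZ; apply/kerp; by eexists.
have [sU FU] := composition_series H U; have [sQ FQ] := composition_series H Q.
have FV : filtration (hw_simple D) V (l :: sU) := FiltCons exU sEl FU.
exists (sQ ++ l :: sU); split; first exact: filt_cat exQ FQ FV.
  have nU : l \notin sU by apply/negP => /(filt_weight H FU).
  have nQ : l \notin sQ by apply/negP => /(filt_weight H FQ).
  by rewrite count_cat /= eqxx (count_memPn nU) (count_memPn nQ).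
apply/allP => m; rewrite mem_cat inE.
case/or3P => [mQ|->//|mU]; rewrite orbC lt_neqAle; have [->//|/= nml] := eqVneq m l.
  by rewrite wX //; apply: weight_quo sp (filt_weight H FQ mQ).
by rewrite wX //; apply: weight_sub injj (weight_sub injk (filt_weight H FU mU)).
Qed.

(* In the application [g] factors through a module of largest weight [l], with *)
(* multiplicity one; the summand lies in the part of [Y] on which [g] is      *)
(* invertible.                                                                *)
Lemma indec_tilting_exists l Y (g : mhom Y Y) (f : mhom (D l) Y) c :
  tilting w Y -> nonzero f -> c != 0 -> (forall x, g (f x) = c *: f x) ->
  (forall m (h : mhom (D m) Y), nonzero (mhom_comp g h) -> (m <= l)%O) ->
  (forall h h' : mhom (D l) Y, proportional (mhom_comp g h) (mhom_comp g h')) ->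
  (exists2 X, indec_tilting w l X & summand X Y)
  /\ exists h : mhom (D l) Y, injective h.
Proof.
move=> [[s Fs] [t Ft]] nf c0 gf hom_le prop.
have [X0 [i0 [p0 [h [pi0 injgi hE]]]]] := fitting c0 gf.
have nh : nonzero h.
  by have [x fx] := nf; exists x; apply: contra fx => /eqP hx; rewrite -hE hx linear0.
have [X [i [p [pi iX nph]]]] := indec_summand nh.
have injgiX : injective (mhom_comp (mhom_comp g i0) i).
  apply: mhom_inj => x /= /(inj_eq0 injgi) ix; by rewrite -(pi x) ix linear0.
have sXY : summand X Y.
  by exists (mhom_comp i0 i), (mhom_comp p p0) => x /=; rewrite pi0 pi.
have [s' Fs'] := std_filt_summand H Fs sXY.
have [t' Ft'] := costd_filt_summand H Ft sXY.
have leX m (h' : mhom (D m) X) : nonzero h' -> (m <= l)%O.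
  move=> [x hx]; apply: (hom_le _ (mhom_comp i0 (mhom_comp i h'))); exists x.
  by apply: contra hx => /eqP/(inj_eq0 injgiX)->.
have propX (f1 f2 : mhom (D l) X) : proportional f1 f2.
  have [a [E|E]] := prop (mhom_comp i0 (mhom_comp i f1)) (mhom_comp i0 (mhom_comp i f2));
    exists a; [left|right] => x; apply: injgiX; have /= -> := E x;
    by rewrite !linearZ.
have iT : indec_tilting w l X.
  apply: indec_tiltingP => //; first by split; [exists s' | exists t'].
  by exists (mhom_comp p h).
split; first by exists X.
have [|C [r [s'' [[inj _ _] _ _]]]] := std_filt_split H Fs' _ nph.
  move=> m /(std_label_weight H Fs')/hom_of_weight[k [f' [mk /leX kl]]] lm.
  by apply: le_anti; rewrite lm (le_trans mk).
by exists (mhom_comp i0 (mhom_comp i (mhom_comp p h))) => x y /= e; apply: inj; apply: injgiX => /=; rewrite e.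
Qed.

(* Standard modules embed in [Y] and maps to [Y] extend along standard         *)
(* filtrations, so [Y] cogenerates the regular module.                        *)
Lemma tilting_faithful Y t : filtration (wcostd w) Y t ->
  (forall l, exists h : mhom (D l) Y, injective h) ->
  forall a : S, (forall y : Y, act a y = 0) -> a = 0.
Proof.
move=> FY emb.
have cogen M s : filtration (wstd w) M s ->
    forall x : M, x != 0 -> exists h : mhom M Y, h x != 0.
  elim=> {M s} [M M0 x|M N Q l s i p ex isoQ _ IH x x0]; first by rewrite (M0 x) eqxx.
  have [inji sp ker] := ex.
  have [px|px] := eqVneq (p x) 0; last first.
    have [e inje] := emb l; have [u [inju _]] := iso_inj_surj isoQ.
    exists (mhom_comp e (mhom_comp u p)).
    by apply: contra px => /eqP/(inj_eq0 inje)/(inj_eq0 inju)->.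
  have [y yE] := iffLR (ker x) px.
  have [|h hy] := IH y; first by apply: contra x0 => /eqP y0; rewrite -yE y0 linear0.
  have [h' h'E] := ext0_iso (iso_sym isoQ) (costd_filt_ext_std H FY) ex h.
  by exists h'; rewrite -yE h'E.
move=> a aY; have [s Fs] := hw_regular H; apply/eqP; case: eqP => // /eqP a0.
have [h /eqP[]] := cogen _ _ Fs (a : regular S) a0.
by have /= := mhom_act h a (1 : regular S); rewrite mulr1 aY => ->.
Qed.

End Tilting.

(** * Base change and modular systems *)

Section BaseChangeMaps.
Variables (R F : comNzRingType) (phi : {rmorphism R -> F}).
Local Notation bc := (bc phi).
Local Notation bcin := (bcin phi).
Implicit Types U V W : vectType R.

Lemma bcinZ V c (x : V) : bcin (c *: x) = phi c *: bcin x.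
Proof. by have := bcinP phi c x 0; rewrite !addr0 bcin0 addr0. Qed.

Lemma bcinD V (x y : V) : bcin (x + y) = bcin x + bcin y.
Proof. by have := bcinP phi 1 x y; rewrite rmorph1 !scale1r. Qed.

Lemma bcin_sum V n (x : 'I_n -> V) : bcin (\sum_i x i) = \sum_i bcin (x i).
Proof. by apply: (big_morph _ (@bcinD V)); apply: bcin0. Qed.

Definition bclin V W (f : V -> W) (u : bc V) : bc W :=
  \sum_i u 0 i *: bcin (f (bbasis i)).

Lemma bclin_linear V W (f : V -> W) : linear (bclin f).
Proof.
move=> c u v; rewrite /bclin scaler_sumr -big_split; apply: eq_bigr => i _ /=.
by rewrite !mxE scalerDl scalerA.
Qed.

Lemma bclin_in V W (f : V -> W) x : linear f -> bclin f (bcin x) = bcin (f x).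
Proof.
move=> lf; rewrite [x in RHS]bbasis_sum (lin_sum _ _ lf) bcin_sum.
by apply: eq_bigr => i _; rewrite bcinZ !mxE.
Qed.

Definition lin_of_basis V W (w : 'I_(dim V) -> W) (x : V) : W :=
  \sum_i v2r x 0 i *: w i.

Lemma lin_of_basis_linear V W (w : 'I_(dim V) -> W) : linear (lin_of_basis w).
Proof.
move=> c x y; rewrite /lin_of_basis scaler_sumr -big_split; apply: eq_bigr => i _ /=.
by rewrite linearP !mxE scalerDl scalerA.
Qed.

Lemma lin_of_basisE V W (w : 'I_(dim V) -> W) i : lin_of_basis w (bbasis i) = w i.
Proof.
rewrite /lin_of_basis /bbasis r2vK (bigD1 i) //= big1 ?addr0 => [|j ji].
  by rewrite mxE !eqxx scale1r.
by rewrite mxE eqxx (negPf ji) scale0r.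
Qed.

Variable A : freeAlgType R.
Implicit Types M N Q P : fmod A.

Lemma bc_act_in M (a : A) (x : M) :
  act (bcin a : Defs.bc phi A) (bcin x : bc_mod phi M) = bcin (act a x).
Proof. exact: (bcbil_in phi (@act_linl R A M) (@act_linr R A M)). Qed.

Lemma bc_equivariant M N (f : bc_mod phi M -> bc_mod phi N) : linear f ->
  (forall a x, f (bcin (act a x)) = act (bcin a : Defs.bc phi A) (f (bcin x))) ->
  forall a x, f (act a x) = act a (f x).
Proof.
move=> lf fin a x; move: a; apply: bc_ext => [c u v|c u v|a].
- by rewrite act_linl lf.
- by rewrite act_linl.
move: x; apply: bc_ext => [c u v|c u v|x].
- by rewrite act_linr lf.
- by rewrite lf act_linr.
by rewrite bc_act_in.
Qed.

Definition bchom M N (f : mhom M N) : mhom (bc_mod phi M) (bc_mod phi N).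
Proof.
refine (@mkhom _ _ (bc_mod phi M) (bc_mod phi N) (bclin f) (@bclin_linear _ _ f) _).
apply: (bc_equivariant (M := M) (N := N) (@bclin_linear _ _ f)) => a x.
have lf : linear f by move=> c u v; rewrite linearP.
by rewrite !bclin_in // mhom_act bc_act_in.
Defined.

Lemma bchom_in M N (f : mhom M N) x : bchom f (bcin x) = bcin (f x).
Proof. by rewrite /= bclin_in // => c u v; rewrite linearP. Qed.

Lemma bchom_ext M (W : lmodType F) (f g : {linear bc_mod phi M -> W}) :
  (forall x, f (bcin x) = g (bcin x)) -> f =1 g.
Proof.
by move=> fg; apply: (bc_ext (phi := phi) (V := M)) => // [c u v|c u v];
  rewrite linearP.
Qed.

Lemma bc_iso M N : iso M N -> iso (bc_mod phi M) (bc_mod phi N).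
Proof.
move=> isoM; have [f [injf sf]] := iso_inj_surj isoM.
have [g [fK gK]] := bij_inverse injf sf.
have bcK M1 M2 (f1 : mhom M1 M2) (f2 : mhom M2 M1) : cancel f1 f2 -> cancel (bchom f1) (bchom f2).
  move=> K; apply: (@bchom_ext M1 _ (mhom_comp (bchom f2) (bchom f1)) (mhom_id _)) => x.
  by rewrite -[LHS]/(bchom f2 (bchom f1 (bcin x))) !bchom_in K.
by exists (bchom f), (bchom g); apply: bcK.
Qed.

(** The quotient is free over the base ring, so the sequence splits linearly; the section [s] and
    retraction [r] survive base change. *)
Lemma bc_short_exact N M Q (i : mhom N M) (p : mhom M Q) :
  short_exact i p -> short_exact (bchom i) (bchom p).
Proof.
move=> [inji sp ker].
have [s [ls ps]] : exists s : Q -> M, linear s /\ forall y, p (s y) = y.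
  pose w i := proj1_sig (constructive_indefinite_description _ (sp (bbasis i))).
  have pw j : p (w j) = bbasis j by rewrite /w; case: constructive_indefinite_description.
  exists (lin_of_basis w); split; first exact: lin_of_basis_linear.
  apply: (basis_ext (g := id)) => // [c x y|j]; last by rewrite lin_of_basisE pw.
  by rewrite lin_of_basis_linear linearP.
have [r [lr rE]] : exists r : M -> N, linear r /\ forall y, i (r y) = y - s (p y).
  have tot y : exists x, i x = y - s (p y) by apply/ker; rewrite linearB ps subrr.
  pose r y := proj1_sig (constructive_indefinite_description _ (tot y)).
  have rE y : i (r y) = y - s (p y) by rewrite /r; case: constructive_indefinite_description.
  exists r; split=> // c x y; apply: inji.
  by rewrite linearP !rE linearP ls scalerBr opprD addrACA.
have dec u : u = bchom i (bclin r u) + bclin s (bchom p u).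
  move: u; apply: (bc_ext (phi := phi) (V := M)) => [c u v|c u v|x] //.
    rewrite !(bclin_linear r, linearP) /= (bclin_linear s) scalerDr.
    by rewrite addrACA.
  rewrite bclin_in // !bchom_in bclin_in // rE -bcinD subrK //.
have pi0 u : bchom p (bchom i u) = 0.
  move: u; apply: (bc_ext (phi := phi) (V := N)) => [c u v|c u v|x].
  - by rewrite !linearP.
  - by rewrite scaler0 addr0.
  by rewrite !bchom_in (iffRL (ker (i x))) ?bcin0 //; exists x.
split.
- apply: (can_inj (g := bclin r)).
  apply: (bc_ext (phi := phi) (V := N)) => [c u v|//|x].
    by rewrite linearP bclin_linear.
  rewrite bchom_in bclin_in //; congr bcin; apply: inji.
  by rewrite rE (iffRL (ker (i x))) ?(lin0 ls) ?subr0 //; exists x.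
- move=> u; exists (bclin s u); move: u.
  apply: (bc_ext (phi := phi) (V := Q)) => [c u v|//|x].
    by rewrite (bclin_linear s) linearP.
  by rewrite bclin_in // bchom_in ps.
- move=> u; split=> [pu|[x <-]]; last exact: pi0.
  by exists (bclin r u); rewrite [RHS]dec pu (lin0 (bclin_linear s)) addr0.
Qed.

Lemma bc_zero_mod M : zero_mod M -> zero_mod (bc_mod phi M).
Proof.
move=> M0; apply: (bc_ext (phi := phi) (V := M)) => [//|c u v|x]; first by rewrite scaler0 addr0.
by rewrite (M0 x) bcin0.
Qed.

Lemma bc_filtration (L : Type) (C : L -> fmod A -> Prop)
    (C' : L -> fmod (Defs.bc phi A) -> Prop) M s :
  (forall l Q, C l Q -> C' l (bc_mod phi Q)) ->
  filtration C M s -> filtration C' (bc_mod phi M) s.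
Proof.
move=> CC'; elim=> {M s} [M /bc_zero_mod|M N Q l s i p ex CQ _ IH]; first exact: FiltNil.
exact: FiltCons (bc_short_exact ex) (CC' _ _ CQ) IH.
Qed.

End BaseChangeMaps.
Arguments bclin {R F} phi {V W} f u.

(** * Projective modules through dual bases *)

Section DualBasis.

(** The data of the dual basis lemma. They base-change entry by entry, and the elements [e i (x j)]
    form the idempotent matrix that cuts [P] out of a free module. *)
Definition is_dual_basis (R : comNzRingType) (A : freeAlgType R) (P : fmod A) n
    (x : 'I_n -> P) (e : 'I_n -> P -> A) : Prop :=
  [/\ forall j, linear (e j), forall j a y, e j (act a y) = a * e j y
    & forall y, y = \sum_j act (e j y) (x j)].

Lemma projective_dual_basis (R : comNzRingType) (A : freeAlgType R) (P : fmod A) :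
  projective P -> exists n (x : 'I_n -> P) e, is_dual_basis x e.
Proof.
move=> [n [X [[i [p [pi pi0 ip]]] [j [r rj]]]]].
exists n, (fun k => r (i k (1 : A))), (fun k y => p k (j y)); split.
- by move=> k c y z; rewrite !linearP.
- by move=> k a y; rewrite !mhom_act.
move=> y; rewrite -[LHS]rj [j y in LHS]ip linear_sum; apply: eq_bigr => k _.
by rewrite -!mhom_act /= mulr1.
Qed.

Variables (R F : comNzRingType) (phi : {rmorphism R -> F}) (A : freeAlgType R).

Lemma bc_dual_basis (P : fmod A) n (x : 'I_n -> P) e : is_dual_basis x e ->
  is_dual_basis (P := bc_mod phi P) (fun j => bcin phi (x j)) (fun j => bclin phi (e j)).
Proof.
move=> [le ae xe]; split.
- by move=> j; apply: bclin_linear.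
- move=> j a y; move: a; apply: (bc_ext (phi := phi)) => [c u v|c u v|a].
  + by rewrite act_linl bclin_linear.
  + by rewrite mulrDl scalerAl.
  move: y; apply: (bc_ext (phi := phi)) => [c u v|c u v|y].
  + by rewrite act_linr bclin_linear.
  + by rewrite bclin_linear mulrDr scalerAr.
  by rewrite bc_act_in !bclin_in // ae -bcmul_in.
- apply: (bc_ext (phi := phi) (V := P)) => [//|c u v|y].
    rewrite scaler_sumr -big_split; apply: eq_bigr => j _ /=.
    by rewrite bclin_linear; apply: (@act_linl _ _ (bc_mod phi P)).
  rewrite [y in LHS]xe bcin_sum; apply: eq_bigr => j _.
  by rewrite bclin_in // bc_act_in.
Qed.

Lemma dual_basis_hom (P M : fmod A) n (x : 'I_n -> P) e (m : 'I_n -> M) :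
  is_dual_basis x e -> exists f : mhom P M, forall y, f y = \sum_j act (e j y) (m j).
Proof.
move=> [le ae xe].
have lf : linear (fun y => \sum_j act (e j y) (m j)).
  move=> c y z; rewrite scaler_sumr -big_split; apply: eq_bigr => j _ /=.
  by rewrite le act_linl.
have af a y : \sum_j act (e j (act a y)) (m j) = act a (\sum_j act (e j y) (m j)).
  by rewrite act_sumr; apply: eq_bigr => j _; rewrite ae actM.
by exists (mkhom lf af).
Qed.

Lemma dual_basis_homE (P M : fmod A) n (x : 'I_n -> P) e (f : mhom P M) y :
  is_dual_basis x e -> f y = \sum_j act (e j y) (f (x j)).
Proof.
by move=> [_ _ xe]; rewrite {1}[y]xe linear_sum; apply: eq_bigr => j _; rewrite mhom_act.
Qed.

End DualBasis.

Lemma dual_basis_lifts (F : fieldType) (A : freeAlgType F) (P : fmod A) n (x : 'I_n -> P) e :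
  is_dual_basis x e -> lifts P.
Proof.
move=> xe X Y p f sp.
pose m j := proj1_sig (constructive_indefinite_description _ (sp (f (x j)))).
have pm j : p (m j) = f (x j) by rewrite /m; case: constructive_indefinite_description.
have [g gE] := dual_basis_hom m xe.
exists g => y; rewrite gE linear_sum (dual_basis_homE f y xe).
by apply: eq_bigr => j _; rewrite mhom_act pm.
Qed.

(** * Divisibility in the valuation ring; lattices and denominators *)

Section ModularSystem.
Variables (l : nat) (O : idomainType) (K k : fieldType).
Variables (iK : {rmorphism O -> K}) (ik : {rmorphism O -> k}).
Hypothesis hO : modular_system l iK ik.

(** An element of least value divides the others. [I] is an arbitrary nonempty set because the lemma
    is applied to sets of coordinates of vectors. *)
Lemma min_divisor (I : O -> Prop) : (exists x, I x) ->
  exists2 g, I g & forall x, I x -> exists c, x = c * g.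
Proof.
move=> [x0 Ix0]; have [[injK _] [v [vM _ _ vO]] _ _ _] := hO.
have [[x1 [Ix1 x1n]]|nI] := classic (exists x, I x /\ x != 0); last first.
  exists x0 => // x Ix; exists 0; rewrite mul0r; apply/eqP; case: eqP => // /eqP xn.
  by case: nI; exists x.
have iK0 x : x != 0 -> iK x != 0.
  by apply: contra => /eqP e; apply/eqP/injK; rewrite e rmorph0.
have vge x : x != 0 -> 0 <= v (iK x) by move=> xn; apply/vO; [exact: iK0 | exists x].
suff low n x : I x -> x != 0 -> (`|v (iK x)| < n)%N ->
    exists g, [/\ I g, g != 0 & forall y, I y -> y != 0 -> v (iK g) <= v (iK y)].
  have [g [Ig gn gmin]] := low _ x1 Ix1 x1n (ltnSn _).
  exists g => // x Ix; have [->|xn] := eqVneq x 0; first by exists 0; rewrite mul0r.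
  have qn : iK x / iK g != 0 by rewrite mulf_neq0 ?invr_eq0 ?iK0.
  have : 0 <= v (iK x / iK g).
    have := vM _ _ qn (iK0 g gn); rewrite divfK ?iK0 // => vE.
    by have := gmin x Ix xn; rewrite vE -{1}[v (iK g)]add0r lerD2r.
  move/(vO _ qn) => [c cE]; exists c; apply: injK.
  by rewrite rmorphM cE divfK ?iK0.
elim: n x => // n IH x Ix xn lev.
have [[y [Iy yn lty]]|ny] := classic (exists y, [/\ I y, y != 0 & v (iK y) < v (iK x)]).
  apply: (IH y) => //; rewrite -ltnS; apply: leq_trans lev; rewrite ltnS.
  by rewrite -ltz_nat !gez0_abs ?vge.
exists x; split=> // y Iy yn; rewrite leNgt; apply/negP => lt; apply: ny.
by exists y.
Qed.

Lemma divides_total (a b : O) : (exists c, a = c * b) \/ (exists c, b = c * a).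
Proof.
have [|g [->|->] gE] := @min_divisor (fun x => x = a \/ x = b); first by exists a; left.
  by right; apply: gE; right.
by left; apply: gE; left.
Qed.

(** A common divisor of the non-units that is itself a non-unit. It is nonzero because an element of
    value 1 is a nonzero non-unit of [O]. *)
Lemma uniformizer : exists2 pi : O, pi != 0 & forall a, ik a = 0 <-> exists c, a = pi * c.
Proof.
have [[injK fracK] [v [vM _ vS vO]] [_ kerk] _ _] := hO.
have [|g gn gE] := @min_divisor (fun x => x \isn't a GRing.unit).
  by exists 0; rewrite unitr0.
exists g.
  apply/eqP => g0; have [x xn vx] := vS 1.
  have : 0 <= v x by rewrite vx.
  move/(vO _ xn) => [a aE].
  have an : a \isn't a GRing.unit.
    apply/negP => ua; have v1 : v 1 = 0.
      have := vM 1 1 (oner_neq0 _) (oner_neq0 _).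
      by rewrite mulr1 -[X in X = _]addr0 => /addrI.
    have an : iK a^-1 != 0.
      apply/eqP => e; have := congr1 (fun z => z * iK a) e.
      by rewrite -rmorphM mulVr // rmorph1 mul0r => /eqP; rewrite oner_eq0.
    have : 0 <= v (iK a^-1) by apply/vO => //; exists a^-1.
    have := vM _ _ an xn; rewrite -aE -rmorphM mulVr // rmorph1 v1 aE vx.
    by move=> e; rewrite -(addrK 1 (v _)) -e.
  have [c] := gE a an; rewrite g0 mulr0 => a0.
  by rewrite -aE a0 rmorph0 eqxx in xn.
move=> a; rewrite kerk; split=> [/gE[c ->]|[c ->]]; first by exists c; rewrite mulrC.
by rewrite unitrM negb_and gn.
Qed.

Lemma frac_scale (x : K) : exists2 c : O, c != 0 & exists a, iK c * x = iK a.
Proof.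
have [[injK fracK] _ _ _ _] := hO; have [a [b [bn ->]]] := fracK x.
have ibn : iK b != 0 by apply: contra bn => /eqP e; apply/eqP/injK; rewrite e rmorph0.
by exists b => //; exists a; rewrite mulrCA mulfV ?mulr1.
Qed.

Lemma iK_eq0 c : (iK c == 0) = (c == 0).
Proof.
have [[injK _] _ _ _ _] := hO.
by apply/eqP/eqP => [e|->]; [apply: injK; rewrite e rmorph0 | rewrite rmorph0].
Qed.

Lemma frac_total (x : K) : (exists c, x = iK c) \/ (exists c, 1 = iK c * x).
Proof.
have [c cn [a xE]] := frac_scale x; have icn : iK c != 0 by rewrite iK_eq0.
have [[e aE]|[e cE]] := divides_total a c.
  by left; exists e; apply: (mulfI icn); rewrite xE aE rmorphM mulrC.
right; exists e; apply: (mulfI icn); rewrite mulr1 mulrCA xE.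
by rewrite {1}cE rmorphM.
Qed.

Section Lattices.
Implicit Types U V W : vectType O.

Lemma bcinK_inj V : injective (@bcin O K iK V).
Proof.
have [[injK _] _ _ _ _] := hO; move=> x y e; apply: (can_inj (@v2rK _ _)).
by apply/matrixP => i j; apply: injK; move/matrixP/(_ i j): e; rewrite !mxE.
Qed.

Lemma scaleO_inj V (c : O) (x y : V) : c != 0 -> c *: x = c *: y -> x = y.
Proof.
move=> cn /(congr1 (@bcin _ _ iK V)); rewrite !bcinZ => e.
by apply: bcinK_inj; apply: scalerI e; rewrite iK_eq0.
Qed.

Lemma bcink_surj V (u : bc ik V) : exists x : V, bcin ik x = u.
Proof.
have [_ _ [sk _] _ _] := hO.
pose a i := proj1_sig (constructive_indefinite_description _ (sk (u 0 i))).
have aE i : ik (a i) = u 0 i by rewrite /a; case: constructive_indefinite_description.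
exists (r2v (\row_i a i)); apply/matrixP => i j.
by rewrite /bcin r2vK !mxE aE (ord1 i).
Qed.

Lemma bcink_eq0 pi V (x : V) : (forall a, ik a = 0 <-> exists c, a = pi * c) ->
  bcin ik x = 0 <-> exists y, x = pi *: y.
Proof.
move=> piE; split=> [x0|[y ->]]; last first.
  by rewrite bcinZ (iffRL (piE pi)) ?scale0r //; exists 1; rewrite mulr1.
have div i : exists c, v2r x 0 i = pi * c.
  by apply/piE; move/matrixP/(_ 0 i): x0; rewrite !mxE.
pose c i := proj1_sig (constructive_indefinite_description _ (div i)).
have cE i : v2r x 0 i = pi * c i by rewrite /c; case: constructive_indefinite_description.
exists (r2v (\row_i c i)); rewrite -[x]v2rK -linearZ; congr r2v; apply/rowP => i.
by rewrite cE !mxE.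
Qed.

Lemma common_denominator V n (u : 'I_n -> bc iK V) : exists2 c : O, c != 0 &
  forall i, exists x, iK c *: u i = bcin iK x.
Proof.
have single (w : bc iK V) : exists2 c : O, c != 0 & exists x, iK c *: w = bcin iK x.
  have dens m (a : 'I_m -> K) : exists2 c : O, c != 0 & forall i, exists b, iK c * a i = iK b.
    elim: m a => [|m IH] a; first by exists 1; [exact: oner_neq0 | case].
    have [c cn cE] := IH (fun i => a (lift ord0 i)).
    have [e en [b bE]] := frac_scale (a ord0).
    exists (c * e); first by rewrite mulf_neq0.
    move=> i; case: (unliftP ord0 i) => [j|] ->.
      have [b' b'E] := cE j; exists (e * b').
      by rewrite !rmorphM -b'E; rewrite mulrAC mulrC.
    by exists (c * b); rewrite !rmorphM -bE mulrA.
  have [c cn cE] := dens _ (fun i => w 0 i); exists c => //.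
  pose b i := proj1_sig (constructive_indefinite_description _ (cE i)).
  have bE i : iK c * w 0 i = iK (b i) by rewrite /b; case: constructive_indefinite_description.
  exists (r2v (\row_i b i)); apply/matrixP => i j.
  by rewrite /bcin r2vK !mxE (ord1 i) bE.
elim: n u => [|n IH] u; first by exists 1; [exact: oner_neq0 | case].
have [c cn cE] := IH (fun i => u (lift ord0 i)); have [e en [x xE]] := single (u ord0).
exists (c * e); first by rewrite mulf_neq0.
move=> i; case: (unliftP ord0 i) => [j|] ->.
  have [y yE] := cE j; exists (e *: y).
  by rewrite bcinZ -yE scalerA -rmorphM mulrC.
by exists (c *: x); rewrite bcinZ -xE scalerA rmorphM.
Qed.

Lemma linK_scale V W (f : bc iK V -> bc iK W) : linear f ->
  exists2 c : O, c != 0 & exists2 g : V -> W, linear g &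
    forall x, iK c *: f (bcin iK x) = bcin iK (g x).
Proof.
move=> lf; have [c cn cE] := common_denominator (fun i => f (bcin iK (bbasis i))).
pose w i := proj1_sig (constructive_indefinite_description _ (cE i)).
have wE i : iK c *: f (bcin iK (bbasis i)) = bcin iK (w i).
  by rewrite /w; case: constructive_indefinite_description.
exists c => //; exists (lin_of_basis w); first exact: lin_of_basis_linear.
move=> x; rewrite {1}[x]bbasis_sum bcin_sum; set s := \sum_i _.
have -> : s = \sum_i iK (v2r x 0 i) *: bcin iK (bbasis i).
  by apply: eq_bigr => i _; rewrite bcinZ.
rewrite (lin_sum _ _ lf) scaler_sumr /lin_of_basis bcin_sum; apply: eq_bigr => i _.
by rewrite bcinZ -wE !scalerA mulrC.
Qed.

Lemma link_lift V W (f : bc ik V -> bc ik W) : linear f ->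
  exists2 g : V -> W, linear g & forall x, f (bcin ik x) = bcin ik (g x).
Proof.
move=> lf.
pose w i := proj1_sig (constructive_indefinite_description _ (bcink_surj (f (bcin ik (bbasis i))))).
have wE i : bcin ik (w i) = f (bcin ik (bbasis i)).
  by rewrite /w; case: constructive_indefinite_description.
exists (lin_of_basis w); first exact: lin_of_basis_linear.
move=> x; rewrite {1}[x]bbasis_sum bcin_sum; set s := \sum_i _.
have -> : s = \sum_i ik (v2r x 0 i) *: bcin ik (bbasis i).
  by apply: eq_bigr => i _; rewrite bcinZ.
rewrite (lin_sum _ _ lf) /lin_of_basis bcin_sum; apply: eq_bigr => i _.
by rewrite bcinZ -wE.
Qed.

End Lattices.

(** After denominators are cleared the map is integral; it is still equivariant because the lattice
    [N] embeds in KN. *)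
Lemma homK_scale (A : freeAlgType O) (M N : fmod A) (f : mhom (bc_mod iK M) (bc_mod iK N)) :
  exists2 c : O, c != 0 & exists g : mhom M N,
    forall x : M, iK c *: f (bcin iK x) = bcin iK (g x).
Proof.
have lf : linear f by move=> c u v; rewrite linearP.
have [c cn [g lg gE]] := linK_scale (V := M) (W := N) lf; exists c => //.
suff eg a x : g (act a x) = act a (g x) by exists (mkhom lg eg).
apply: bcinK_inj; rewrite -gE -!bc_act_in mhom_act -gE.
exact: (esym (@actZr _ _ (bc_mod iK N) _ _ _)).
Qed.

End ModularSystem.

(** * Lifting homomorphisms *)

Section Derivations.
Variables (R : comNzRingType) (S : freeAlgType R) (M N : fmod S).

(** These are the 1-cocycles of [S] with values in Hom(M, N); their classes modulo [inner] ones form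
    Ext^1(M, N). *)
Definition derivation (D : S -> M -> N) : Prop :=
  [/\ forall x, linear (D^~ x), forall a, linear (D a)
    & forall a b x, D (a * b) x = act a (D b x) + D a (act b x)].

Definition inner (D : S -> M -> N) : Prop :=
  exists2 f : M -> N, linear f & forall a x, D a x = act a (f x) - f (act a x).

End Derivations.

Section ExtensionModule.
Variables (F : fieldType) (S : freeAlgType F) (M N : fmod S) (D : S -> M -> N).
Hypothesis derD : derivation D.

Let eact (a : S) (p : N * M) : N * M := (act a p.1 + D a p.2, act a p.2).

Definition ext_mod : fmod S.
Proof.
exists ((N * M)%type : vectType F) eact => [p c a b|a c p p'|[n m]|a b [n m]];
  have [Dl Dr DM] := derD; rewrite /eact /=.
- rewrite !act_linl Dl; congr (_, _) => /=.
  by rewrite scalerDr addrACA.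
- rewrite !act_linr Dr; congr (_, _) => /=.
  by rewrite scalerDr addrACA.
- have D1 : D 1 m = 0.
    by have := DM 1 1 m; rewrite mulr1 !act1 -[X in X = _ -> _]addr0 => /addrI.
  by rewrite !act1 D1 addr0.
- by rewrite !actM DM actDr addrA.
Defined.

(** The cocycle twists the action on N x M into an extension. Its retraction onto [N], restricted to
    the second factor, is the map that makes [D] inner. *)
Lemma ext0_inner : ext0 M N -> inner D.
Proof.
move=> e; have [Dl Dr _] := derD.
have li : linear (fun n : N => (n, 0) : ext_mod).
  by move=> c n n'; congr (_, _); rewrite /= scaler0 addr0.
have ei a (n : N) : ((act a n, 0) : ext_mod) = act a ((n, 0) : ext_mod).
  by congr (_, _); rewrite /= ?act0r // (lin0 (Dr a)) addr0.
have lp : linear (fun p : ext_mod => (p : N * M).2 : M) by [].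
have ep a (p : ext_mod) : (act a p : N * M).2 = act a (p : N * M).2 by [].
have ex : short_exact (mkhom li ei) (mkhom lp ep).
  split=> [n n' [] //|m|[n m]] /=; first by exists ((0, m) : ext_mod).
  by split=> [->|[x [_ <-]] //]; exists n.
have [h hE] := e _ _ _ _ ex (mhom_id N).
exists (fun m => h ((0, m) : ext_mod)) => [c m m'|a m].
  rewrite -linearP; congr (hfun h _); congr (_, _).
  by rewrite /= scaler0 addr0.
rewrite -mhom_act -linearB -[LHS](hE (D a m)); congr (hfun h _); congr (_, _) => /=.
  by rewrite act0r add0r subr0.
by rewrite subrr.
Qed.

End ExtensionModule.

(** * Nakayama's lemma and the lifting of homomorphisms *)

Section Lifting.
Variables (l : nat) (O : idomainType) (K k : fieldType).
Variables (iK : {rmorphism O -> K}) (ik : {rmorphism O -> k}).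
Hypothesis hO : modular_system l iK ik.

Definition lin_closed (V : lmodType O) (U : V -> Prop) : Prop :=
  U 0 /\ forall c x y, U x -> U y -> U (c *: x + y).

Lemma lin_closed_sum (V : lmodType O) (U : V -> Prop) n (c : 'I_n -> O) (x : 'I_n -> V) :
  lin_closed U -> (forall i, U (x i)) -> U (\sum_i c i *: x i).
Proof.
by move=> [U0 UP] Ux; apply: big_rec => // i y _ Uy; apply: UP.
Qed.

(** Induction on the number [m] of coordinates that may be nonzero: one generator has the last of
    them dividing all others, and the rest of the submodule has that coordinate zero. *)
Lemma finitely_generated (V : vectType O) (U : V -> Prop) : lin_closed U ->
  exists n (g : 'I_n -> V), (forall i, U (g i)) /\
    forall x, U x -> exists c : 'I_n -> O, x = \sum_i c i *: g i.
Proof.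
suff gen m (W : V -> Prop) : lin_closed W ->
    (forall x, W x -> forall i : 'I_(dim V), (m <= i)%N -> v2r x 0 i = 0) ->
    exists n (g : 'I_n -> V), (forall i, W (g i)) /\
      forall x, W x -> exists c : 'I_n -> O, x = \sum_i c i *: g i.
  by move=> UP; apply: (gen (dim V)) => // x _ i; rewrite leqNgt ltn_ord.
elim: m W => [|m IH] W [W0 WP] Wm.
  exists 0%N, (fun=> 0); split=> [//|x Wx]; exists (fun=> 0); rewrite big_ord0.
  by apply: (can_inj (@v2rK _ _)); rewrite linear0; apply/rowP => i; rewrite mxE Wm.
have [mV|Vm] := ltnP m (dim V); last first.
  by apply: IH => // x Wx i mi; case: (leqP (dim V) i) => [|]; [rewrite leqNgt ltn_ord | rewrite ltnNge (leq_trans Vm mi)].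
pose i0 := Ordinal mV.
have [|_ [g0 Wg0 <-] g0min] := min_divisor hO (I := fun a => exists2 x, W x & v2r x 0 i0 = a).
  by exists 0, 0 => //; rewrite linear0 mxE.
have [||n [g [Wg gE]]] := IH (fun x => W x /\ v2r x 0 i0 = 0).
- split=> [|c x y [Wx x0] [Wy y0]]; first by rewrite linear0 mxE.
  by split; [apply: WP | rewrite linearP !mxE x0 y0 mulr0 addr0].
- move=> x [Wx x0] i; rewrite leq_eqVlt => /orP[/eqP mi|/Wm]; last exact.
  by rewrite -x0; congr (v2r x 0 _); apply: val_inj.
exists n.+1, (fun i => oapp g g0 (unlift ord0 i)); split=> [i|x Wx].
  by case: (unliftP ord0 i) => [j|] _ //=; case: (Wg j).
have [c cE] := g0min _ (ex_intro2 _ _ x Wx erefl).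
have [|b bE] := gE (x - c *: g0).
  split; first by rewrite addrC -scaleNr; apply: WP.
  by rewrite linearB linearZ !mxE cE subrr.
exists (fun i => oapp b c (unlift ord0 i)).
rewrite big_ord_recl unlift_none /= -[LHS](subrK (c *: g0)) bE addrC.
by congr (_ + _); apply: eq_bigr => i _; rewrite liftK.
Qed.

(** The determinant trick: on generators of [U] the hypothesis reads C g in W, where C is the
    identity modulo the maximal ideal and so has unit determinant. *)
Lemma nakayama (V : vectType O) (U W : V -> Prop) pi : ik pi = 0 ->
  lin_closed U -> lin_closed W ->
  (forall x, U x -> exists v y, [/\ W v, U y & x = v + pi *: y]) ->
  forall x, U x -> W x.
Proof.
move=> pi0 cU cW UW x Ux; have [n [g [Ug gE]]] := finitely_generated cU.
have [_ _ [_ kerk] _ _] := hO.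
have ex i : exists p : V * ('I_n -> O), W p.1 /\ g i = p.1 + pi *: \sum_j p.2 j *: g j.
  have [v [y [Wv /gE[c ->] ->]]] := UW _ (Ug i); by exists (v, c).
pose p i := proj1_sig (constructive_indefinite_description _ (ex i)).
have pE i : W (p i).1 /\ g i = (p i).1 + pi *: \sum_j (p i).2 j *: g j.
  by rewrite /p; case: constructive_indefinite_description.
pose C : 'M[O]_n := 1%:M - \matrix_(i, j) (pi * (p i).2 j).
have uC : C \in unitmx.
  rewrite unitmxE; apply: contraT => /kerk; rewrite -det_map_mx map_mxB map_mx1.
  rewrite (_ : map_mx ik _ = 0) ?subr0 ?det1 => [/eqP|]; first by rewrite oner_eq0.
  by apply/matrixP => i j; rewrite !mxE rmorphM pi0 mul0r.
have Cg i : \sum_j C i j *: g j = (p i).1.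
  have -> : \sum_j C i j *: g j = g i - pi *: \sum_j (p i).2 j *: g j.
    rewrite scaler_sumr -sumrN [g i in RHS](_ : _ = \sum_j (1%:M : 'M[O]_n) i j *: g j).
      rewrite -big_split; apply: eq_bigr => j _ /=.
      by rewrite !mxE scalerBl scalerA.
    rewrite (bigD1 i) //= big1 ?addr0 ?mxE ?eqxx ?scale1r // => j ji.
    by rewrite mxE eq_sym (negPf ji) scale0r.
  by have [_ {1}->] := pE i; rewrite addrK.
have Wg i : W (g i).
  have -> : g i = \sum_j invmx C i j *: (p j).1.
    under eq_bigr => j _ do rewrite -Cg scaler_sumr.
    rewrite exchange_big /= (bigD1 i) //= [X in _ + X]big1 ?addr0 => [|j ji].
      transitivity ((invmx C *m C) i i *: g i); first by rewrite mulVmx // mxE eqxx scale1r.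
      by rewrite mxE scaler_suml; apply: eq_bigr => j _; rewrite scalerA.
    transitivity ((invmx C *m C) i j *: g j); last by rewrite mulVmx // mxE eq_sym (negPf ji) scale0r.
    by rewrite mxE scaler_suml; apply: eq_bigr => j' _; rewrite scalerA.
  by apply: lin_closed_sum => // j; case: (pE j).
by have [c ->] := gE x Ux; apply: lin_closed_sum.
Qed.

Lemma lfun_of_bilinear (U V W : vectType O) (b : U -> V -> W) :
  (forall y, linear (b^~ y)) -> (forall x, linear (b x)) ->
  exists f : 'Hom(U, 'Hom(V, W)), forall x y, f x y = b x y.
Proof.
move=> bl br; pose g x : 'Hom(V, W) := linfun (mklin (br x)).
have gE x y : g x y = b x y by rewrite lfunE.
have lg : linear g.
  by move=> c x x'; apply/lfunP => y; rewrite add_lfunE scale_lfunE !gE bl.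
by exists (linfun (mklin lg)) => x y; rewrite lfunE gE.
Qed.

Variable A : freeAlgType O.
Variables M N : fmod A.

Lemma divide_derivation pi (D : A -> M -> N) : pi != 0 ->
  derivation D -> (forall a x, exists y, D a x = pi *: y) ->
  exists2 D' : A -> M -> N, derivation D' & forall a x, D a x = pi *: D' a x.
Proof.
move=> pin [Dl Dr DM] div.
pose D' a x := proj1_sig (constructive_indefinite_description _ (div a x)).
have DE a x : D a x = pi *: D' a x by rewrite /D'; case: constructive_indefinite_description.
exists D' => //; split=> [x c a b|a c x y|a b x]; apply: (scaleO_inj hO pin).
- by rewrite -DE Dl !DE scalerDr !scalerA mulrC.
- by rewrite -DE Dr !DE scalerDr !scalerA mulrC.
- by rewrite -DE DM !DE actZr scalerDr.
Qed.

Lemma inner_derivation (f : M -> N) : linear f ->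
  derivation (fun a x => act a (f x) - f (act a x)).
Proof.
move=> lf; have fD x y : f (x + y) = f x + f y by have := lf 1 x y; rewrite !scale1r.
split=> [x c a b|a c x y|a b x].
- by rewrite !act_linl lf scalerBr opprD addrACA.
- by rewrite lf !act_linr lf scalerBr opprD addrACA.
- by rewrite !actM actBr addrA subrK.
Qed.

Lemma bc_derivation (D : A -> M -> N) : derivation D ->
  derivation (M := bc_mod ik M) (N := bc_mod ik N) (bcbil (phi := ik) D).
Proof.
move=> [Dl Dr DM]; have Din := bcbil_in ik Dl Dr.
split=> [x|a|a b x]; [exact: bcbil_linl | exact: bcbil_linr |].
have multl (c : bc ik A) : linear ( *%R^~ c) by move=> d y z; rewrite mulrDl scalerAl.
have multr (c : bc ik A) : linear ( *%R c) by move=> d y z; rewrite mulrDr scalerAr.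
move: a; apply: (bc_ext (phi := ik)) => [c u v|c u v|a].
- by rewrite multl bcbil_linl.
- by rewrite act_linl bcbil_linl scalerDr addrACA.
move: b; apply: (bc_ext (phi := ik)) => [c u v|c u v|b].
- by rewrite multr bcbil_linl.
- by rewrite bcbil_linl act_linl act_linr bcbil_linr scalerDr addrACA.
move: x; apply: (bc_ext (phi := ik)) => [c u v|c u v|x].
- by rewrite bcbil_linr.
- by rewrite bcbil_linr !act_linr bcbil_linr scalerDr addrACA.
rewrite [_ * _]bcmul_in bc_act_in !Din bc_act_in -bcinD; congr (bcin _ _); exact: DM.
Qed.

(* The obstruction to lifting a homomorphism modulo the maximal ideal is a     *)
(* derivation; all derivations are inner by Nakayama, as they are so modulo   *)
(* the maximal ideal.                                                         *)
Lemma hom_lift (f : mhom (bc_mod ik M) (bc_mod ik N)) :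
  ext0 (bc_mod ik M) (bc_mod ik N) ->
  exists g : mhom M N, forall x : M, f (bcin ik x) = bcin ik (g x).
Proof.
move=> e; have [pi pin piE] := uniformizer hO.
have pi0 : ik pi = 0 by apply/piE; exists 1; rewrite mulr1.
have divP (V : vectType O) (x : V) := bcink_eq0 x piE.
have reduce (D : A -> M -> N) : derivation D ->
    exists2 h : M -> N, linear h & exists2 D' : A -> M -> N, derivation D' &
      forall a x, D a x = (act a (h x) - h (act a x)) + pi *: D' a x.
  move=> dD; have [h' lh' h'E] := ext0_inner (bc_derivation dD) e.
  have [h lh hE] := link_lift hO (V := M) (W := N) lh'.
  exists h => //; have [Dl Dr DM] := dD; have [Il Ir IM] := inner_derivation lh.
  have [||D' dD' D'E] := @divide_derivation pi (fun a x => D a x - (act a (h x) - h (act a x))) pin.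
  - split=> [x c a b|a c x y|a b x].
    + by rewrite Dl Il opprD addrACA -scalerBr.
    + by rewrite Dr Ir opprD addrACA -scalerBr.
    + by rewrite DM IM opprD addrACA -actBr.
  - move=> a x; apply/divP; rewrite bcinD -(scaleN1r (_ - _)) bcinZ rmorphN1 scaleN1r.
    apply/eqP; rewrite subr_eq0; apply/eqP.
    have := h'E (bcin ik a) (bcin ik x); rewrite (bcbil_in ik Dl Dr) => ->.
    rewrite bc_act_in !hE bc_act_in bcinD -(scaleN1r (h _)) bcinZ rmorphN1.
    by rewrite scaleN1r.
  by exists D' => // a x; rewrite -D'E addrC subrK.
have homP (c : O) (E1 E2 : 'Hom(A, 'Hom(M, N))) a x :
    (c *: E1 + E2) a x = c *: E1 a x + E2 a x.
  rewrite (_ : (c *: E1 + E2) a = c *: E1 a + E2 a).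
    by rewrite add_lfunE scale_lfunE.
  by rewrite [LHS]add_lfunE scale_lfunE.
have hom0 a x : (0 : 'Hom(A, 'Hom(M, N))) a x = 0.
  have := homP 1 0 0 a x.
  by rewrite scale1r addr0 scale1r -[X in X = _]addr0 => /addrI.
have derI (D : A -> M -> N) : derivation D -> inner D.
  move=> dD; have [Dl Dr DM] := dD; have [E EE] := lfun_of_bilinear Dl Dr.
  suff [h lh hE] : inner (fun a x => E a x) by exists h => // a x; rewrite -EE.
  (* Derivations form a submodule of the finite free module Hom(A, Hom(M, N)), and [reduce]
     expresses each of them as an inner one plus [pi] times a derivation. *)
  apply: (nakayama (U := fun E : 'Hom(A, 'Hom(M, N)) => derivation (fun a x => E a x))
                   (W := fun E => inner (fun a x => E a x)) pi0).
  - split=> [|c E1 E2 [l1 r1 m1] [l2 r2 m2]].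
      split=> [x c a b|a c x y|a b x]; rewrite !hom0 ?scaler0 ?act0r ?addr0 //.
    split=> [x c' a b|a c' x y|a b x]; first by rewrite !linearP add_lfunE scale_lfunE.
      by rewrite linearP.
    rewrite !homP m1 m2.
    by rewrite actDr actZr scalerDr addrACA.
  - split=> [|c E1 E2 [h1 l1 e1] [h2 l2 e2]].
      exists (fun=> 0) => [c x y|a x]; first by rewrite scaler0 addr0.
      by rewrite hom0 act0r subr0.
    exists (fun x => c *: h1 x + h2 x) => [c' x y|a x].
      by rewrite l1 l2 !scalerDr !scalerA mulrC addrACA.
    rewrite homP e1 e2.
    by rewrite actDr actZr scalerBr opprD addrACA.
  - move=> E' dE'; have [h lh [D' [Dl' Dr' DM'] D'E]] := reduce _ dE'.
    have [Il Ir _] := inner_derivation lh.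
    have [I IE] := lfun_of_bilinear Il Ir; have [E2 E2E] := lfun_of_bilinear Dl' Dr'.
    exists I, E2; split.
    + by exists h.
    + by split=> [x c a b|a c x y|a b x]; rewrite !E2E ?Dl' ?Dr' ?DM'.
    apply/lfunP => a; apply/lfunP => x.
    by rewrite addrC homP IE E2E D'E addrC.
  split=> [x c a b|a c x y|a b x]; by rewrite !EE ?Dl ?Dr ?DM.
have lf : linear f by move=> c u v; rewrite linearP.
(* [g0] lifts [f] only linearly. Its failure to be equivariant is [pi] times a derivation, which is
   inner through [h], so g0 - pi h is equivariant and still lifts [f]. *)
have [g0 lg0 g0E] := link_lift hO (V := M) (W := N) lf.
have [|D' dD' D'E] := divide_derivation pin (inner_derivation lg0).
  move=> a x; apply/divP; rewrite bcinD -(scaleN1r (g0 _)) bcinZ rmorphN1 scaleN1r.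
  rewrite -g0E -!bc_act_in mhom_act g0E; apply/eqP.
  by rewrite subr_eq0.
have [h lh hE] := derI _ dD'.
have lg : linear (fun x => g0 x - pi *: h x).
  move=> c x y; rewrite lg0 lh scalerDr scalerBr opprD addrACA.
  by rewrite !scalerA mulrC.
have eg a x : g0 (act a x) - pi *: h (act a x) = act a (g0 x - pi *: h x).
  have e' : g0 (act a x) = act a (g0 x) - (pi *: act a (h x) - pi *: h (act a x)).
    by rewrite -scalerBr -hE -D'E subKr.
  by rewrite actBr actZr e' opprB addrC addrCA addKr.
exists (mkhom lg eg) => x.
rewrite bcinD -(scaleN1r (_ *: _)) !bcinZ pi0 scale0r scaler0 addr0.
exact: g0E.
Qed.

End Lifting.

(** * Reduction of a split quasi-hereditary algebra *)

Lemma direct_sum_filtration (F : fieldType) (S : freeAlgType F) (L : eqType)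
    (C : L -> fmod S -> Prop) n (D : 'I_n -> fmod S) (lab : 'I_n -> L) (M : fmod S) :
  (forall j, C (lab j) (D j)) -> direct_sum D M -> exists s, filtration C M s.
Proof.
elim: n D lab M => [|n IH] D lab M CD [i [p [pi pi0 ip]]].
  by exists [::]; apply: FiltNil => x; rewrite (ip x) big_ord0.
have sp : surj (p ord0) by move=> y; exists (i ord0 y); rewrite pi.
have [N [e exN]] := ker_exists sp; have [inje _ ker] := exN.
have fac j : exists i' : mhom (D (lift ord0 j)) N, forall x, e (i' x) = i (lift ord0 j) x.
  by apply: factor_inj inje _ => x; apply/ker; apply: pi0; rewrite eq_sym neq_lift.
pose i' j := proj1_sig (constructive_indefinite_description _ (fac j)).
have i'E j x : e (i' j x) = i (lift ord0 j) x.
  by rewrite /i'; case: constructive_indefinite_description.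
have [||s FN] := IH (fun j => D (lift ord0 j)) (fun j => lab (lift ord0 j)) N.
- by move=> j.
- exists i', (fun j => mhom_comp (p (lift ord0 j)) e); split=> [j x|j j' x nj|x] /=.
  + by rewrite i'E pi.
  + by rewrite i'E pi0 // (inj_eq lift_inj).
  apply: inje; rewrite linear_sum [e x in LHS]ip big_ord_recl /=.
  rewrite (iffRL (ker (e x))) ?linear0 ?add0r; last by exists x.
  by apply: eq_bigr => j _; rewrite i'E.
by exists (lab ord0 :: s); apply: FiltCons exN (CD _) FN.
Qed.

Section Restriction.
Variables (R : comNzRingType) (A B : freeAlgType R) (p : {lrmorphism A -> B}).

Definition restrict_hom (M N : fmod B) (f : mhom M N) : mhom (restrict p M) (restrict p N) :=
  @MHom R A (restrict p M) (restrict p N) (hfun f) (fun a x => mhom_act f (p a) x).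

Fact quotient_lin : linear (fun a : regular A => p (a : A) : restrict p (regular B)).
Proof. by move=> c a b; rewrite linearP. Qed.

Fact quotient_act (a : A) (x : regular A) :
  (p (act a x : A) : restrict p (regular B)) = act a (p (x : A) : restrict p (regular B)).
Proof. exact: rmorphM. Qed.

Definition quotient_hom : mhom (regular A) (restrict p (regular B)) :=
  mkhom quotient_lin quotient_act.

End Restriction.

(** * Projective modules above the integral standard modules *)

Section Cover.
Variables (O : idomainType) (A : freeAlgType O) (d : Order.disp_t) (L : finPOrderType d).
Variable (q : split_qh A L).
Local Notation Delta := (qh_std q).

Record std_cover (l : L) := StdCover {
  covP : fmod A;
  covN : fmod A;
  covi : mhom covN covP;
  covq : mhom covP (Delta l);
  covs : seq L;
  cov_proj : projective covP;
  cov_exact : short_exact covi covq;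
  cov_filt : filtration (fun m X => iso X (Delta m)) covN covs;
  cov_lt : all (fun m => l < m)%O covs }.

Lemma cover_inhabited l : inhabited (std_cover l).
Proof.
by have [P [N [i [p [s [pP ex FN sl]]]]]] := qh_std_proj q l; constructor; exists P N i p s.
Qed.

Definition chosen_cover l : std_cover l :=
  proj1_sig (constructive_indefinite_description (fun _ => True)
    (let: inhabits c := cover_inhabited l in ex_intro _ c I)).

Variables (l : L) (C : std_cover l).

Lemma cover_hom_le m (f : mhom (covP C) (Delta m)) : nonzero f -> (l <= m)%O.
Proof.
move=> [x fx]; have [inji sq ker] := cov_exact C.
have [fi0|nf] := zero_or_nonzero (mhom_comp f (covi C)).
  have [|g gE] := factor_surj (f := f) sq; first by move=> y /ker[z <-]; apply: fi0.
  by apply: (qh_std_hom (f := g)); exists (covq C x); rewrite gE.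
have [k [Q [g [ks isoQ [z gz]]]]] := filt_hom (cov_filt C) nf.
have [h [injh sh]] := iso_inj_surj (iso_sym isoQ); have [w hw] := sh z.
apply: le_trans (ltW (allP (cov_lt C) k ks)) _.
by apply: (qh_std_hom (f := mhom_comp g h)); exists w; rewrite /= hw.
Qed.

Lemma cover_hom_scal (f : mhom (covP C) (Delta l)) : exists c, forall x, f x = c *: covq C x.
Proof.
have [inji sq ker] := cov_exact C.
have [fi0|nf] := zero_or_nonzero (mhom_comp f (covi C)).
  have [|g gE] := factor_surj (f := f) sq; first by move=> y /ker[z <-]; apply: fi0.
  by have [c cE] := qh_std_end g; exists c => x; rewrite -gE cE.
have [k [Q [g [ks isoQ [z gz]]]]] := filt_hom (cov_filt C) nf.
have [h [injh sh]] := iso_inj_surj (iso_sym isoQ); have [w hw] := sh z.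
have : (k <= l)%O.
  by apply: (qh_std_hom (f := mhom_comp g h)); exists w; rewrite /= hw.
by rewrite (lt_geF (allP (cov_lt C) k ks)).
Qed.

End Cover.

Section Reduction.
Variables (l : nat) (O : idomainType) (K k : fieldType).
Variables (iK : {rmorphism O -> K}) (ik : {rmorphism O -> k}).
Hypothesis hO : modular_system l iK ik.
Variables (A : freeAlgType O) (d : Order.disp_t) (L : finPOrderType d).
Variable (q : split_qh A L).
Local Notation Delta := (qh_std q).

(** It suffices to lift the images of the members of a dual basis. *)
Lemma projective_hom_lift (P N : fmod A) (f : mhom (bc_mod ik P) (bc_mod ik N)) :
  projective P -> exists g : mhom P N, forall x : P, f (bcin ik x) = bcin ik (g x).
Proof.
move=> /projective_dual_basis[n [x [e xe]]].
pose m j := proj1_sig (constructive_indefinite_description _ (bcink_surj hO (V := N) (f (bcin ik (x j))))).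
have mE j : bcin ik (m j) = f (bcin ik (x j)).
  by rewrite /m; case: constructive_indefinite_description.
have [g gE] := dual_basis_hom m xe; exists g => y.
rewrite (dual_basis_homE f _ (bc_dual_basis ik xe)) gE bcin_sum.
apply: eq_bigr => j _; have [le _ _] := xe.
by rewrite bclin_in // -mE bc_act_in.
Qed.

Lemma bchom_determined (M N : fmod A) (f : mhom (bc_mod ik M) (bc_mod ik N)) (g : mhom M N) :
  (forall x : M, f (bcin ik x) = bcin ik (g x)) -> f =1 bchom ik g.
Proof. by move=> fg; apply: bchom_ext => x; rewrite bchom_in fg. Qed.

Lemma nonzero_lift (M N : fmod A) (f : mhom (bc_mod ik M) (bc_mod ik N)) (g : mhom M N) :
  (forall x : M, f (bcin ik x) = bcin ik (g x)) -> nonzero f -> nonzero g.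
Proof.
move=> fg [u fu]; have [x xE] := bcink_surj hO (V := M) u; exists x.
by apply: contra fu => /eqP gx; rewrite -xE fg gx bcin0.
Qed.

Lemma bc_nonzero_mod (F : fieldType) (phi : {rmorphism O -> F}) (M : fmod A) :
  ~ zero_mod M -> ~ zero_mod (bc_mod phi M).
Proof.
move=> nM M0; apply: nM => x; rewrite [x]bbasis_sum big1 // => i _.
have := M0 (bcin phi (bbasis i)); rewrite bcin_basis => /matrixP/(_ 0 i)/eqP.
by rewrite !mxE !eqxx oner_eq0.
Qed.

Lemma bc_regular (F : fieldType) (phi : {rmorphism O -> F}) :
  iso (bc_mod phi (regular A)) (regular (bc phi A)).
Proof.
have lid : linear (fun u : bc_mod phi (regular A) => u : regular (bc phi A)) by [].
by exists (mkhom lid (fun a x => erefl)), id.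
Qed.

Lemma restrict_std_filtration (Abar : freeAlgType O) (p : {lrmorphism A -> Abar}) X n
    (lab : 'I_n -> L) : direct_sum (fun j => Delta (lab j)) (restrict p X) ->
  exists s, filtration (fun m Y => iso Y (bc_std ik q m)) (bc_mod ik (restrict p X)) s.
Proof.
move=> [i [r [ri ri0 ir]]].
apply: (direct_sum_filtration (D := fun j => bc_std ik q (lab j)) (lab := lab)).
  by move=> j; apply: iso_refl.
exists (fun j => bchom ik (i j)), (fun j => bchom ik (r j)); split.
- move=> j; apply: (bchom_ext (f := mhom_comp (bchom ik (r j)) (bchom ik (i j))) (g := mhom_id _)) => x.
  by rewrite -[LHS]/(bchom ik (r j) (bchom ik (i j) (bcin ik x))) !bchom_in ri.
- move=> j j' x nj; move: x.
  apply: (bchom_ext (f := mhom_comp (bchom ik (r j')) (bchom ik (i j))) (g := mhom_zero _ _)) => x.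
  by rewrite -[LHS]/(bchom ik (r j') (bchom ik (i j) (bcin ik x))) !bchom_in ri0 ?bcin0.
apply: (bc_ext (phi := ik) (V := restrict p X)) => [//|c u v|x].
  rewrite scaler_sumr -big_split; apply: eq_bigr => j _ /=.
  exact: (linearP (hfun (mhom_comp (bchom ik (i j)) (bchom ik (r j))))) .
rewrite [x in LHS]ir bcin_sum; apply: eq_bigr => j _.
by rewrite !bchom_in.
Qed.

(** Descending induction along the chain of ideals: A/J_i is an extension of A/J_(i+1) by the
    heredity ideal J_(i+1)/J_i, which is a direct sum of standard modules. The last quotient is its
    own heredity ideal, and i = 0 gives the algebra. *)
Lemma regular_std_filtration :
  exists s, filtration (fun m Y => iso Y (bc_std ik q m)) (regular (bc ik A)) s.
Proof.
pose good i := exists (Abar : freeAlgType O) (p : {lrmorphism A -> Abar}),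
  [/\ surj (quotient_hom p), forall x, p x = 0 <-> qh_ideal q i x
    & exists s, filtration (fun m Y => iso Y (bc_std ik q m))
        (bc_mod ik (restrict p (regular Abar))) s].
have len0 : (0 < qh_len q)%N.
  rewrite lt0n; apply/eqP => len0; have := qh_idealT q 1.
  by rewrite len0 => /qh_ideal0/eqP; rewrite oner_eq0.
have [Abar [p [sp kerp [s Fs]]]] : good 0%N.
  suff goods m i : (qh_len q - i <= m)%N -> (i < qh_len q)%N -> good i by apply: (goods (qh_len q)); rewrite ?subn0.
  elim: m i => [|m IH] i; first by rewrite leqn0 subn_eq0 leqNgt => /negPf->.
  move=> lem lti; have [Abar [p [X [sp kerp her [n [lab [ds _]]]]]]] := qh_heredity (Ordinal lti).
  have [_ _ [[e [inje eJ]] _] _ _] := her.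
  exists Abar, p; split=> //.
  have [sX FX] := restrict_std_filtration ds.
  have [lti1|gei1] := ltnP i.+1 (qh_len q); last first.
    exists sX; apply: filt_iso FX; apply: bc_iso.
    apply: (inj_surj_iso (f := restrict_hom p e)) => //.
    move=> y; have [x xE] := sp y; apply/eJ; exists x => //=.
    by rewrite (_ : i.+1 = qh_len q); [exact: qh_idealT | apply/eqP; rewrite eqn_leq lti].
  have [|Abar' [p' [sp' kerp' [s' Fs']]]] := IH _ _ lti1.
    by rewrite subnS -ltnS prednK ?subn_gt0.
  have [|pi piE] := factor_surj (p := quotient_hom p) (f := quotient_hom p') sp.
    move=> x px; apply/kerp'.
    have /kerp Jx : p x = 0 := px.
    by case: (qh_ideal_lt lti) => sub _; apply: sub.
  exists (s' ++ sX); apply: filt_cat Fs' FX.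
  apply: (bc_short_exact ik (i := restrict_hom p e) (p := pi)); split=> //.
    by move=> y; have [x <-] := sp' y; exists (quotient_hom p x).
  move=> y; have [x <-] := sp y; rewrite piE; split=> [/kerp' Jx|].
    by have [|z zE] := iffLR (eJ (p x)); [exists x | exists z].
  move=> ze; have [x' Jx' pxx'] := iffRL (eJ (p x)) ze.
  rewrite -piE; have -> : quotient_hom p x = quotient_hom p x' by [].
  by rewrite piE; apply/kerp'.
exists s; have isoA : iso (restrict p (regular Abar)) (regular A).
  apply: iso_sym; apply: inj_surj_iso sp.
  by apply: mhom_inj => x /kerp/qh_ideal0.
exact: filt_iso (bc_regular ik) (filt_iso (bc_iso ik isoA) Fs).
Qed.

(** The Hom conditions in [hw_data] concern maps out of the projectives only, and those lift to [O],
    where they follow from the integral structure. *)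
Lemma hw_data_reduction : hw_data (bc_std ik q).
Proof.
apply: (@HWData k (bc ik A) d L (bc_std ik q)
  (fun m => bc_mod ik (covP (chosen_cover q m))) (fun m => bc_mod ik (covN (chosen_cover q m)))
  (fun m => bchom ik (covi (chosen_cover q m))) (fun m => bchom ik (covq (chosen_cover q m)))
  (fun m => covs (chosen_cover q m))).
- by move=> m; apply: bc_short_exact (cov_exact _).
- move=> m; have [n [x [e xe]]] := projective_dual_basis (cov_proj (chosen_cover q m)).
  exact: dual_basis_lifts (bc_dual_basis ik xe).
- by move=> m; apply: bc_filtration (cov_filt (chosen_cover q m)) => j Q; apply: bc_iso.
- by move=> m j; apply: (allP (cov_lt (chosen_cover q m))).
- move=> m j f nf; have [g gE] := projective_hom_lift f (cov_proj _).
  exact: cover_hom_le (nonzero_lift gE nf).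
- move=> m f; have [g gE] := projective_hom_lift f (cov_proj _).
  have [c cE] := cover_hom_scal g; exists (ik c) => u.
  rewrite (bchom_determined gE); move: u.
  apply: (bchom_ext (f := bchom ik g) (g := mhom_scale (ik c) (bchom ik (covq (chosen_cover q m))))) => x.
  by rewrite -[RHS]/(ik c *: bchom ik (covq (chosen_cover q m)) (bcin ik x)) !bchom_in cE bcinZ.
- by move=> m; apply: bc_nonzero_mod; apply: qh_std_neq0.
- exact: regular_std_filtration.
Qed.

End Reduction.

(** * Tuples of homomorphisms *)

Definition right_mul (R : comNzRingType) (A B : freeAlgType R) (T : bimod A B) (b : B) :
  mhom (lmod T) (lmod T) :=
  @mkhom _ _ (lmod T) (lmod T) (fun x => ract x b) (@ract_linl _ _ _ T b)
    (fun a x => esym (@lractA _ _ _ T a x b)).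

Section Bimodule.
Variables (R : comNzRingType) (A B : freeAlgType R) (T : bimod A B).

Lemma ract_sumr n (b : 'I_n -> B) (x : T) : ract x (\sum_j b j) = \sum_j ract x (b j).
Proof.
by apply: (big_morph (fun b => ract x b) _ (lin0 (@ract_linr _ _ _ T x))) => b1 b2;
  have := @ract_linr _ _ _ T x 1 b1 b2; rewrite !scale1r.
Qed.

Lemma ract_subr (x : T) (b c : B) : ract x (b - c) = ract x b - ract x c.
Proof.
by have := @ract_linr _ _ _ T x (-1) c b; rewrite !scaleN1r ![- _ + _]addrC.
Qed.

Lemma lact_subl (x : T) (a c : A) : lact (a - c) x = lact a x - lact c x.
Proof.
by have := @lact_linl _ _ _ T x (-1) c a; rewrite !scaleN1r ![- _ + _]addrC.
Qed.

Lemma ract_bcin (F : comNzRingType) (phi : {rmorphism R -> F}) (x : T) (b : B) :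
  ract (bcin phi x : bc_bimod phi T) (bcin phi b) = bcin phi (ract x b).
Proof. exact: (bcbil_in phi (@ract_linl _ _ _ T) (@ract_linr _ _ _ T)). Qed.

Lemma lact_bcin (F : comNzRingType) (phi : {rmorphism R -> F}) (x : T) (a : A) :
  lact (bcin phi a) (bcin phi x : bc_bimod phi T) = bcin phi (lact a x).
Proof. exact: (bcbil_in phi (@lact_linl _ _ _ T) (@lact_linr _ _ _ T)). Qed.

End Bimodule.

Section Tuples.
Variables (l : nat) (O : idomainType) (K k : fieldType).
Variables (iK : {rmorphism O -> K}) (ik : {rmorphism O -> k}).
Hypothesis hO : modular_system l iK ik.
Variables (A B : freeAlgType O) (d : Order.disp_t) (L : finPOrderType d).
Variables (q : split_qh A L) (T : bimod A B).
Local Notation Delta := (qh_std q).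
Variables (n : nat) (e : 'I_n -> 'I_n -> B).

Lemma hom_divide (M N : fmod A) (f : mhom M N) c : c != 0 ->
  (forall x, exists y, f x = c *: y) -> exists g : mhom M N, forall x, f x = c *: g x.
Proof.
move=> c0 fc; apply: (mhom_of_rel (r := fun x y => f x = c *: y)) => //.
- by move=> y; rewrite linear0 -{1}(scaler0 _ c) => /(scaleO_inj hO c0).
- by move=> a x x' y y' xy xy'; rewrite linearP xy xy' scalerDr !scalerA mulrC.
- by move=> a x y xy; rewrite mhom_act xy actZr.
Qed.

(* The homomorphisms from [Delta m] to the summand of [T^n] cut out by the     *)
(* idempotent matrix [e].                                                     *)
Definition tuple_fixed m (f : 'I_n -> mhom (Delta m) (lmod T)) : Prop :=
  forall i x, f i x = \sum_j ract (f j x : T) (e j i).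

Hypothesis e_idem : forall i j, \sum_h e i h * e h j = e i j.
Hypothesis hT : tilting (qh_weights ik q) (lmod (bc_bimod ik T)).
Variable la : L.
Hypothesis tuple_le : forall m (f : 'I_n -> mhom (Delta m) (lmod T)),
  tuple_fixed f -> (exists i, nonzero (f i)) -> (m <= la)%O.
Hypothesis tuple_prop : forall f g : 'I_n -> mhom (Delta la) (lmod T),
  tuple_fixed f -> tuple_fixed g -> exists c,
    (forall i x, f i x = c *: g i x) \/ (forall i x, g i x = c *: f i x).
Hypothesis tuple_exists : exists2 f : 'I_n -> mhom (Delta la) (lmod T),
  tuple_fixed f & exists i, nonzero (f i).

Let bcinZT (c : O) (x : lmod T) : bcin ik (c *: x : T) = ik c *: bcin ik (x : T).
Proof. exact: bcinZ. Qed.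

(** [f] followed by the map from T to T^n sending t to row [j] of t e; as [e] is idempotent, it
    lands in the part cut out by [e]. *)
Let right_tuple m (f : mhom (Delta m) (lmod T)) j i := mhom_comp (right_mul T (e j i)) f.

Let right_tuple_fixed m (f : mhom (Delta m) (lmod T)) j : tuple_fixed (right_tuple f j).
Proof.
move=> i x; rewrite -[LHS]/(ract (f x : T) (e j i)) -e_idem ract_sumr.
by apply: eq_bigr => h _; rewrite ractM.
Qed.

(** A nonzero tuple is divided by the greatest common divisor of all coordinates of all its
    values. *)
Let normalized_tuple : exists2 f : 'I_n -> mhom (Delta la) (lmod T),
  tuple_fixed f & exists i x, bcin ik (f i x : T) != 0.
Proof.
have [f ff [i [x fx]]] := tuple_exists.
have [|c [i0 [x0 [h0 cE]]] cmin] := min_divisor hO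
    (I := fun a => exists i (x : Delta la) h, a = v2r (f i x : T) 0 h).
  have [h _] : exists h : 'I_(dim T), True.
    case: (posnP (dim T)) => [d0|d0]; last by exists (Ordinal d0).
    case/eqP: fx; apply: (can_inj (@v2rK _ _)); apply/rowP => h.
    by case: h => h lt; exfalso; rewrite d0 in lt.
  by exists (v2r (f i x : T) 0 h), i, x, h.
have c0 : c != 0.
  apply: contra fx => /eqP c0; apply/eqP; apply: (can_inj (@v2rK _ _)).
  rewrite linear0; apply/rowP => h; rewrite [RHS]mxE.
  by have [|a ->] := cmin (v2r (f i x : T) 0 h); [exists i, x, h | rewrite c0 mulr0].
have div j y : exists z : lmod T, f j y = c *: z.
  have co h : exists a, v2r (f j y : T) 0 h = a * c by apply: cmin; exists j, y, h.
  pose a h := proj1_sig (constructive_indefinite_description _ (co h)).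
  have aE h : v2r (f j y : T) 0 h = a h * c by rewrite /a; case: constructive_indefinite_description.
  exists (r2v (\row_h a h)); rewrite -[LHS]v2rK -linearZ; congr r2v; apply/rowP => h.
  by rewrite aE !mxE mulrC.
pose g j := proj1_sig (constructive_indefinite_description _ (hom_divide c0 (div j))).
have gE j y : f j y = c *: g j y by rewrite /g; case: constructive_indefinite_description.
exists g => [j y|].
  apply: (scaleO_inj hO c0); rewrite -gE ff scaler_sumr; apply: eq_bigr => h _.
  rewrite gE; have := @ract_linl _ _ _ T (e h j) c (g h y) 0.
  by rewrite !addr0 (lin0 (@ract_linl _ _ _ T _)) addr0.
exists i0, x0; apply/eqP => /matrixP/(_ 0 h0); rewrite !mxE.
move: cE; rewrite gE linearZ mxE -{1}[c]mulr1 => /(mulfI c0) <-.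
by rewrite rmorph1 => /eqP; rewrite oner_eq0.
Qed.

(** The rank-one bound over [O] turns right multiplication by a diagonal entry of [e] into an
    endomorphism of kT with a nonzero eigenvalue on a map from the standard module of [la], as
    [indec_tilting_exists] requires. *)
Lemma tilting_summand :
  (exists2 X, indec_tilting (qh_weights ik q) la X & summand X (lmod (bc_bimod ik T)))
  /\ exists h : mhom (bc_std ik q la) (lmod (bc_bimod ik T)), injective h.
Proof.
have H := hw_data_reduction hO q.
have [_ [t Ft]] := hT.
have lift m (h : mhom (bc_std ik q m) (bc_mod ik (lmod T))) :
    exists f : mhom (Delta m) (lmod T), forall x : Delta m, h (bcin ik x) = bcin ik (f x : T).
  apply: (hom_lift hO); exact: (costd_filt_ext_std H) Ft.
have [f ff [i0 [x0 fx0]]] := normalized_tuple.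
(* Row [j] applied to [f j] and [f] itself are proportional over [O]. If the constant stands on the
   side of the row, it is a unit modulo the maximal ideal, since [f] is nonzero there. *)
have eigen j : exists c, forall i x, bcin ik (ract (f j x : T) (e j i)) = c *: bcin ik (f i x : T).
  have [c [E|E]] := tuple_prop (right_tuple_fixed (f j) j) ff.
    by exists (ik c) => i x; have /= -> := E i x; rewrite bcinZT.
  have c0 : ik c != 0.
    by apply: contra fx0 => /eqP c0; rewrite E bcinZT c0 scale0r.
  by exists (ik c)^-1 => i x; rewrite (E i x) bcinZT scalerA mulVf // scale1r.
pose c j := proj1_sig (constructive_indefinite_description _ (eigen j)).
have cE j i x : bcin ik (ract (f j x : T) (e j i)) = c j *: bcin ik (f i x : T).
  by move: i x; rewrite /c; case: constructive_indefinite_description.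
(* Summing over [j] gives f = (sum of the c_j) f modulo the maximal ideal, as the tuple is fixed by
   [e]. *)
have [j cj] : exists j, c j != 0.
  apply: NNPP => nc; case/eqP: fx0; rewrite ff bcin_sum big1 // => j _.
  rewrite cE; have [->|cj] := eqVneq (c j) 0; first by rewrite scale0r.
  by case: nc; exists j.
have nfj : nonzero (bchom ik (f j)).
  have [fj0|//] := zero_or_nonzero (bchom ik (f j)).
  have := cE j i0 x0; rewrite -ract_bcin.
  have -> : bcin ik (f j x0 : T) = 0 by rewrite -[RHS](fj0 (bcin ik x0)) bchom_in.
  rewrite (lin0 (@ract_linl _ _ _ (bc_bimod ik T) _)) => /esym/eqP.
  by rewrite scaler_eq0 (negPf cj) (negPf fx0).
have tY : tilting (hw_weights (bc_std ik q)) (bc_mod ik (lmod T)) := hT.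
(* Multiplication by e_jj factors through the part of kT^n cut out by [e], so the bounds for tuples,
   transported by lifting maps to [O], bound its composites with maps from standard modules. *)
apply: (indec_tilting_exists H (g := bchom ik (right_mul T (e j j))) tY nfj cj).
- apply: (bchom_ext (f := mhom_comp (bchom ik (right_mul T (e j j))) (bchom ik (f j)))
                    (g := mhom_scale (c j) (bchom ik (f j)))) => x.
  rewrite -[LHS]/(bchom ik (right_mul T (e j j)) (bchom ik (f j) (bcin ik x))).
  by rewrite -[RHS]/(c j *: bchom ik (f j) (bcin ik x)) !bchom_in -cE.
- move=> m h nh; have [g gE] := lift m h.
  apply: (tuple_le (right_tuple_fixed g j)); exists j.
  apply: (nonzero_lift hO _ nh) => x.
  by rewrite -[LHS]/(bchom ik (right_mul T (e j j)) (h (bcin ik x))) gE bchom_in.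
- move=> h h'; have [g gE] := lift la h; have [g' g'E] := lift la h'.
  have comp (h1 : mhom (bc_std ik q la) (bc_mod ik (lmod T))) g1 :
      (forall x : Delta la, h1 (bcin ik x) = bcin ik (g1 x : T)) ->
      forall x : Delta la, mhom_comp (bchom ik (right_mul T (e j j))) h1 (bcin ik x) =
        bcin ik (ract (g1 x : T) (e j j)).
    by move=> g1E x; rewrite -[LHS]/(bchom ik (right_mul T (e j j)) (h1 (bcin ik x))) g1E bchom_in.
  have [a [E|E]] := tuple_prop (right_tuple_fixed g j) (right_tuple_fixed g' j);
    exists (ik a); [left|right].
  + apply: (bchom_ext (f := mhom_comp _ h) (g := mhom_scale (ik a) (mhom_comp _ h'))) => x.
    rewrite (comp _ _ gE) -[RHS]/(ik a *: mhom_comp _ h' (bcin ik x)) (comp _ _ g'E) -bcinZT.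
    by congr bcin; apply: (E j x).
  + apply: (bchom_ext (f := mhom_comp _ h') (g := mhom_scale (ik a) (mhom_comp _ h))) => x.
    rewrite (comp _ _ g'E) -[RHS]/(ik a *: mhom_comp _ h (bcin ik x)) (comp _ _ gE) -bcinZT.
    by congr bcin; apply: (E j x).
Qed.

End Tuples.

(** * Semisimplicity and tensor equivalences *)

Section Semisimple.
Variables (F : fieldType) (S : freeAlgType F).
Hypothesis ssS : semisimple_alg S.
Implicit Types M N : fmod S.

(** A stable subspace meeting [U] trivially is enlarged: if [x] lies outside U + C, some simple
    summand of the regular module, applied to [x], meets U + C trivially and may be added to [C]. *)
Lemma stable_complement M (U : {vspace M}) : stable U ->
  exists C : {vspace M}, [/\ stable C, (U + C)%VS = fullv & (U :&: C)%VS = 0%VS].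
Proof.
move=> sU; have [n [D [sD [i [p [_ _ ip]]]]]] := ssS.
suff grow m (C : {vspace M}) : (\dim {:M} - \dim C <= m)%N -> stable C ->
    (U :&: C)%VS = 0%VS -> exists C : {vspace M},
      [/\ stable C, (U + C)%VS = fullv & (U :&: C)%VS = 0%VS].
  apply: (grow _ 0%VS (leqnn _)); last by rewrite capv0.
  by move=> a x; rewrite memv0 => /eqP->; rewrite act0r mem0v.
elim: m C => [|m IH] C leC sC UC0.
  exists C; split=> //; apply/eqP; rewrite eqEsubv subvf.
  suff /eqP-> : C == fullv by rewrite addvSr.
  by rewrite eqEdim subvf /= -subn_eq0 -leqn0.
have [UC|UCn] := eqVneq (U + C)%VS fullv; first by exists C.
have [x UCx] : exists x, x \notin (U + C)%VS.
  apply: NNPP => nx; case/eqP: UCn; apply/eqP; rewrite eqEsubv subvf.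
  by apply/subvP => x _; apply/negPn/negP => UCx; apply: nx; exists x.
have sUC : stable (U + C)%VS.
  by move=> a _ /memv_addP[y Uy [z Cz ->]]; rewrite actDr memv_add ?sU ?sC.
have [j xj] : exists j, act (i j (p j (1 : S)) : S) x \notin (U + C)%VS.
  apply: NNPP => nj; case/negP: UCx; rewrite -[x]act1 (ip (1 : S)).
  have -> : act (\sum_j i j (p j (1 : S)) : S) x = \sum_j act (i j (p j (1 : S)) : S) x.
    exact: act_suml.
  apply: memv_suml => j _; apply/negPn/negP => xj; by apply: nj; exists j.
have lphi : linear (fun y : D j => act (i j y : S) x).
  by move=> c y z; rewrite linearP; apply: act_linl.
have ephi a (y : D j) : act (i j (act a y) : S) x = act a (act (i j y : S) x).
  by rewrite mhom_act; apply: actM.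
pose phi := mkhom lphi ephi; pose W := limg (linfun phi).
have phiW y : phi y \in W by rewrite -[phi y]lfunE memv_img ?memvf.
have Wphi w : w \in W -> exists y, w = phi y.
  by move=> /memv_imgP[y _ ->]; exists y; rewrite lfunE.
have inj_phi y : phi y \in (U + C)%VS -> y = 0.
  have [UCV0 UCVP UCVa] := stable_preim phi (stable_vspace sUC).
  have [V' V'E] := vspace_of_pred UCV0 UCVP.
  have sV' : stable V' by move=> a z /V'E Uz; apply/V'E/UCVa.
  have [_ simpD] := sD j; have [V0|VT] := simpD _ sV'; first by move/V'E; rewrite V0 memv0 => /eqP.
  by case/negP: xj; apply/(V'E (p j (1 : S))); rewrite VT memvf.
apply: (IH (C + W)%VS).
- rewrite -ltnS (leq_trans _ leC) // ltn_sub2l //.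
    rewrite ltn_neqAle dimvS ?subvf // andbT; apply: contra UCn => /eqP dC.
    have /eqP-> : C == fullv by rewrite eqEdim subvf dC /=.
    by rewrite eqEsubv subvf addvSr.
  rewrite ltn_neqAle dimvS ?addvSl // andbT; apply: contra xj => /eqP dC.
  have /eqP-> : C == (C + W)%VS by rewrite eqEdim addvSl dC /=.
  by apply: (subvP (addvSr U _)); apply: (subvP (addvSr C W)); apply: (phiW (p j (1 : S))).
- move=> a _ /memv_addP[y Cy [w /Wphi[z ->] ->]].
  by rewrite actDr -mhom_act memv_add ?sC.
apply/eqP; rewrite -subv0; apply/subvP => u /memv_capP[Uu /memv_addP[c Cc [w /Wphi[y ->] uE]]].
have y0 : y = 0.
  apply: inj_phi; have -> : phi y = u - c by rewrite uE addrC addKr.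
  by rewrite memv_add // memvN.
by rewrite -UC0 memv_cap Uu uE y0 linear0 addr0.
Qed.

(** Kernel and image both have complements. This replaces decompositions into simple modules: it
    turns maps to KP into maps from KP. *)
Lemma vn_regular M N (f : mhom M N) : exists g : mhom N M, forall x, f (g (f x)) = f x.
Proof.
have [k0 kP ka] := stable_ker f; have [U UE] := vspace_of_pred k0 kP.
have [i0 iP ia] := stable_im f; have [I IE] := vspace_of_pred i0 iP.
have sU : stable U by move=> a x /UE Ux; apply/UE/ka.
have sI : stable I by move=> a x /IE Ix; apply/IE/ia.
have [C [sC UC UC0]] := stable_complement sU.
have [C' [sC' IC IC0]] := stable_complement sI.
have IC0' y : y \in I -> y \in C' -> y = 0.
  by move=> Iy Cy; apply/eqP; rewrite -memv0 -IC0 memv_cap Iy.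
have [||||g gE] := mhom_of_rel (r := fun y m => m \in C /\ f m - y \in C').
- move=> y; have /memv_addP[_ /IE[x <-] [c Cc ->]] : y \in (I + C')%VS by rewrite IC memvf.
  have /memv_addP[u /UE fu [m Cm ->]] : x \in (U + C)%VS by rewrite UC memvf.
  by exists m; rewrite [f (u + m)]linearD fu add0r opprD addNKr memvN.
- move=> m [Cm]; rewrite subr0 => Cfm.
  have fm : f m = 0 by apply: IC0' Cfm; apply/IE; exists m.
  by apply/eqP; rewrite -memv0 -UC0 memv_cap Cm andbT; apply/UE.
- move=> c y y' m m' [Cm Cy] [Cm' Cy']; split; first by rewrite memvD ?memvZ.
  by rewrite linearP opprD addrACA -scalerBr memvD ?memvZ.
- by move=> a y m [Cm Cy]; rewrite sC // mhom_act -actBr sC'.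
exists g => x; have [_ Cx] := gE (f x); apply/eqP; rewrite -subr_eq0; apply/eqP.
by apply: IC0' Cx; apply/IE; exists (g (f x) - x); rewrite linearB.
Qed.

End Semisimple.

(** * Full and faithful tensor functors *)

Lemma naturally_iso_faithful (R : comNzRingType) (S S' : freeAlgType R) (E : functor S S') (G : functor S' S) (M N : fmod S) (f g : mhom M N) :
  naturally_iso (functor_comp G E) (functor_id S) ->
  fmap E f =1 fmap E g -> f =1 g.
Proof.
move=> [eta [beta nat]] efg y; have [h hK Kh] := beta M.
by rewrite -(Kh y) -[LHS](nat _ _ f) -[RHS](nat _ _ g) /= (fmap_ext (f := fmap E f) (g := fmap E g)).
Qed.

Section Equivalences.
Variables (R : comNzRingType) (S S' : freeAlgType R).

Lemma equivalence_faithful (E : functor S S') M N (f g : mhom M N) :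
  is_equivalence E -> fmap E f =1 fmap E g -> f =1 g.
Proof. by move=> [G [GE _]]; apply: naturally_iso_faithful GE. Qed.

Lemma equivalence_full (E : functor S S') M N (g : mhom (E M) (E N)) :
  is_equivalence E -> exists f : mhom M N, fmap E f =1 g.
Proof.
move=> [G [GE EG]]; have [eta [beta nat]] := GE.
have [h hK Kh] := beta M; have [h' hK' Kh'] := beta N.
have seta : surj (eta M) by move=> y; exists (h y).
have [e [eK Ke]] := bij_inverse (can_inj hK) seta.
pose f : mhom M N := mhom_comp (mhom_comp (eta N) (fmap G g)) e.
exists f; apply: (naturally_iso_faithful EG) => x.
apply: (can_inj hK'); rewrite -[LHS]/(eta N (fmap (functor_comp G E) f x)) nat.
by rewrite -[LHS]/(eta N (fmap G g (e (eta M x)))) eK.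
Qed.

End Equivalences.

Section TensorRegular.
Variables (F : fieldType) (S B : freeAlgType F) (T : bimod S B).

Definition tens_mul (w : tensor_mod T (regular B)) : lmod T :=
  tlift (M := regular B) (fun t b => ract t b : lmod T) w.

Lemma tens_mulE t (b : B) : tens_mul (tens (M := regular B) t b) = ract t b.
Proof.
apply: (tlift_tens (M := regular B) (b := fun t b => ract t b : lmod T)).
- by move=> m; apply: ract_linl.
- by move=> t'; apply: ract_linr.
- by move=> t' a m; rewrite /= ractM.
Qed.

Fact tens_mul_lin : linear tens_mul.
Proof. exact: tlift_linear. Qed.

Fact tens_mul_act s w : tens_mul (act s w) = act s (tens_mul w).
Proof.
move: w; apply: (tens_ext (T := T) (M := regular B)) => [c u v|c u v|t b].
- by rewrite act_linr tens_mul_lin.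
- by rewrite tens_mul_lin act_linr.
by rewrite /= tact_tens !tens_mulE lractA.
Qed.

Definition tensor_regular : mhom (tensor_mod T (regular B)) (lmod T) :=
  mkhom tens_mul_lin tens_mul_act.

Fact tens_one_lin : linear (fun t : lmod T => tens (M := regular B) t (1 : B) : tensor_mod T (regular B)).
Proof. by move=> c t t'; apply: tens_linl. Qed.

Fact tens_one_act s (t : lmod T) :
  tens (M := regular B) (act s t : T) (1 : B) = act s (tens (M := regular B) (t : T) (1 : B) : tensor_mod T (regular B)).
Proof. by rewrite /= tact_tens. Qed.

Definition tensor_regular_inv : mhom (lmod T) (tensor_mod T (regular B)) :=
  mkhom tens_one_lin tens_one_act.

Lemma tensor_regularK w : tensor_regular_inv (tensor_regular w) = w.
Proof.
move: w; apply: (tens_ext (T := T) (M := regular B)) => [c u v|//|t b].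
  by rewrite !linearP.
by rewrite /= tens_mulE tens_bal /= mulr1.
Qed.

Hypothesis eT : is_equivalence (tensor T).

(** T (x) B is T, so fullness of the functor produces a map from [M] to the regular module. *)
Lemma tensor_hom_regular (M : fmod B) (f : mhom (tensor_mod T M) (lmod T)) :
  exists g : mhom M (regular B), forall t m, f (tens t m) = ract t (g m : B).
Proof.
have [g gE] := equivalence_full (E := tensor T) (N := regular B) (mhom_comp tensor_regular_inv f) eT.
exists g => t m; have := gE (tens t m); rewrite /= tmap_tens => /(congr1 tens_mul).
by rewrite !tens_mulE ract1.
Qed.

Lemma tensor_end_full (f : mhom (lmod T) (lmod T)) : exists b : B, forall x, f x = ract (x : T) b.
Proof.
have [g gE] := tensor_hom_regular (mhom_comp f tensor_regular).
exists (g (1 : B)) => x; rewrite -gE -[RHS]/(f (tens_mul (tens (M := regular B) x (1 : B)))).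
by rewrite tens_mulE ract1.
Qed.

Lemma tensor_ract_faithful (M : fmod B) (g : mhom M (regular B)) :
  (forall t m, ract (t : T) (g m : B) = 0) -> forall m, g m = 0.
Proof.
move=> g0; apply: (equivalence_faithful (f := g) (g := mhom_zero _ _) eT).
apply: (tens_ext (T := T) (M := M)) => [c u v|c u v|t m]; try by rewrite linearP.
rewrite /= !tmap_tens /= (lin0 (@tens_linr _ _ _ T (regular B) t)).
by rewrite -[LHS]tensor_regularK /= tens_mulE g0 (lin0 tens_one_lin).
Qed.

End TensorRegular.

(** * The left module *)

Lemma lin_big (R : nzRingType) (V W : lmodType R) (f : V -> W) n (x : 'I_n -> V) :
  linear f -> f (\sum_i x i) = \sum_i f (x i).
Proof.
move=> lf; apply: (big_morph f _ (lin0 lf)) => y z.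
by have := lf 1 y z; rewrite !scale1r.
Qed.

Section GenericFibre.
Variables (l : nat) (O : idomainType) (K k : fieldType).
Variables (iK : {rmorphism O -> K}) (ik : {rmorphism O -> k}).
Hypothesis hO : modular_system l iK ik.

Lemma homK_scale_family (A : freeAlgType O) (M N : fmod A) n
    (f : 'I_n -> mhom (bc_mod iK M) (bc_mod iK N)) :
  exists2 c : O, c != 0 & exists g : 'I_n -> mhom M N,
    forall i (x : M), iK c *: f i (bcin iK x) = bcin iK (g i x).
Proof.
elim: n f => [|n IH] f.
  by exists 1; [exact: oner_neq0 | exists (fun i => mhom_zero M N); case].
have [c cn [g gE]] := IH (fun i => f (lift ord0 i)).
have [c0 c0n [g0 g0E]] := homK_scale hO (f ord0).
exists (c * c0); first by rewrite mulf_neq0.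
exists (fun i => if unlift ord0 i is Some j then mhom_scale c0 (g j) else mhom_scale c g0).
move=> i x; case: (unliftP ord0 i) => [j|] ->.
  by rewrite /= bcinZ -gE scalerA -rmorphM mulrC.
by rewrite /= bcinZ -g0E scalerA -rmorphM.
Qed.

Lemma bchomK_inj (A : freeAlgType O) (M N : fmod A) (f g : mhom M N) :
  bchom iK f =1 bchom iK g -> f =1 g.
Proof. by move=> fg x; apply: (bcinK_inj hO); rewrite -!bchom_in fg. Qed.

Lemma nonzeroK_scale (A : freeAlgType O) (M N : fmod A) (f : mhom (bc_mod iK M) (bc_mod iK N)) :
  nonzero f -> exists g : mhom M N, nonzero g.
Proof.
move=> [u fu]; have [c cn [g gE]] := homK_scale hO f.
exists g; apply: NNPP => ng; case/eqP: fu; move: u.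
apply: (bchom_ext (f := f) (g := mhom_zero _ _)) => x /=.
have [g0|//] := zero_or_nonzero g.
have := gE x; rewrite g0 bcin0 => /eqP; rewrite scaler_eq0 (iK_eq0 hO).
by rewrite (negPf cn) => /eqP.
Qed.

Section Standard.
Variables (A : freeAlgType O) (d : Order.disp_t) (L : finPOrderType d) (q : split_qh A L).
Local Notation Delta := (qh_std q).

Lemma stdK_end m (f : mhom (bc_std iK q m) (bc_std iK q m)) : exists c, forall x, f x = c *: x.
Proof.
have [c cn [g gE]] := homK_scale hO f; have [a aE] := qh_std_end g.
exists (iK a / iK c); apply: (bchom_ext (f := f) (g := mhom_scale _ (mhom_id _))) => x /=.
have icn : iK c != 0 by rewrite (iK_eq0 hO).
by apply: (scalerI icn); rewrite gE aE bcinZ scalerA mulrCA mulfV // mulr1.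
Qed.

Lemma coverK_hom m (C : std_cover q m) (f : mhom (bc_mod iK (covP C)) (bc_std iK q m)) :
  exists c, forall x, f x = c *: bchom iK (covq C) x.
Proof.
have [c cn [g gE]] := homK_scale hO f; have [a aE] := cover_hom_scal g.
exists (iK a / iK c).
apply: (bchom_ext (f := f) (g := mhom_scale _ (bchom iK (covq C)))) => x.
rewrite -[RHS]/(_ *: bchom iK (covq C) (bcin iK x)) bchom_in.
have icn : iK c != 0 by rewrite (iK_eq0 hO).
by apply: (scalerI icn); rewrite gE aE bcinZ scalerA mulrCA mulfV // mulr1.
Qed.

End Standard.

End GenericFibre.

(** * Maps from standard A-modules to T (x) P *)

Section LeftSide.
Variables (l : nat) (O : idomainType) (K k : fieldType).
Variables (iK : {rmorphism O -> K}) (ik : {rmorphism O -> k}).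
Hypothesis hO : modular_system l iK ik.
Variables (A B : freeAlgType O) (dL dU : Order.disp_t).
Variables (Lambda : finPOrderType dL) (Upsilon : finPOrderType dU).
Variables (qA : split_qh A Lambda) (qB : split_qh B Upsilon).
Hypothesis hB : semisimple_alg (bc iK B).
Variable T : bimod A B.
Local Notation KT := (bc_bimod iK T).
Hypothesis hE : is_equivalence (tensor KT).
Variable sigma : Upsilon -> Lambda.
Hypothesis sigma_bij : bijective sigma.
Hypothesis sigma_iso : forall u, iso (tensor KT (bc_std iK qB u)) (bc_std iK qA (sigma u)).
Hypothesis sigma_rev : forall u v, (u <= v)%O -> (sigma v <= sigma u)%O.
Variable u : Upsilon.
Variable C : std_cover qB u.
Local Notation P := (covP C).
Local Notation KP := (bc_mod iK P).
Local Notation Kq := (bchom iK (covq C)).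
Variables (n : nat) (x : 'I_n -> P) (e : 'I_n -> P -> B).
Hypothesis xe : is_dual_basis x e.

Let ee j i := e i (x j).

Lemma dual_basis_idempotent i j : \sum_h ee i h * ee h j = ee i j.
Proof.
have [le ae xE] := xe; rewrite /ee [x i in RHS]xE (lin_big _ (le j)).
by apply: eq_bigr => h _; rewrite ae.
Qed.

Let bclin_act j (a : bc iK B) (y : KP) : bclin iK (e j) (act a y) = a * bclin iK (e j) y :> bc iK B.
Proof. by have [_ ae _] := bc_dual_basis iK xe; apply: ae. Qed.

Let ract_tuple m (f : 'I_n -> mhom (qh_std qA m) (lmod T)) i y :
  tuple_fixed ee f ->
  bchom iK (f i) y = \sum_j ract (bchom iK (f j) y : KT) (bcin iK (ee j i)) :> KT.
Proof.
move=> ff; move: y; apply: (bc_ext (phi := iK) (V := qh_std qA m)) => [c a b|c a b|y].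
- by rewrite linearP.
- rewrite scaler_sumr -big_split; apply: eq_bigr => j _.
  by rewrite linearP; apply: (@ract_linl _ _ _ KT).
rewrite bchom_in ff bcin_sum; apply: eq_bigr => j _.
by rewrite -ract_bcin bchom_in.
Qed.

(* A tuple is a homomorphism to [KT (x) KP], hence comes from a homomorphism   *)
(* to [KP] as the functor [KT (x) -] is full.                                 *)
Lemma tuple_hom v (th : mhom (tensor_mod KT (bc_std iK qB v)) (bc_std iK qA (sigma v)))
    (f : 'I_n -> mhom (qh_std qA (sigma v)) (lmod T)) : tuple_fixed ee f ->
  exists psi : mhom (bc_std iK qB v) KP, forall i t y,
    bchom iK (f i) (th (tens t y)) = ract (t : KT) (bclin iK (e i) (psi y)) :> KT.
Proof.
move=> ff.
have ex i : exists g : mhom (bc_std iK qB v) (regular (bc iK B)), forall t y,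
    bchom iK (f i) (th (tens t y)) = ract (t : KT) (g y : bc iK B) :> KT.
  exact: (tensor_hom_regular hE (mhom_comp (bchom iK (f i)) th)).
pose g i := proj1_sig (constructive_indefinite_description _ (ex i)).
have gE i t y : bchom iK (f i) (th (tens t y)) = ract (t : KT) (g i y : bc iK B) :> KT.
  by move: t y; rewrite /g; case: constructive_indefinite_description.
have lpsi : linear (fun y => \sum_j act (g j y : bc iK B) (bcin iK (x j) : KP)).
  move=> c y z; rewrite scaler_sumr -big_split; apply: eq_bigr => j _ /=.
  by rewrite linearP; apply: (@act_linl _ _ KP).
have apsi a y : \sum_j act (g j (act a y) : bc iK B) (bcin iK (x j) : KP) =
    act a (\sum_j act (g j y : bc iK B) (bcin iK (x j) : KP)).
  by rewrite act_sumr; apply: eq_bigr => j _; rewrite mhom_act; apply: (@actM _ _ KP).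
exists (mkhom lpsi apsi) => i t y; rewrite ract_tuple // [mkhom _ _ _]/=.
rewrite (lin_big _ (@bclin_linear _ _ iK _ _ (e i))) [RHS](@ract_sumr _ _ _ KT).
apply: eq_bigr => j _; rewrite gE bclin_act bclin_in; last by case: xe.
exact: (esym (@ractM _ _ _ KT _ _ _)).
Qed.

Lemma tuple_hom_scale v (th : mhom (tensor_mod KT (bc_std iK qB v)) (bc_std iK qA (sigma v)))
    (f f' : 'I_n -> mhom (qh_std qA (sigma v)) (lmod T)) psi psi' c :
  surj th ->
  (forall i t y, bchom iK (f i) (th (tens t y)) = ract (t : KT) (bclin iK (e i) (psi y)) :> KT) ->
  (forall i t y, bchom iK (f' i) (th (tens t y)) = ract (t : KT) (bclin iK (e i) (psi' y)) :> KT) ->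
  (forall y, psi y = iK c *: psi' y) -> forall i y, f i y = c *: f' i y.
Proof.
move=> sth fE f'E pp i; apply: (bchomK_inj hO (g := mhom_scale c (f' i))) => z.
have -> : bchom iK (mhom_scale c (f' i)) z = iK c *: bchom iK (f' i) z.
  move: z; apply: (bchom_ext (f := bchom iK (mhom_scale c (f' i))) (g := mhom_scale (iK c) (bchom iK (f' i)))) => z.
  by rewrite bchom_in -[RHS]/(_ *: bchom iK (f' i) (bcin iK z)) bchom_in -bcinZ.
have [w <-] := sth z; move: w; apply: (tens_ext (T := KT)) => [b w w'|b w w'|t y].
- by rewrite !linearP.
- by rewrite !linearP /= !scalerA mulrC.
rewrite fE f'E pp.
have -> : bclin iK (e i) (iK c *: psi' y) = iK c *: bclin iK (e i) (psi' y).
  have := @bclin_linear _ _ iK _ _ (e i) (iK c) (psi' y) 0.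
  by rewrite !addr0 (lin0 (@bclin_linear _ _ iK _ _ (e i))) addr0.
have := @ract_linr _ _ _ KT t (iK c) (bclin iK (e i) (psi' y)) 0.
by rewrite !addr0 (lin0 (@ract_linr _ _ _ KT t)) addr0.
Qed.

(** The tuple yields a nonzero map from K Delta(v) to KP, where m = sigma v. By semisimplicity there
    is one in the opposite direction, whence u <= v. *)
Lemma left_tuple_le m (f : 'I_n -> mhom (qh_std qA m) (lmod T)) :
  tuple_fixed ee f -> (exists i, nonzero (f i)) -> (m <= sigma u)%O.
Proof.
have [tau sK Ks] := sigma_bij; move: f; rewrite -(Ks m); move: (tau m) => v f ff [i [y fy]].
have [th [injth sth]] := iso_inj_surj (sigma_iso v).
have [psi psiE] := tuple_hom th ff; apply: sigma_rev.
have [chi chiE] := vn_regular hB psi.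
have [g ng] : exists g : mhom P (qh_std qB v), nonzero g; last exact: cover_hom_le ng.
apply: (nonzeroK_scale hO (f := chi)).
have [chi0|//] := zero_or_nonzero chi.
have psi0 z : psi z = 0 by rewrite -chiE chi0 linear0.
case/eqP: fy; rewrite (tuple_hom_scale sth psiE psiE (c := 0)) ?scale0r // => z.
by rewrite psi0 scaler0.
Qed.

(** By semisimplicity psi = psi chi psi for some [chi], which is a multiple of [Kq]. *)
Lemma section_unique (psi : mhom (bc_std iK qB u) KP) :
  (forall y, Kq (psi y) = 0) -> forall y, psi y = 0.
Proof.
move=> qpsi y; have [chi chiE] := vn_regular hB psi.
have [c cE] := coverK_hom hO chi.
by rewrite -chiE cE qpsi scaler0 linear0.
Qed.

(** By [section_unique], a map from K Delta(u) to KP is determined by its composite with [Kq], which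
    is a scalar. *)
Lemma left_tuple_prop (f g : 'I_n -> mhom (qh_std qA (sigma u)) (lmod T)) :
  tuple_fixed ee f -> tuple_fixed ee g -> exists c,
    (forall i y, f i y = c *: g i y) \/ (forall i y, g i y = c *: f i y).
Proof.
move=> ff fg; have [th [injth sth]] := iso_inj_surj (sigma_iso u).
have [psi psiE] := tuple_hom th ff; have [phi phiE] := tuple_hom th fg.
have [a aE] := stdK_end hO (mhom_comp Kq psi); have [b bE] := stdK_end hO (mhom_comp Kq phi).
have ab y : b *: psi y = a *: phi y.
  have : mhom_sub (mhom_scale b psi) (mhom_scale a phi) y = 0.
    apply: section_unique => z; rewrite mhom_subE linearB.
    rewrite [Kq (mhom_scale b psi z)]mhomZ [Kq (mhom_scale a phi z)]mhomZ.
    have Ea : Kq (psi z) = a *: z := aE z; have Eb : Kq (phi z) = b *: z := bE z.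
    by rewrite Ea Eb !scalerA mulrC subrr.
  by rewrite mhom_subE => /eqP; rewrite subr_eq0 => /eqP.
have [a0|a0] := eqVneq a 0.
  exists 0; left; apply: tuple_hom_scale sth psiE phiE _ => y.
  rewrite rmorph0 scale0r; apply: section_unique => z.
  by have /= -> := aE z; rewrite a0 scale0r.
(* The ratio or its inverse lies in [O], so one of the tuples is an integral multiple of the
   other. *)
have [[c cE]|[c cE]] := frac_total hO (b / a).
  exists c; right; apply: tuple_hom_scale sth phiE psiE _ => y.
  by rewrite -cE; apply: (scalerI a0); rewrite scalerA mulrCA mulfV // mulr1 ab.
exists c; left; apply: tuple_hom_scale sth psiE phiE _ => y.
have bE' : a = iK c * b by apply: (mulIf (invr_neq0 a0)); rewrite mulfV // -mulrA.
have b0 : b != 0 by apply: contra a0 => /eqP b0; rewrite bE' b0 mulr0.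
by apply: (scalerI b0); rewrite ab bE' scalerA mulrC.
Qed.

(** Semisimplicity provides a section of [Kq]. Its coordinates in the dual basis, tensored with KT
    and cleared of denominators, form the tuple, which is nonzero because the tensor functor is
    faithful. *)
Lemma left_tuple_exists : exists2 f : 'I_n -> mhom (qh_std qA (sigma u)) (lmod T),
  tuple_fixed ee f & exists i, nonzero (f i).
Proof.
have [th [injth sth]] := iso_inj_surj (sigma_iso u).
have [th' [thK thK']] := bij_inverse injth sth.
have [_ sq _] := bc_short_exact iK (cov_exact C).
have [g gE] := vn_regular hB Kq.
have qg y : Kq (g y) = y by have [z <-] := sq y; rewrite gE.
have [le ae _] := bc_dual_basis iK xe.
have lh i : linear (fun y => bclin iK (e i) (g y) : regular (bc iK B)).
  by move=> c y z; rewrite linearP; apply: le.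
have ah i a y : bclin iK (e i) (g (act a y)) = act a (bclin iK (e i) (g y) : regular (bc iK B)).
  by rewrite mhom_act; apply: ae.
pose h i := mkhom (lh i) (ah i).
have [f' f'E] : exists f' : 'I_n -> mhom (bc_std iK qA (sigma u)) (bc_mod iK (lmod T)),
    forall i t y, f' i (th (tens t y)) = ract (t : KT) (bclin iK (e i) (g y)) :> KT.
  exists (fun i => mhom_comp (mhom_comp (tensor_regular KT) (tensor_map KT (h i))) th').
  by move=> i t y; rewrite /= thK tmap_tens tens_mulE.
have [c cn [f fE]] := homK_scale_family hO f'.
have icn : iK c != 0 by rewrite (iK_eq0 hO).
exists f.
  move=> i y; apply: (bcinK_inj hO); rewrite -[LHS]fE bcin_sum.
  under eq_bigr => j _ do rewrite -ract_bcin.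
  have [w wE] := sth (bcin iK y).
  have fix_w : f' i (th w) = \sum_j ract (f' j (th w) : KT) (bcin iK (ee j i)) :> KT.
    move: {wE} w; apply: (tens_ext (T := KT)) => [a w w'|a w w'|t z].
    - by rewrite !linearP.
    - rewrite scaler_sumr -big_split; apply: eq_bigr => j _.
      by rewrite !linearP; apply: (@ract_linl _ _ _ KT).
    have step j : ract (f' j (th (tens t z)) : KT) (bcin iK (ee j i)) =
        ract (t : KT) (bclin iK (e j) (g z) * bcin iK (ee j i)).
      by rewrite f'E; apply: (esym (@ractM _ _ _ KT _ _ _)).
    rewrite f'E; transitivity (\sum_j ract (t : KT) (bclin iK (e j) (g z) * bcin iK (ee j i))).
      rewrite -[RHS](@ract_sumr _ _ _ KT); congr ract.
      have [_ _ xE] := bc_dual_basis iK xe.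
      rewrite [g z in LHS]xE (lin_big _ (@bclin_linear _ _ iK _ _ (e i))).
      by apply: eq_bigr => j _; rewrite bclin_act bclin_in //; case: xe.
    by apply: eq_bigr => j _; rewrite step.
  rewrite -wE fix_w scaler_sumr; apply: eq_bigr => j _.
  have := fE j y; rewrite -wE => <-.
  have := @ract_linl _ _ _ KT (bcin iK (ee j i)) (iK c) (f' j (th w)) 0.
  by rewrite !addr0 (lin0 (@ract_linl _ _ _ KT _)) addr0 => ->.
apply: NNPP => nf.
have [D0|[y y0]] := zero_mod_or (bc_std iK qB u).
  by case: (bc_nonzero_mod (phi := iK) (@qh_std_neq0 _ _ _ _ qB u)).
case/eqP: y0; rewrite -(qg y); have [_ _ xE] := bc_dual_basis iK xe.
rewrite (xE (g y)) big1 ?linear0 // => i _.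
suff -> : bclin iK (e i) (g y) = 0 by apply: (@act0l _ _ KP).
apply: (tensor_ract_faithful hE (g := h i)) => t z.
rewrite -[LHS]/(ract t (bclin iK (e i) (g z))) -f'E; move: (th _).
apply: (bchom_ext (f := f' i) (g := mhom_zero _ _)) => z'.
have [f0|nfi] := zero_or_nonzero (f i); last by case: nf; exists i.
by apply: (scalerI icn); rewrite [LHS]fE f0 bcin0 /= scaler0.
Qed.

End LeftSide.

(** * The dual bimodule and the right module *)

Section DualBimodule.
Variables (R : comNzRingType).

Definition dot (V : vectType R) (x y : V) : R := \sum_i v2r x 0 i * v2r y 0 i.

Lemma dot_linl (V : vectType R) c (x x' y : V) : dot (c *: x + x') y = c * dot x y + dot x' y.
Proof.
rewrite /dot mulr_sumr -big_split; apply: eq_bigr => i _ /=.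
by rewrite linearP !mxE mulrDl mulrA.
Qed.

Lemma dot_linr (V : vectType R) c (x y y' : V) : dot x (c *: y + y') = c * dot x y + dot x y'.
Proof.
rewrite /dot mulr_sumr -big_split; apply: eq_bigr => i _ /=.
by rewrite linearP !mxE mulrDr mulrCA.
Qed.

Lemma dot_basis (V : vectType R) (x : V) i : dot x (bbasis i) = v2r x 0 i.
Proof.
rewrite /dot /bbasis r2vK (bigD1 i) //= big1 ?addr0 => [|j ji].
  by rewrite mxE !eqxx mulr1.
by rewrite mxE eqxx (negPf ji) mulr0.
Qed.

Lemma dot_ext (V : vectType R) (x y : V) : (forall t, dot x t = dot y t) -> x = y.
Proof.
move=> xy; apply: (can_inj (@v2rK _ _)); apply/rowP => i.
by rewrite -!dot_basis xy.
Qed.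

Definition transpose (V : vectType R) (f : V -> V) (x : V) : V :=
  r2v (\row_i dot x (f (bbasis i))).

Lemma transposeE (V : vectType R) (f : V -> V) x y : linear f ->
  dot (transpose f x) y = dot x (f y).
Proof.
move=> lf; move: y; apply: (basis_ext (W := R^o)) => [c y z|c y z|i].
- exact: dot_linr.
- by rewrite lf; apply: dot_linr.
by rewrite dot_basis /transpose r2vK mxE.
Qed.

Variables (A B : freeAlgType R) (T : bimod A B).

Definition star_lact (b : B) (x : T) : T := transpose (fun t => ract t b) x.
Definition star_ract (x : T) (a : A) : T := transpose (fun t => lact a t) x.

Lemma star_lactE b (x t : T) : dot (star_lact b x) t = dot x (ract t b).
Proof. exact: transposeE (@ract_linl _ _ _ T b). Qed.
Lemma star_ractE a (x t : T) : dot (star_ract x a) t = dot x (lact a t).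
Proof. exact: transposeE (@lact_linr _ _ _ T a). Qed.

(* [Hom_R(T, R)], identified with [T] by means of the basis dual to the chosen *)
(* one.                                                                       *)
Definition star : bimod B A.
Proof.
exists (bcar T : vectType R) star_lact star_ract => [x c a b|a c x y|x|a b x|a c x y|x c a b|x|a b x|a x b];
  apply: dot_ext => t;
  rewrite ?dot_linl ?star_lactE ?star_ractE ?dot_linl ?star_lactE ?star_ractE //.
- by rewrite ract_linr dot_linr.
- by rewrite ract1.
- by rewrite ractM.
- by rewrite lact_linl dot_linr.
- by rewrite lact1.
- by rewrite lactM.
- by rewrite lractA.
Defined.

End DualBimodule.

Section DualBaseChange.
Variables (R F : comNzRingType) (phi : {rmorphism R -> F}).

Definition bcdot (V : vectType R) (u v : bc phi V) : F := \sum_i u 0 i * v 0 i.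

Lemma bcdot_in (V : vectType R) (x y : V) : bcdot (bcin phi x) (bcin phi y) = phi (dot x y).
Proof. by rewrite /bcdot /dot rmorph_sum; apply: eq_bigr => i _; rewrite !mxE rmorphM. Qed.

Lemma bcdot_linl (V : vectType R) c (x x' y : bc phi V) :
  bcdot (c *: x + x') y = c * bcdot x y + bcdot x' y.
Proof.
rewrite /bcdot mulr_sumr -big_split; apply: eq_bigr => i _ /=.
by rewrite !mxE mulrDl mulrA.
Qed.

Lemma bcdot_linr (V : vectType R) c (x y y' : bc phi V) :
  bcdot x (c *: y + y') = c * bcdot x y + bcdot x y'.
Proof.
rewrite /bcdot mulr_sumr -big_split; apply: eq_bigr => i _ /=.
by rewrite !mxE mulrDr mulrCA.
Qed.

Lemma bcdot_delta (V : vectType R) (x : bc phi V) i : bcdot x (delta_mx 0 i) = x 0 i.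
Proof.
rewrite /bcdot (bigD1 i) //= big1 ?addr0 => [|j ji].
  by rewrite mxE !eqxx mulr1.
by rewrite mxE eqxx (negPf ji) mulr0.
Qed.

Lemma bcdot_ext (V : vectType R) (x y : bc phi V) : (forall t, bcdot x t = bcdot y t) -> x = y.
Proof. by move=> xy; apply/rowP => i; rewrite -!bcdot_delta xy. Qed.

Variables (A B : freeAlgType R) (T : bimod A B).
Local Notation FT := (bc_bimod phi T).
Local Notation FS := (bc_bimod phi (star T)).

Lemma bcdot_lact b (x : FS) (t : FT) : bcdot (V := T) (lact b x) t = bcdot (V := T) x (ract t b).
Proof.
move: b; apply: (bc_ext (phi := phi) (V := B) (W := F^o)) => [c b b'|c b b'|b].
- by rewrite (@lact_linl _ _ _ FS); apply: (bcdot_linl (V := T)).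
- by rewrite (@ract_linr _ _ _ FT); apply: (bcdot_linr (V := T)).
move: x; apply: (bc_ext (phi := phi) (V := T) (W := F^o)) => [c x y|c x y|x].
- by rewrite (@lact_linr _ _ _ FS); apply: (bcdot_linl (V := T)).
- exact: (bcdot_linl (V := T)).
move: t; apply: (bc_ext (phi := phi) (V := T) (W := F^o)) => [c s t|c s t|t].
- exact: (bcdot_linr (V := T)).
- by rewrite (@ract_linl _ _ _ FT); apply: (bcdot_linr (V := T)).
rewrite ract_bcin -[lact _ _]/(lact (bcin phi b) (bcin phi (x : star T) : FS)) lact_bcin.
by rewrite !(bcdot_in (V := T)) /= star_lactE.
Qed.

Lemma bcdot_ract a (x : FS) (t : FT) : bcdot (V := T) (ract x a) t = bcdot (V := T) x (lact a t).
Proof.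
move: a; apply: (bc_ext (phi := phi) (V := A) (W := F^o)) => [c b b'|c b b'|b].
- by rewrite (@ract_linr _ _ _ FS); apply: (bcdot_linl (V := T)).
- by rewrite (@lact_linl _ _ _ FT); apply: (bcdot_linr (V := T)).
move: x; apply: (bc_ext (phi := phi) (V := T) (W := F^o)) => [c x y|c x y|x].
- by rewrite (@ract_linl _ _ _ FS); apply: (bcdot_linl (V := T)).
- exact: (bcdot_linl (V := T)).
move: t; apply: (bc_ext (phi := phi) (V := T) (W := F^o)) => [c s t|c s t|t].
- exact: (bcdot_linr (V := T)).
- by rewrite (@lact_linr _ _ _ FT); apply: (bcdot_linr (V := T)).
rewrite lact_bcin -[ract _ _]/(ract (bcin phi (x : star T) : FS) (bcin phi b)) ract_bcin.
by rewrite !(bcdot_in (V := T)) /= star_ractE.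
Qed.

End DualBaseChange.

(** * Maps from standard B-modules to the dual bimodule, as functionals *)

Section RightSide.
Variables (l : nat) (O : idomainType) (K k : fieldType).
Variables (iK : {rmorphism O -> K}) (ik : {rmorphism O -> k}).
Hypothesis hO : modular_system l iK ik.
Variables (A B : freeAlgType O) (dL dU : Order.disp_t).
Variables (Lambda : finPOrderType dL) (Upsilon : finPOrderType dU).
Variables (qA : split_qh A Lambda) (qB : split_qh B Upsilon).
Variable T : bimod A B.
Local Notation KT := (bc_bimod iK T).
Local Notation KS := (bc_bimod iK (star T)).
Local Notation kdot := (bcdot (phi := iK) (V := T)).
Variable sigma : Upsilon -> Lambda.
Hypothesis sigma_iso : forall u, iso (tensor KT (bc_std iK qB u)) (bc_std iK qA (sigma u)).
Hypothesis sigma_rev : forall u v, (sigma u <= sigma v)%O -> (v <= u)%O.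
Variable u : Upsilon.
Variable C : std_cover qA (sigma u).
Local Notation P := (covP C).
Local Notation KP := (bc_mod iK P).
Local Notation Kq := (bchom iK (covq C)).
Variables (n : nat) (x : 'I_n -> P) (e : 'I_n -> P -> A).
Hypothesis xe : is_dual_basis x e.

Let ee j i := e i (x j).

(* [Hom_KB(M, Hom_K(KT, K))] is the dual of the space [KT (x) M].              *)
Lemma tuple_functional v (th : mhom (tensor_mod KT (bc_std iK qB v)) (bc_std iK qA (sigma v)))
    (f : mhom (qh_std qB v) (lmod (star T))) : injective th -> surj th ->
  exists2 phi : bc_std iK qA (sigma v) -> K^o, linear phi &
    forall t y, phi (th (tens t y)) = kdot (bchom iK f y) t.
Proof.
move=> injth sth; have [th' [thK _]] := bij_inverse injth sth.
pose b (t : KT) (y : bc_std iK qB v) : K^o := kdot (bchom iK f y) t.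
have bl y : linear (b^~ y) by move=> c t t'; apply: (bcdot_linr (V := T)).
have br t : linear (b t).
  by move=> c y y'; rewrite /b linearP; apply: (bcdot_linl (V := T)).
have bal t a y : b (ract t a) y = b t (act a y).
  by rewrite /b mhom_act -bcdot_lact.
exists (fun w => tlift b (th' w)) => [c w w'|t y]; first by rewrite linearP; apply: tlift_linear.
by rewrite thK tlift_tens.
Qed.

Lemma functional_scale v (th : mhom (tensor_mod KT (bc_std iK qB v)) (bc_std iK qA (sigma v)))
    (f g : mhom (qh_std qB v) (lmod (star T))) (phi psi : bc_std iK qA (sigma v) -> K^o) c :
  (forall t y, phi (th (tens t y)) = kdot (bchom iK f y) t) ->
  (forall t y, psi (th (tens t y)) = kdot (bchom iK g y) t) ->
  (forall w, phi w = iK c * psi w) -> forall y, f y = c *: g y.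
Proof.
move=> fE gE pp y; apply: (bcinK_inj hO); apply: (bcdot_ext (V := T)) => t.
rewrite -[bcin iK (f y)]bchom_in -fE pp gE bchom_in.
have -> : bcin iK (c *: g y) = iK c *: bcin iK (g y) by apply: bcinZ.
have := bcdot_linl (V := T) (iK c) (bcin iK (g y)) 0 t.
rewrite addr0 => ->; rewrite -[LHS]addr0; congr (_ + _).
by rewrite /bcdot big1 // => i _; rewrite mxE mul0r.
Qed.

Lemma functional_tuple v (th : mhom (tensor_mod KT (bc_std iK qB v)) (bc_std iK qA (sigma v)))
    (f : 'I_n -> mhom (qh_std qB v) (lmod (star T))) (phi : 'I_n -> bc_std iK qA (sigma v) -> K^o) :
  surj th -> (forall i, linear (phi i)) ->
  (forall i t y, phi i (th (tens t y)) = kdot (bchom iK (f i) y) t) ->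
  tuple_fixed ee f -> forall i w, phi i w = \sum_j phi j (act (bcin iK (ee j i)) w).
Proof.
move=> sth lphi phiE ff i w; have [w' <-] := sth w; move: {w} w'.
apply: (tens_ext (T := KT)) => [c a b|c a b|t y].
- by rewrite linearP lphi.
- rewrite scaler_sumr -big_split; apply: eq_bigr => j _.
  by rewrite linearP act_linr lphi.
rewrite phiE.
have step j : phi j (act (bcin iK (ee j i)) (th (tens t y))) =
    kdot (ract (bchom iK (f j) y : KS) (bcin iK (ee j i))) t.
  by rewrite -mhom_act /= tact_tens phiE bcdot_ract.
rewrite (eq_bigr _ (fun j _ => step j)).
have dot_sum (z : 'I_n -> KS) : kdot (\sum_j z j) t = \sum_j kdot (z j) t.
  apply: (lin_big (W := K^o) z (f := fun w => kdot w t)) => c a b.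
  exact: (bcdot_linl (V := T)).
rewrite -dot_sum; congr (kdot _ t); move: y {step}.
apply: (bc_ext (phi := iK) (V := qh_std qB v)) => [c a b|c a b|y].
- by rewrite linearP.
- rewrite scaler_sumr -big_split; apply: eq_bigr => j _.
  by rewrite linearP; apply: (@ract_linl _ _ _ KS).
rewrite bchom_in ff bcin_sum; apply: eq_bigr => j _.
by rewrite -[RHS]/(ract (_ : KS) _) bchom_in; apply: (esym (ract_bcin (T := star T) _ _ _)).
Qed.

(** A nonzero tuple of functionals requires an entry e_i(x_j) acting nontrivially on some [w] in
    Delta(sigma v). Then z -> e_i(z) w is a nonzero map from [P], so sigma u <= sigma v. *)
Lemma right_tuple_le v (f : 'I_n -> mhom (qh_std qB v) (lmod (star T))) :
  tuple_fixed ee f -> (exists i, nonzero (f i)) -> (v <= u)%O.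
Proof.
move=> ff [i [y fy]]; apply: sigma_rev.
have [th [injth sth]] := iso_inj_surj (sigma_iso v).
have [phi phiE] : exists phi : 'I_n -> bc_std iK qA (sigma v) -> K^o,
    forall i, linear (phi i) /\ forall t y, phi i (th (tens t y)) = kdot (bchom iK (f i) y) t.
  have ex j : exists p : bc_std iK qA (sigma v) -> K^o,
      linear p /\ forall t y, p (th (tens t y)) = kdot (bchom iK (f j) y) t.
    by have [p lp pE] := tuple_functional (f j) injth sth; exists p.
  exists (fun j => proj1_sig (constructive_indefinite_description _ (ex j))) => j.
  by case: constructive_indefinite_description.
have lphi j : linear (phi j) by case: (phiE j).
have phiT := functional_tuple sth lphi (fun j => (phiE j).2) ff.
have [j [w jw]] : exists j w, act (ee j i) w != 0 :> qh_std qA (sigma v).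
  apply: NNPP => nj; case/eqP: fy.
  rewrite (functional_scale (g := f i) (c := 0) (phiE i).2 (phiE i).2) ?scale0r // => w.
  rewrite rmorph0 mul0r phiT big1 // => j _.
  rewrite -[RHS](lin0 (lphi j)); congr phi; move: w.
  apply: (bc_ext (phi := iK) (V := qh_std qA (sigma v))) => [c a b|c a b|w].
  - by rewrite act_linr.
  - by rewrite scaler0 addr0.
  rewrite bc_act_in; have [->|jw] := eqVneq (act (ee j i) w) 0; first by rewrite bcin0.
  by case: nj; exists j, w.
have [le ae _] := xe.
have lh : linear (fun z : P => act (e i z) w) by move=> c z z'; rewrite le act_linl.
have ah a (z : P) : act (e i (act a z)) w = act a (act (e i z) w) by rewrite ae actM.
by apply: (@cover_hom_le _ _ _ _ _ _ C _ (mkhom lh ah)); exists (x j).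
Qed.

(** z -> e_i(z) w is a homomorphism from KP to K Delta(sigma u), and these are the multiples of
    [Kq]. *)
Let eigen (w : bc_std iK qA (sigma u)) i : exists c : K, forall z : KP,
  act (bclin iK (e i) z) w = c *: Kq z.
Proof.
have [le ae _] := bc_dual_basis iK xe.
have lh : linear (fun z : KP => act (bclin iK (e i) z) w).
  by move=> c z z'; rewrite le; apply: (@act_linl _ _ (bc_std iK qA (sigma u))).
have ah a (z : KP) : act (bclin iK (e i) (act a z)) w = act a (act (bclin iK (e i) z) w).
  by rewrite ae; apply: (@actM _ _ (bc_std iK qA (sigma u))).
exact: (coverK_hom hO (mkhom lh ah)).
Qed.

(** By [eigen], phi_i(w) is the scalar attached to [i] and [w] times s, the sum of the phi_j(Kq
    x_j). The whole tuple is thus determined by the single scalar s. *)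
Lemma right_tuple_prop (f g : 'I_n -> mhom (qh_std qB u) (lmod (star T))) :
  tuple_fixed ee f -> tuple_fixed ee g -> exists c,
    (forall i y, f i y = c *: g i y) \/ (forall i y, g i y = c *: f i y).
Proof.
move=> ff fg; have [th [injth sth]] := iso_inj_surj (sigma_iso u).
have functional (h : 'I_n -> mhom (qh_std qB u) (lmod (star T))) : tuple_fixed ee h ->
    exists (phi : 'I_n -> bc_std iK qA (sigma u) -> K^o) (s : K),
      (forall i t y, phi i (th (tens t y)) = kdot (bchom iK (h i) y) t)
      /\ forall w i c, (forall z : KP, act (bclin iK (e i) z) w = c *: Kq z) -> phi i w = c * s.
  move=> fh.
  have ex j : exists p : bc_std iK qA (sigma u) -> K^o,
      linear p /\ forall t y, p (th (tens t y)) = kdot (bchom iK (h j) y) t.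
    by have [p lp pE] := tuple_functional (h j) injth sth; exists p.
  pose phi j := proj1_sig (constructive_indefinite_description _ (ex j)).
  have phiE j : linear (phi j) /\ forall t y, phi j (th (tens t y)) = kdot (bchom iK (h j) y) t.
    by rewrite /phi; case: constructive_indefinite_description.
  have lphi j : linear (phi j) by case: (phiE j).
  have phiT := functional_tuple sth lphi (fun j => (phiE j).2) fh.
  exists phi, (\sum_j phi j (Kq (bcin iK (x j)))); split; first by move=> i; case: (phiE i).
  move=> w i c cE; rewrite phiT mulr_sumr; apply: eq_bigr => j _.
  have -> : bcin iK (ee j i) = bclin iK (e i) (bcin iK (x j)) by rewrite bclin_in; case: xe.
  rewrite cE; have := lphi j c (Kq (bcin iK (x j))) 0.
  by rewrite !addr0 (lin0 (lphi j)) addr0.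
have [phi [s [phiE phiS]]] := functional f ff; have [psi [t [psiE psiS]]] := functional g fg.
have [s0|s0] := eqVneq s 0.
  exists 0; left => i; apply: functional_scale (phiE i) (psiE i) _ => w.
  by have [c cE] := eigen w i; rewrite (phiS _ _ _ cE) s0 mulr0 rmorph0 mul0r.
have [[a aE]|[a aE]] := frac_total hO (t / s).
  exists a; right => i; apply: functional_scale (psiE i) (phiE i) _ => w.
  have [c cE] := eigen w i; rewrite (phiS _ _ _ cE) (psiS _ _ _ cE) -aE mulrCA.
  by rewrite divfK // mulrC.
exists a; left => i; apply: functional_scale (phiE i) (psiE i) _ => w.
have [c cE] := eigen w i; rewrite (phiS _ _ _ cE) (psiS _ _ _ cE) mulrCA; congr (_ * _).
by apply: (mulIf (invr_neq0 s0)); rewrite mulfV // -mulrA.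
Qed.

(** The functionals are w -> psi(e_i(x_j0) w), where psi does not vanish on Kq x_j0. They are fixed
    because the matrix is idempotent, and not all zero because Kq x_j0 is the sum of the e_i(x_j0)
    Kq x_i. *)
Lemma right_tuple_exists : exists2 f : 'I_n -> mhom (qh_std qB u) (lmod (star T)),
  tuple_fixed ee f & exists i, nonzero (f i).
Proof.
have [th [injth sth]] := iso_inj_surj (sigma_iso u).
have [th' [thK thK']] := bij_inverse injth sth.
have [_ sq _] := bc_short_exact iK (cov_exact C).
have [_ _ xE] := bc_dual_basis iK xe.
have [j0 zj0] : exists j, Kq (bcin iK (x j)) != 0.
  apply: NNPP => nj; apply: (bc_nonzero_mod (phi := iK) (@qh_std_neq0 _ _ _ _ qA (sigma u))) => w.
  have [z <-] := sq w; rewrite (xE z) linear_sum big1 // => j _.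
  rewrite mhom_act; have [->|zj] := eqVneq (Kq (bcin iK (x j))) 0; first by rewrite act0r.
  by case: nj; exists j.
have [psi lpsi psi0] : exists2 psi : bc_std iK qA (sigma u) -> K^o, linear psi &
    psi (Kq (bcin iK (x j0))) != 0.
  have [h zh] : exists h, (Kq (bcin iK (x j0)) : 'rV_(dim (qh_std qA (sigma u)))) 0 h != 0.
    apply: NNPP => nh; case/eqP: zj0; apply/rowP => h; rewrite [RHS]mxE.
    by apply/eqP; case: eqP => // /eqP zh; case: nh; exists h.
  exists (fun w : bc_std iK qA (sigma u) => (w : 'rV_(dim (qh_std qA (sigma u)))) 0 h : K^o) => //.
  by move=> c w w'; rewrite !mxE.
pose phi i (w : bc_std iK qA (sigma u)) : K^o := psi (act (bcin iK (ee j0 i)) w).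
have lphi i : linear (phi i) by move=> c w w'; rewrite /phi act_linr lpsi.
(* The vector representing, in the standard pairing, the functional t -> phi_i(t (x) y) on KT. *)
pose f0 i (y : bc_std iK qB u) : KS := \row_h phi i (th (tens (delta_mx 0 h : KT) y)).
have f0E i y (t : KT) : kdot (f0 i y) t = phi i (th (tens t y)).
  move: t; apply: (bc_ext (phi := iK) (V := T) (W := K^o)) => [c t t'|c t t'|t].
  - exact: (bcdot_linr (V := T)).
  - by rewrite tens_linl linearP lphi.
  rewrite [t]bbasis_sum bcin_sum.
  rewrite (lin_big (W := K^o) _ (f := kdot (f0 i y))); last first.
    by move=> c a b; apply: (bcdot_linr (V := T)).
  rewrite (lin_big (W := K^o) _ (f := fun t : KT => phi i (th (tens t y)))); last first.
    by move=> c a b; rewrite tens_linl linearP lphi.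
  apply: eq_bigr => h _; rewrite bcinZ bcin_basis.
  have -> : iK (v2r t 0 h) *: delta_mx 0 h = iK (v2r t 0 h) *: delta_mx 0 h + 0 :> KT by rewrite addr0.
  rewrite (bcdot_linr (V := T)) (bcdot_delta (V := T)) mxE tens_linl linearP lphi; congr (_ + _).
  rewrite (lin0 (@tens_linl _ _ _ KT _ y)) linear0 (lin0 (lphi i)).
  by rewrite /bcdot big1 // => h' _; rewrite [X in _ * X]mxE mulr0.
have lf0 i : linear (f0 i).
  move=> c y y'; apply: (bcdot_ext (V := T)) => t.
  by rewrite (bcdot_linl (V := T)) !f0E tens_linr linearP lphi.
have af0 i b y : f0 i (act b y) = lact b (f0 i y).
  by apply: (bcdot_ext (V := T)) => t; rewrite bcdot_lact !f0E tens_bal.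
have [f1 f1E] : exists f1 : 'I_n -> mhom (bc_std iK qB u) (bc_mod iK (lmod (star T))),
    forall i y, f1 i y = f0 i y.
  by exists (fun i => @mkhom _ _ (bc_std iK qB u) (bc_mod iK (lmod (star T))) (f0 i) (lf0 i) (af0 i)).
have [c cn [f fE]] := homK_scale_family hO f1.
have icn : iK c != 0 by rewrite (iK_eq0 hO).
have idem i j w : \sum_h act (bcin iK (ee i h)) (act (bcin iK (ee h j)) w) =
    act (bcin iK (ee i j)) w :> bc_std iK qA (sigma u).
  have <- : \sum_h ee i h * ee h j = ee i j by apply: (dual_basis_idempotent xe).
  rewrite bcin_sum.
  rewrite [RHS](act_suml (M := bc_std iK qA (sigma u))); apply: eq_bigr => h _.
  by rewrite -bcmul_in; apply: (esym (@actM _ _ (bc_std iK qA (sigma u)) _ _ _)).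
have dot_sum (z : 'I_n -> KS) t : kdot (\sum_j z j) t = \sum_j kdot (z j) t.
  apply: (lin_big (W := K^o) z (f := fun w => kdot w t)) => a b b'.
  exact: (bcdot_linl (V := T)).
exists f.
  move=> i y; apply: (bcinK_inj hO); rewrite -[LHS]fE bcin_sum.
  have step j : bcin iK (ract (f j y : star T) (ee j i)) =
      iK c *: ract (f1 j (bcin iK y) : KS) (bcin iK (ee j i)) :> KS.
    rewrite -(ract_bcin (T := star T)) -fE.
    have := @ract_linl _ _ _ KS (bcin iK (ee j i)) (iK c) (f1 j (bcin iK y)) 0.
    by rewrite !addr0 (lin0 (@ract_linl _ _ _ KS _)) addr0.
  rewrite (eq_bigr _ (fun j _ => step j)) -scaler_sumr; congr (_ *: _).
  apply: (bcdot_ext (V := T)) => t; rewrite dot_sum f1E f0E /phi -idem.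
  rewrite (lin_big (W := K^o) _ lpsi); apply: eq_bigr => j _.
  rewrite bcdot_ract f1E f0E /phi.
  have -> : act (bcin iK (ee j i)) (th (tens (T := KT) (M := bc_std iK qB u) t (bcin iK y))) =
      th (tens (M := bc_std iK qB u) (@lact _ _ _ KT (bcin iK (ee j i)) t) (bcin iK y)).
    by rewrite -mhom_act /= tact_tens.
  by [].
apply: NNPP => nf; case/eqP: psi0.
have phi0 i w : phi i w = 0.
  have [w' <-] := sth w; move: w'; apply: (tens_ext (T := KT)) => [a b b'|a b b'|t y].
  - by rewrite linearP lphi.
  - by rewrite scaler0 addr0.
  rewrite -f0E -f1E (_ : f1 i y = 0).
    by rewrite /bcdot big1 // => h _; rewrite mxE mul0r.
  move: y; apply: (bchom_ext (f := f1 i) (g := mhom_zero _ _)) => y.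
  have [f2|nfi] := zero_or_nonzero (f i); last by case: nf; exists i.
  by apply: (scalerI icn); rewrite [LHS]fE f2 bcin0 /= scaler0.
have -> : Kq (bcin iK (x j0)) = \sum_i act (bcin iK (ee j0 i)) (Kq (bcin iK (x i))).
  rewrite {1}(xE (bcin iK (x j0))) linear_sum; apply: eq_bigr => i _.
  by rewrite mhom_act bclin_in //; case: xe.
by rewrite (lin_big (W := K^o) _ lpsi) big1 // => i _; apply: (phi0 i).
Qed.

End RightSide.

(** * Ringel duality *)

Lemma lfun_of (R : comNzRingType) (U V : vectType R) (f : U -> V) : linear f ->
  exists g : 'Hom(U, V), forall x, g x = f x.
Proof. by move=> lf; exists (linfun (mklin lf)) => x; rewrite lfunE. Qed.

(** * Dualising filtrations of right modules *)

Section PreDual.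
Variables (F : fieldType) (S : freeAlgType F).

Definition predual_act (X : fmod (GRing.converse S)) (a : S) (f : 'Hom(X, F^o)) : 'Hom(X, F^o) :=
  linfun (fun x => f (act (a : GRing.converse S) x) : F^o).

Fact predual_actE (X : fmod (GRing.converse S)) (a : S) f x :
  predual_act (X := X) a f x = f (act (a : GRing.converse S) x).
Proof.
have lin : linear (fun x => f (act (a : GRing.converse S) x) : F^o).
  by move=> c y z; rewrite act_linr linearP.
by rewrite /predual_act -[LHS]/(linfun (mklin lin) x) lfunE.
Qed.

(** The linear dual again; [dual X] would be a module over the double converse of [S] rather than
    over [S]. *)
Definition predual (X : fmod (GRing.converse S)) : fmod S.
Proof.
exists ('Hom(X, F^o) : vectType F) (@predual_act X) => [f c a b|a c f g|f|a b f];
  apply/lfunP => x; rewrite ?(add_lfunE, scale_lfunE, predual_actE) //.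
- by rewrite act_linl linearP.
- by rewrite act1.
- by rewrite -actM.
Defined.

(** Duality reverses exact sequences, so the dual of the top layer becomes the bottom layer, and it
    is the original [M] by reflexivity. *)
Lemma predual_filtration (L : Type) (C : L -> fmod S -> Prop) X s :
  filtration (fun l N => exists2 M, C l M & iso N (dual M)) X s ->
  exists t, filtration C (predual X) t.
Proof.
elim=> {X s} [X X0|X N Q l s i p [inji sp ker] [M CM isoQ] _ [s' Fs']].
  exists [::]; apply: FiltNil => f; apply/lfunP => x.
  by rewrite (X0 x) !linear0.
have [h [injh sh]] := iso_inj_surj isoQ.
have ev m c x y : (h (c *: x + y) : 'Hom(M, F^o)) m =
    c *: (h x : 'Hom(M, F^o)) m + (h y : 'Hom(M, F^o)) m.
  by rewrite linearP add_lfunE scale_lfunE.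
have [||||r rE] := mhom_of_rel (M := predual X) (N := predual N)
    (r := fun f g => forall x, (g : 'Hom(N, F^o)) x = (f : 'Hom(X, F^o)) (i x)).
- by move=> f; apply: lfun_of => c x y; rewrite !linearP.
- by move=> g gE; apply/lfunP => x; rewrite gE !zero_lfunE.
- move=> c f f' g g' gE gE' x.
  by rewrite [LHS]add_lfunE [RHS]add_lfunE !scale_lfunE gE gE'.
- by move=> a f g gE x; rewrite [LHS]predual_actE [RHS]predual_actE -mhom_act gE.
have [||||j jE] := mhom_of_rel (M := M) (N := predual X)
    (r := fun m g => forall x, (g : 'Hom(X, F^o)) x = (h (p x) : 'Hom(M, F^o)) m).
- by move=> m; apply: lfun_of => c x y; rewrite linearP; apply: ev.
- by move=> g gE; apply/lfunP => x; rewrite gE linear0 zero_lfunE.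
- by move=> c m m' g g' gE gE' x; rewrite add_lfunE scale_lfunE gE gE' linearP.
- by move=> a m g gE x; rewrite predual_actE gE !mhom_act [LHS]dual_actE.
(* Coordinate functionals on [M] and their preimages in [X]: these make explicit that a functional
   on [Q] is evaluation at a vector of [M]. *)
have [co coE] : exists co : 'I_(dim M) -> 'Hom(M, F^o), forall t m, co t m = v2r m 0 t.
  have ex t : exists g : 'Hom(M, F^o), forall m, g m = v2r m 0 t.
    by apply: (lfun_of (f := fun m : M => v2r m 0 t : F^o)) => c m m'; rewrite linearP !mxE.
  exists (fun t => proj1_sig (constructive_indefinite_description _ (ex t))) => t.
  by case: constructive_indefinite_description.
have [z zE] : exists z : 'I_(dim M) -> X, forall t, h (p (z t)) = co t.
  have ex t : exists x, h (p x) = co t.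
    by have [y <-] := sh (co t); have [x <-] := sp y; exists x.
  exists (fun t => proj1_sig (constructive_indefinite_description _ (ex t))) => t.
  by case: constructive_indefinite_description.
have exj : short_exact j r.
  split.
  - apply: mhom_inj => m jm; apply: (can_inj (@v2rK _ _)); rewrite linear0.
    by apply/rowP => t; rewrite -coE -zE -jE jm zero_lfunE mxE.
  - move=> g; have i0 : lker (linfun i) == 0%VS by apply/lker0P => x y; rewrite !lfunE; apply: inji.
    have [f fE] : exists f : 'Hom(X, F^o), forall x, f x = (g : 'Hom(N, F^o)) ((linfun i)^-1%VF x).
      by apply: lfun_of => c x y; rewrite !linearP.
    exists f; apply/lfunP => x; rewrite rE fE -[i x]lfunE.
    by rewrite lker0_lfunK.
  - move=> f; split=> [rf|[m <-]]; last first.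
      apply/lfunP => x; rewrite rE jE (iffRL (ker (i x))); last by exists x.
      by rewrite linear0 !zero_lfunE.
    have f0 x : p x = 0 -> (f : 'Hom(X, F^o)) x = 0.
      by move=> /ker[y <-]; rewrite -rE rf zero_lfunE.
    exists (\sum_t (f : 'Hom(X, F^o)) (z t) *: bbasis t); apply/lfunP => x; rewrite jE.
    have lhx : linear (h (p x) : 'Hom(M, F^o)) by move=> c m m'; rewrite linearP.
    rewrite (lin_sum _ _ lhx).
    have px : p (x - \sum_t (h (p x) : 'Hom(M, F^o)) (bbasis t) *: z t) = 0.
      apply: (inj_eq0 injh); apply/lfunP => m; rewrite !linearB zero_lfunE add_lfunE opp_lfunE.
      apply/eqP; rewrite subr_eq0; apply/eqP.
      rewrite !linear_sum sum_lfunE {1}[m]bbasis_sum (lin_sum _ _ lhx).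
      by apply: eq_bigr => t _; rewrite !mhomZ scale_lfunE zE coE; apply: mulrC.
    have := f0 _ px; rewrite linearB => /eqP; rewrite subr_eq0 => /eqP->.
    rewrite linear_sum; apply: eq_bigr => t _.
    by rewrite linearZ; apply: mulrC.
exists (s' ++ [:: l]); exact: filt_cat exj Fs' (filt_single CM).
Qed.

End PreDual.

(* The two posets have the same number of comparable pairs.                   *)
Lemma antitone_reflect (d d' : Order.disp_t) (X : finPOrderType d) (Y : finPOrderType d')
    (f : X -> Y) (g : Y -> X) : injective f -> injective g ->
  (forall u v, (u <= v)%O -> (f v <= f u)%O) ->
  (forall u v, (u <= v)%O -> (g v <= g u)%O) ->
  forall u v, (f u <= f v)%O -> (v <= u)%O.
Proof.
move=> injf injg fr gr.
pose RX := [set p : X * X | (p.1 <= p.2)%O]; pose RY := [set p : Y * Y | (p.1 <= p.2)%O].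
pose phi (p : X * X) := (f p.2, f p.1); pose psi (p : Y * Y) := (g p.2, g p.1).
have injphi : injective phi by move=> [a b] [c e] [/injf-> /injf->].
have injpsi : injective psi by move=> [a b] [c e] [/injg-> /injg->].
have subY : phi @: RX \subset RY.
  by apply/subsetP => _ /imsetP[p pX ->]; rewrite inE; apply: fr; rewrite inE in pX.
have subX : psi @: RY \subset RX.
  by apply/subsetP => _ /imsetP[p pY ->]; rewrite inE; apply: gr; rewrite inE in pY.
have /eqP imphi : phi @: RX == RY.
  rewrite eqEcard subY /= card_imset // -(card_imset RY injpsi).
  exact: subset_leq_card.
move=> u v fuv; have : (f u, f v) \in RY by rewrite inE.
by rewrite -imphi => /imsetP[[a b]]; rewrite inE => ab [/injf-> /injf->].
Qed.

(** * Faithfulness modulo the maximal ideal removes denominators *)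

Section Divisibility.
Variables (l : nat) (O : idomainType) (K k : fieldType).
Variables (iK : {rmorphism O -> K}) (ik : {rmorphism O -> k}).
Hypothesis hO : modular_system l iK ik.
Variables (U V : vectType O) (b : U -> V -> V).
Hypotheses (bl : forall y, linear (b^~ y)).
Hypothesis b_faithful : forall u, (forall x, bcin ik (b u x) = 0) -> bcin ik u = 0.

Lemma content (W : vectType O) (w : W) : w != 0 ->
  exists2 c, c != 0 & exists2 w', bcin ik w' != 0 & w = c *: w'.
Proof.
move=> w0; have [|c [i0 cE] cmin] := min_divisor hO (I := fun a => exists i, a = v2r w 0 i).
  have [d0|d0] := posnP (dim W); last by exists (v2r w 0 (Ordinal d0)), (Ordinal d0).
  case/eqP: w0; apply: (can_inj (@v2rK _ _)); apply/rowP => h.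
  by case: h => h lt; exfalso; rewrite d0 in lt.
have c0 : c != 0.
  apply: contra w0 => /eqP c0; apply/eqP; apply: (can_inj (@v2rK _ _)).
  rewrite linear0; apply/rowP => h; rewrite [RHS]mxE.
  by have [|a ->] := cmin (v2r w 0 h); [exists h | rewrite c0 mulr0].
have co i : exists a, v2r w 0 i = a * c by apply: cmin; exists i.
pose a i := proj1_sig (constructive_indefinite_description _ (co i)).
have aE i : v2r w 0 i = a i * c by rewrite /a; case: constructive_indefinite_description.
exists c => //; exists (r2v (\row_i a i)).
  apply/eqP => /matrixP/(_ 0 i0); rewrite /bcin r2vK !mxE.
  move: cE; rewrite aE -{1}[c]mul1r => /(mulIf c0) <-.
  by rewrite rmorph1 => /eqP; rewrite oner_eq0.
rewrite -[LHS]v2rK -linearZ; congr r2v; apply/rowP => i.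
by rewrite aE !mxE mulrC.
Qed.

Let bZ c u x : b (c *: u) x = c *: b u x.
Proof. by have := bl x c u 0; rewrite !addr0 (lin0 (bl x)) addr0. Qed.

Lemma bilinear_faithful u : (forall x, b u x = 0) -> u = 0.
Proof.
move=> bu; apply/eqP; case: eqP => // /eqP /content[c c0 [u' u'0 uE]].
case/eqP: u'0; apply: b_faithful => x.
rewrite (_ : b u' x = 0) ?bcin0 //; apply: (scaleO_inj hO c0).
by rewrite -bZ -uE bu scaler0.
Qed.

(** Write u = e u' with u' nonzero modulo the maximal ideal. If [c] divides [e], the division is
    immediate. Otherwise c = a e and a f = u'; were [a] not a unit, u' would act as zero modulo the
    maximal ideal, against faithfulness. *)
Lemma bilinear_divide c (f : V -> V) u : c != 0 -> (forall x, c *: f x = b u x) ->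
  exists u', forall x, f x = b u' x.
Proof.
move=> c0 cf; have [u0|/content[e e0 [u' u'0 uE]]] := eqVneq u 0.
  exists 0 => x; apply: (scaleO_inj hO c0).
  by rewrite cf u0 (lin0 (bl x)) scaler0.
have [[a aE]|[a aE]] := divides_total hO e c.
  exists (a *: u') => x; apply: (scaleO_inj hO c0).
  by rewrite cf uE bZ -!bZ scalerA mulrC -aE.
have af x : a *: f x = b u' x.
  by apply: (scaleO_inj hO e0); rewrite scalerA mulrC -aE cf uE bZ.
have [ua|na] := boolP (a \is a GRing.unit).
  by exists (a^-1 *: u') => x; rewrite bZ -af scalerA mulVr ?scale1r.
case/eqP: u'0; apply: b_faithful => x; rewrite -af bcinZ.
by have [_ _ [_ kerk] _ _] := hO; rewrite (iffRL (kerk a)) ?scale0r.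
Qed.

End Divisibility.

Theorem theorem109 (l : nat) (O : idomainType) (K k : fieldType)
    (iK : {rmorphism O -> K}) (ik : {rmorphism O -> k})
    (hO : modular_system l iK ik)
    (A B : freeAlgType O) (dL dU : Order.disp_t)
    (Lambda : finPOrderType dL) (Upsilon : finPOrderType dU)
    (qA : split_qh A Lambda) (qB : split_qh B Upsilon)
    (hA : semisimple_alg (bc iK A)) (hB : semisimple_alg (bc iK B))
    (T : bimod A B)
    (hTl : left_Kk_tilting iK ik qA T) (hTr : right_Kk_tilting iK ik qB T)
    (* [KT (x)_KB -] *)
    (hEl : is_equivalence (tensor (bc_bimod iK T)))
    (* [- (x)_KA KT], right modules being left modules over opposite algebras *)
    (hEr : is_equivalence (tensor (flip (bc_bimod iK T))))
    (hol : order_reversing (tensor (bc_bimod iK T))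
             (bc_std iK qB) (bc_std iK qA))
    (hor : order_reversing (tensor (flip (bc_bimod iK T)))
             (fun a => dual (bc_std iK qA a)) (fun u => dual (bc_std iK qB u))) :
  ringel_duality (qh_weights ik qA) (bc_bimod ik T)
  /\ right_action_iso T
  /\ left_action_iso T.
Proof.
have [_ tT] := hTl; have [_ tTr] := hTr.
have [sigma [sigma_bij sigma_iso sigma_rev]] := hol.
have [tau [tau_bij _ tau_rev]] := hor.
(* The bijection of the second functor, in the opposite direction, makes sigma an anti-isomorphism
   of posets. *)
have sigma_refl := antitone_reflect (bij_inj sigma_bij) (bij_inj tau_bij) sigma_rev tau_rev.
have left a : (exists2 X, indec_tilting (qh_weights ik qA) a X & summand X (lmod (bc_bimod ik T)))
    /\ exists h : mhom (bc_std ik qA a) (lmod (bc_bimod ik T)), injective h.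
  have [sigma' _ sigmaK] := sigma_bij; rewrite -(sigmaK a); set u := sigma' a.
  have [n [x [e xe]]] := projective_dual_basis (cov_proj (chosen_cover qB u)).
  apply: (tilting_summand hO (dual_basis_idempotent xe) tT).
  - exact: (left_tuple_le hO hB hEl sigma_bij sigma_iso sigma_rev xe).
  - exact: (left_tuple_prop hO hB hEl sigma_iso xe).
  - exact: (left_tuple_exists hO hB hEl sigma_iso xe).
(* The layers of a standard filtration of the right module kT are duals of costandard left modules,
   so dualising gives a costandard filtration of the reduction of [star T], and likewise with the
   two kinds exchanged. *)
have tS : tilting (qh_weights ik qB) (lmod (bc_bimod ik (star T))).
  have isoS : iso (predual (rmod (bc_bimod ik T))) (lmod (bc_bimod ik (star T))).
    apply: iso_sym.
    have [||||j jE] := mhom_of_rel (M := lmod (bc_bimod ik (star T)))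
        (N := predual (rmod (bc_bimod ik T)))
        (r := fun y f => forall t, (f : 'Hom(rmod (bc_bimod ik T), k^o)) t = bcdot (V := T) y t).
    - by move=> y; apply: lfun_of => c t t'; apply: (bcdot_linr (V := T)).
    - move=> f fE; apply/lfunP => t; rewrite fE zero_lfunE /bcdot big1 // => i _.
      by rewrite mxE mul0r.
    - move=> c y y' f f' fE fE' t.
      by rewrite [LHS]add_lfunE scale_lfunE fE fE' (bcdot_linl (V := T)).
    - by move=> b y f fE t; rewrite [LHS]predual_actE fE [RHS]bcdot_lact.
    apply: (inj_surj_iso (f := j)).
      by move=> y y' e; apply: (bcdot_ext (V := T)) => t; rewrite -!jE e.
    move=> f; exists (\row_i (f : 'Hom(rmod (bc_bimod ik T), k^o)) (delta_mx 0 i) : bc ik T).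
    apply/lfunP => t; rewrite jE; move: t.
    apply: (bc_ext (phi := ik) (V := T) (W := k^o)) => [c t t'|c t t'|t].
    - exact: (bcdot_linr (V := T)).
    - by rewrite linearP.
    rewrite {2}[t]bbasis_sum bcin_sum linear_sum /bcdot; apply: eq_bigr => i _.
    by rewrite bcinZ bcin_basis linearZ !mxE mulrC.
  have [[s Fs] [t Ft]] := tTr.
  have [s' Fs'] := predual_filtration Ft; have [t' Ft'] := predual_filtration Fs.
  by split; [exists s' | exists t']; apply: filt_iso isoS _.
(* Now [star T] takes the place of [T], and the idempotent matrix comes from the projective A-module
   above Delta(sigma u). *)
have right u : exists h : mhom (bc_std ik qB u) (lmod (bc_bimod ik (star T))), injective h.
  have [n [x [e xe]]] := projective_dual_basis (cov_proj (chosen_cover qA (sigma u))).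
  suff [] : (exists2 X, indec_tilting (qh_weights ik qB) u X & summand X (lmod (bc_bimod ik (star T))))
    /\ exists h : mhom (bc_std ik qB u) (lmod (bc_bimod ik (star T))), injective h by [].
  apply: (tilting_summand hO (dual_basis_idempotent xe) tS).
  - exact: (right_tuple_le hO sigma_iso sigma_refl xe).
  - exact: (right_tuple_prop hO sigma_iso xe).
  - exact: (right_tuple_exists hO sigma_iso xe).
have faithA (a : bc ik A) : (forall t : bc_bimod ik T, lact a t = 0) -> a = 0.
  have [_ [t Ft]] := tT.
  exact: (tilting_faithful (hw_data_reduction hO qA) Ft (fun a => (left a).2)).
have faithB (b : bc ik B) : (forall t : bc_bimod ik T, ract t b = 0) -> b = 0.
  move=> b0; have [_ [t Ft]] := tS.
  apply: (tilting_faithful (hw_data_reduction hO qB) Ft right) => y.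
  apply: (bcdot_ext (V := T)) => s; rewrite [LHS]bcdot_lact b0 /bcdot big1 => [|i _].
    by rewrite big1 // => i _; rewrite mxE mul0r.
  by rewrite [X in _ * X]mxE mulr0.
have faithB' (b : B) : (forall t : T, bcin ik (ract t b) = 0) -> bcin ik b = 0.
  move=> b0; apply: faithB; apply: (bc_ext (phi := ik) (V := T)) => [c t t'|c t t'|t].
  - exact: (@ract_linl _ _ _ (bc_bimod ik T)).
  - by rewrite scaler0 addr0.
  by rewrite ract_bcin.
have faithA' (a : A) : (forall t : T, bcin ik (lact a t) = 0) -> bcin ik a = 0.
  move=> a0; apply: faithA; apply: (bc_ext (phi := ik) (V := T)) => [c t t'|c t t'|t].
  - exact: (@lact_linr _ _ _ (bc_bimod ik T)).
  - by rewrite scaler0 addr0.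
  by rewrite lact_bcin.
have isoB : right_action_iso T.
  (* Over K, [f] is right multiplication by [beta]; a multiple c beta is integral, and [c] is
     removed by faithfulness of kT over kB. *)
  move=> f; have [beta betaE] := tensor_end_full hEl (bchom iK f : mhom (lmod (bc_bimod iK T)) (lmod (bc_bimod iK T))).
  have [c c0 /(_ ord0)[b bE]] := common_denominator hO (fun _ : 'I_1 => beta).
  have [|b' b'E] := bilinear_divide hO (b := fun (b : B) (t : T) => ract t b)
      (fun t => @ract_linr _ _ _ T t) faithB' (f := f) (u := b) c0.
    move=> t; apply: (bcinK_inj hO); rewrite -ract_bcin -bE bcinZ.
    have -> : bcin iK (f t : T) = ract (bcin iK t : bc_bimod iK T) beta.
      by rewrite -betaE; apply: (esym (bchom_in iK f t)).
    have := @ract_linr _ _ _ (bc_bimod iK T) (bcin iK t) (iK c) beta 0.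
    by rewrite !addr0 (lin0 (@ract_linr _ _ _ (bc_bimod iK T) _)) addr0.
  exists b'; split=> // b2 b2E; apply/eqP; rewrite -subr_eq0; apply/eqP.
  apply: (bilinear_faithful hO (b := fun (b : B) (t : T) => ract t b) (fun t => @ract_linr _ _ _ T t) faithB').
  by move=> t; rewrite ract_subr -b'E -b2E subrr.
split; last split=> //.
- split.
    by split=> // a; case: (left a).
  move=> f; have [[s Fs] [t Ft]] := tT.
  (* kT has both filtrations, so Ext^1(kT, kT) = 0 and every endomorphism of kT comes from one of
     [T], hence from [B]. *)
  have [g gE] := hom_lift hO (M := lmod T) (N := lmod T) f (std_costd_ext (hw_data_reduction hO qA) Fs Ft).
  have [b [bE _]] := isoB g; exists (bcin ik b); split=> [|b2 b2E].
    apply: (bc_ext (phi := ik) (V := T)) => [c x y|c x y|x]; first by rewrite linearP.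
      exact: (@ract_linl _ _ _ (bc_bimod ik T)).
    by rewrite gE bE ract_bcin.
  apply/eqP; rewrite -subr_eq0; apply/eqP; apply: faithB => x.
  rewrite (ract_subr (T := bc_bimod ik T)) -b2E; apply/eqP; rewrite subr_eq0; apply/eqP.
  move: x; apply: (bc_ext (phi := ik) (V := T)) => [c x y|c x y|x].
  - exact: (@ract_linl _ _ _ (bc_bimod ik T)).
  - by rewrite linearP.
  by rewrite gE bE ract_bcin.
move=> f.
have lf : linear f by move=> c x y; rewrite linearP.
(* [bchom] would produce a module over the base change of the converse of [B], while the flipped
   functor uses the converse of the base change; the scalar extension of [f] is therefore checked to
   be KB-linear by hand. *)
have Kf_act (a : bc iK B) (x : bc_bimod iK T) : bclin iK f (ract x a) = ract (bclin iK f x : bc_bimod iK T) a.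
  move: a; apply: (bc_ext (phi := iK) (V := B)) => [c a a'|c a a'|a].
  - by rewrite (@ract_linr _ _ _ (bc_bimod iK T)) bclin_linear.
  - exact: (@ract_linr _ _ _ (bc_bimod iK T)).
  move: x; apply: (bc_ext (phi := iK) (V := T)) => [c x y|c x y|x].
  - by rewrite (@ract_linl _ _ _ (bc_bimod iK T)) bclin_linear.
  - by rewrite bclin_linear; apply: (@ract_linl _ _ _ (bc_bimod iK T)).
  by rewrite ract_bcin !bclin_in // ract_bcin -[ract (f x) a]/(act (a : GRing.converse B) (f x : rmod T)) -mhom_act.
have [alpha alphaE] := tensor_end_full hEr
  (@mkhom _ _ (lmod (flip (bc_bimod iK T))) (lmod (flip (bc_bimod iK T))) (bclin iK f) (@bclin_linear _ _ iK _ _ f) Kf_act).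
have [c c0 /(_ ord0)[a aE]] := common_denominator hO (fun _ : 'I_1 => (alpha : bc iK A)).
have [|a' a'E] := bilinear_divide hO (b := fun (a : A) (t : T) => lact a t)
    (fun t => @lact_linl _ _ _ T t) faithA' (f := f) (u := a) c0.
  move=> t; apply: (bcinK_inj hO); rewrite -lact_bcin -aE bcinZ.
  have -> : bcin iK (f t : T) = @lact _ _ _ (bc_bimod iK T) alpha (bcin iK t).
    by rewrite -(bclin_in iK t lf); apply: alphaE.
  have := @lact_linl _ _ _ (bc_bimod iK T) (bcin iK t) (iK c) alpha 0.
  by rewrite !addr0 (lin0 (@lact_linl _ _ _ (bc_bimod iK T) _)) addr0.
exists a'; split=> // a2 a2E; apply/eqP; rewrite -subr_eq0; apply/eqP.
apply: (bilinear_faithful hO (b := fun (a : A) (t : T) => lact a t) (fun t => @lact_linl _ _ _ T t) faithA').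
by move=> t; rewrite lact_subl -a'E -a2E subrr.
Qed.
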